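(* Not every differentiable family of complete affine $2$-tori is induced by a smooth map into the deformation space $\mathfrak{D}_c(T^2)$ (with the differentiable structure given by the period coordinates $\mathsf{p}$). Explicitly, for $a\in\mathbb{R}$ let $$\Phi_a\colon\mathbb{R}^2\to\mathbb{A}^2,\qquad \Phi_a(x,y)=\big(x,\ y+\tfrac12 a x^2\big).$$ Then the $\Phi_a$, $a\in\mathbb{R}$, form a differentiable family of developing maps of complete affine structures on $T^2=\mathbb{R}^2/\mathbb{Z}^2$, giving a differentiable family $\mathcal{E}\to\mathbb{R}$ whose fibre $\mathcal{E}_a$ is the complete affine torus marked by $\Phi_a$, and the corresponding curve $\mathbb{R}\to\mathfrak{D}_c(T^2)$ is given in period coordinates by $$a\longmapsto \mathsf{p}(\mathcal{E}_a)=(-a^{1/3},\,0),$$ where $a^{1/3}$ is the real cube root; in particular it is not smooth at $a=0$.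
   Context: Affine structures. $\mathbb{A}^2$ is real affine $2$-space with an orientation and $\mathsf{Aff}(2)$ is its group of orientation-preserving affine automorphisms. An affine structure on an oriented smooth surface is a maximal atlas of (orientation-compatible) charts into $\mathbb{A}^2$ whose transition maps are locally restrictions of elements of $\mathsf{Aff}(2)$; equivalently it is given by a flat torsionfree affine connection $\nabla$. A developing map for $T^2=\mathbb{R}^2/\mathbb{Z}^2$ is a local diffeomorphism $\mathbb{R}^2\to\mathbb{A}^2$ equivariant with respect to the translation action of $\mathbb{Z}^2$ on $\mathbb{R}^2$ and an affine action of $\mathbb{Z}^2$ on $\mathbb{A}^2$ given by a homomorphism $\mathbb{Z}^2\to\mathsf{Aff}(2)$ (the holonomy); the structure is complete if the developing map is a diffeomorphism. A complete affine $2$-torus is Euclidean if it is affinely diffeomorphic to a quotient of $\mathbb{A}^2$ by a lattice of translations, and non-Riemannian otherwise. The family. Let $h_a\colon\mathbb{Z}^2\to\mathsf{Aff}(2)$ be the holonomy of $\Phi_a$, $h_a(\gamma)=\Phi_a\circ T_\gamma\circ\Phi_a^{-1}$ with $T_\gamma$ translation by $\gamma$. $\mathcal{E}$ is the quotient of $\mathbb{R}\times\mathbb{A}^2$ by the $\mathbb{Z}^2$-action $\gamma\cdot(a,v)=(a,h_a(\gamma)v)$, with projection to the first factor; the fibre is $\mathcal{E}_a=\mathbb{A}^2/h_a(\mathbb{Z}^2)$, marked by the diffeomorphism $f_a\colon T^2\to\mathcal{E}_a$ induced by $\Phi_a$ (and oriented so that $f_a$ preserves orientation). A differentiable family of complete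 affine tori over a base manifold is a smooth torus bundle with locally trivializing charts defining complete affine structures on the fibres that vary smoothly with the base point. Deformation space and periods. A marked complete affine torus is a pair $(f,M)$ with $M$ an oriented complete affine $2$-torus and $f\colon T^2\to M$ an orientation-preserving diffeomorphism; $(f,M)$ and $(f',M')$ are isotopic if there is an affine diffeomorphism $\varphi\colon M\to M'$ such that $\varphi\circ f$ and $f'$ are related by a diffeomorphism of $T^2$ in the identity component of the group of orientation-preserving diffeomorphisms. $\mathfrak{D}_c(T^2)$ is the set of isotopy classes. A tensor field on $M$ is parallel if its coefficients in affine coordinates are constant, and polynomial if its coefficients in affine coordinates are polynomial. For an oriented non-Riemannian $M$ let $\omega_M$ be the parallel area form with $\int_M\omega_M=1$; there is a unique parallel vector field $\zeta_M$ such that $\zeta_M=\nabla_{\xi_M}\xi_M$ and $\omega_M(\zeta_M,\xi_M)=1$ for some polynomial vector field $\xi_M$. Put $\eta_M=\iota_{\zeta_M}\omega_M$. With $\alpha_1=(1,0),\alpha_2=(0,1)$ the standard generators of $\pi_1(T^2)\cong\mathbb{Z}^2$, define $\mathsf{p}(f,M)=\big(\int_{\alpha_1}f^*\eta_M,\int_{\alpha_2}f^*\eta_M\big)$ if $M$ is non-Riemannian and $\mathsf{p}(f,M)=(0,0)$ if $M$ is Euclidean. The map $\mathsf{p}\colon\mathfrak{D}_c(T^2)\to\mathbb{R}^2$ is a bijection (a homeomorphism for the natural topology), and the differentiable structure on $\mathfrak{D}_c(T^2)$ is the one making $\mathsf{p}$ a diffeomorphism. $\mathsf{p}(\mathcal{E}_a)$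 means $\mathsf{p}(f_a,\mathcal{E}_a)$. *)

(* Defs.v *)
From HB Require Import structures.
From mathcomp Require Import all_boot all_order all_algebra.
From mathcomp Require Import all_classical all_reals all_analysis.

Set Implicit Arguments.
Unset Strict Implicit.
Unset Printing Implicit Defensive.

Import Order.TTheory GRing.Theory Num.Theory.
Import numFieldNormedType.Exports.

Local Open Scope classical_set_scope.
Local Open Scope ring_scope.

(** * Smooth maps and smooth manifolds *)

Section Manifolds.
Context {R : realType}.

(* Every model space below is finite dimensional (a product of R^n's).  There
   f is C^k on an open set iff all its iterated directional derivatives up to
   order k exist and are continuous on it. *)
Fixpoint Ck_on {V W : normedModType R} (k : nat) (D : set V) (f : V -> W)
    : Prop :=
  (forall x, D x -> {for x, continuous f}) /\
  if k is k'.+1 then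
    forall v : V, (forall x, D x -> derivable f x v) /\ Ck_on k' D ('D_v f)
  else True.

Definition smooth_on {V W : normedModType R} (D : set V) (f : V -> W) :=
  forall k, Ck_on k D f.

Definition smooth_near {V W : normedModType R} (f : V -> W) (x : V) :=
  exists D : set V, [/\ open D, D x & smooth_on D f].

(* Manifolds are sets with an atlas, the topology being the one induced by the
   charts.  An atlas stands for the maximal atlas it generates: nothing below
   changes if compatible charts are added.  A chart carries its coordinate map
   (relevant on [dom]) and the inverse (relevant on the image of [dom]). *)
Record chart (M : Type) (V : normedModType R) := Chart {
  dom : set M;
  cmap : M -> V;
  cinv : V -> M }.

Definition chart_ok {M : Type} {V : normedModType R} (c : chart M V) :=
  open (cmap c @` dom c) /\ forall p, dom c p -> cinv c (cmap c p) = p.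

Definition smooth_at {M N : Type} {V W : normedModType R}
    (a : set (chart M V)) (a' : set (chart N W)) (f : M -> N) (p : M) :=
  forall c d, a c -> a' d -> dom c p -> dom d (f p) ->
    (\forall y \near cmap c p, dom d (f (cinv c y))) /\
    smooth_near (fun y => cmap d (f (cinv c y))) (cmap c p).

Definition smooth_map {M N : Type} {V W : normedModType R}
    (a : set (chart M V)) (a' : set (chart N W)) (f : M -> N) :=
  forall p, smooth_at a a' f p.

Definition mdiffeo {M N : Type} {V W : normedModType R}
    (a : set (chart M V)) (a' : set (chart N W)) (f : M -> N) :=
  exists g : N -> M,
    [/\ cancel f g, cancel g f, smooth_map a a' f & smooth_map a' a g].

Definition mopen {M : Type} {V : normedModType R} (a : set (chart M V))
    (U : set M) :=
  forall c p, a c -> dom c p -> U p ->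
    \forall y \near cmap c p, U (cinv c y).

Definition mhausdorff {M : Type} {V : normedModType R} (a : set (chart M V)) :=
  forall p q : M, p <> q ->
    exists A B : set M, [/\ mopen a A, mopen a B, A p, B q & A `&` B = set0].

(* Smoothness of the identity says that domains overlap in open sets and that
   all coordinate changes are smooth; the last clause is second countability. *)
Definition smooth_manifold {M : Type} {V : normedModType R}
    (a : set (chart M V)) :=
  [/\ forall c, a c -> chart_ok c,
      forall p, exists2 c, a c & dom c p,
      smooth_map a a id,
      mhausdorff a
    & exists s : nat -> chart M V,
        (forall k, a (s k)) /\ forall p, exists k, dom (s k) p].

(* The atlas of all local sections of q : V -> M.  When q is the projection to
   the quotient by a free and properly discontinuous action, this is the
   structure on the quotient making q a local diffeomorphism. *)
Definition cover_atlas {M : Type} {V : normedModType R} (q : V -> M)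
    : set (chart M V) :=
  [set c | chart_ok c /\ cinv c = q].

Definition vec_atlas (V : normedModType R) : set (chart V V) :=
  cover_atlas (fun x : V => x).

Definition prod_chart {M N : Type} {V W : normedModType R}
    (c : chart M V) (d : chart N W) : chart (M * N) (V * W)%type :=
  @Chart (M * N)%type (V * W)%type (dom c `*` dom d)
    (fun p => (cmap c p.1, cmap d p.2)) (fun y => (cinv c y.1, cinv d y.2)).

Definition prod_atlas {M N : Type} {V W : normedModType R}
    (a : set (chart M V)) (a' : set (chart N W))
    : set (chart (M * N) (V * W)%type) :=
  [set e | exists c d, [/\ a c, a' d & e = prod_chart c d]].

(* R as a 1-dimensional manifold with charts into R^1. *)
Definition line_atlas : set (chart R 'rV[R]_1) :=
  cover_atlas (fun y : 'rV[R]_1 => y 0 0).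

End Manifolds.

Arguments vec_atlas {R} V.

(** * Orbit spaces *)

Section Orbits.
Context {G T : Type} (act : G -> T -> T).

Definition orb (p : T) : set T := range (act ^~ p).
Definition orbit_space := {C : set T | exists p, C = orb p}.
Definition orbit_cls (p : T) : orbit_space :=
  exist _ (orb p) (ex_intro _ p erefl).
Definition orbit_repr (C : orbit_space) : T := projT1 (cid (svalP C)).

End Orbits.

(** * Affine structures on the 2-torus *)

Section AffineTori.
Context {R : realType}.

Local Notation A2 := 'rV[R]_2.
Local Notation Z2 := 'rV[int]_2.

Definition row2 (x y : R) : A2 := \row_(j < 2) (if j == 0 then x else y).

Definition zvec (g : Z2) : A2 := map_mx intr g.

Definition Aff2 : set (A2 -> A2) :=
  [set f | exists (A : 'M[R]_2) (b : A2),
     0 < \det A /\ f = fun v => v *m A + b].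

Definition transl (g : Z2) (x : A2) : A2 := x + zvec g.
Definition T2 : Type := orbit_space transl.
Definition pi2 : A2 -> T2 := orbit_cls transl.
Definition T2_atlas : set (chart T2 A2) := cover_atlas pi2.

(* Oriented affine surfaces; the orientation is the one for which the affine
   charts are orientation preserving. *)
Definition affine_surface {M : Type} (a : set (chart M A2)) :=
  smooth_manifold a /\
  forall c d p, a c -> a d -> dom c p -> dom d p ->
    exists2 g, Aff2 g & \forall y \near cmap c p, cmap d (cinv c y) = g y.

Definition affine_diffeo {M N : Type} (a : set (chart M A2))
    (a' : set (chart N A2)) (f : M -> N) :=
  bijective f /\
  forall c d p, a c -> a' d -> dom c p -> dom d (f p) ->
    exists (A : 'M[R]_2) (b : A2), A \in unitmx /\
      \forall y \near cmap c p,
        dom d (f (cinv c y)) /\ cmap d (f (cinv c y)) = y *m A + b.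

(* The rows of L are a basis of the lattice. *)
Definition lattice_act (L : 'M[R]_2) (g : Z2) (x : A2) : A2 := x + zvec g *m L.

Definition euclidean {M : Type} (a : set (chart M A2)) :=
  exists2 L : 'M[R]_2, L \in unitmx &
  exists f : M -> orbit_space (lattice_act L),
    affine_diffeo a (cover_atlas (orbit_cls (lattice_act L))) f.

Definition local_diffeo (f : A2 -> A2) :=
  forall x, exists (U : set A2) (g : A2 -> A2),
    [/\ open U, U x, open (f @` U)
      & [/\ smooth_on U f, smooth_on (f @` U) g
          & forall y, U y -> g (f y) = y]].

Definition diffeo (f : A2 -> A2) :=
  exists g, [/\ cancel f g, cancel g f, smooth_on setT f & smooth_on setT g].

Definition developing_map (dev : A2 -> A2) (h : Z2 -> A2 -> A2) :=
  [/\ local_diffeo dev,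
      forall g, Aff2 (h g),
      forall g g', h (g + g') = h g \o h g'
    & forall g x, dev (transl g x) = h g (dev x)].

(* An affine surface together with a map from the torus. *)
Record marked := Marked {
  msurf : Type;
  matlas : set (chart msurf A2);
  mmap : T2 -> msurf }.

(* dev is an affine chart near every point, for the structure pulled back to
   R^2 through T^2. *)
Definition develops (m : marked) (dev : A2 -> A2) :=
  forall x d, matlas d -> dom d (mmap m (pi2 x)) ->
    (\forall y \near x, dom d (mmap m (pi2 y))) /\
    exists2 g, Aff2 g &
      \forall y \near x, cmap d (mmap m (pi2 y)) = g (dev y).

Definition complete_dev (m : marked) (dev : A2 -> A2) (h : Z2 -> A2 -> A2) :=
  [/\ developing_map dev h, develops m dev & diffeo dev].

Definition orientation_preserving {M N : Type} (a : set (chart M A2))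
    (a' : set (chart N A2)) (f : M -> N) :=
  forall c d p, a c -> a' d -> dom c p -> dom d (f p) ->
    0 < \det (jacobian (fun y => cmap d (f (cinv c y))) (cmap c p)).

Definition complete_marked (m : marked) :=
  [/\ affine_surface (@matlas m),
      mdiffeo T2_atlas (@matlas m) (mmap m),
      orientation_preserving T2_atlas (@matlas m) (mmap m)
    & exists dev h, complete_dev m dev h].

(** ** The deformation space *)

(* Diffeomorphisms in the identity component: those joined to the identity by
   a smooth isotopy. *)
Definition diff0 (g : T2 -> T2) :=
  exists G : R -> T2 -> T2,
    [/\ smooth_map (prod_atlas line_atlas T2_atlas) T2_atlas
          (fun z => G z.1 z.2),
        forall t, mdiffeo T2_atlas T2_atlas (G t),
        G 0 = id
      & G 1 = g].

Definition isotopic (m m' : marked) :=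
  exists (phi : msurf m -> msurf m') (g : T2 -> T2),
    [/\ affine_diffeo (@matlas m) (@matlas m') phi, diff0 g
      & forall t, phi (mmap m t) = mmap m' (g t)].

Definition iso_class (m : marked) : marked -> Prop :=
  fun m' => complete_marked m' /\ isotopic m m'.

Definition Dc (C : marked -> Prop) : Prop :=
  exists2 m, complete_marked m & C = iso_class m.

(** ** Tensor fields in affine coordinates and the period map *)

(* A vector field is given by its component vector in each chart, an area form
   by the coefficient of du /\ dv in each chart (u, v), a 1-form by the
   covector in each chart; values outside of the atlas or of the domain of the
   chart are irrelevant. *)
Definition vfield (M : Type) := chart M A2 -> M -> A2.
Definition aform (M : Type) := chart M A2 -> M -> R.
Definition oneform (M : Type) := chart M A2 -> M -> A2 -> R.

Section Fields.
Context {M : Type} (a : set (chart M A2)).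

Definition is_vfield (xi : vfield M) :=
  forall c d p, a c -> a d -> dom c p -> dom d p ->
    xi d p = 'D_(xi c p) (fun y => cmap d (cinv c y)) (cmap c p).

Definition is_aform (om : aform M) :=
  forall c d p, a c -> a d -> dom c p -> dom d p ->
    om c p =
      om d p * \det (jacobian (fun y => cmap d (cinv c y)) (cmap c p)).

(* The domain of a chart need not be connected, so that constant coefficients
   mean locally constant ones here. *)
Definition parallel {W : Type} (F : chart M A2 -> M -> W) :=
  forall c p, a c -> dom c p ->
    \forall y \near cmap c p, F c (cinv c y) = F c p.

(* P.[v%:P].[u] is the value at (u, v) of the bivariate polynomial P. *)
Definition polynomial_vfield (xi : vfield M) :=
  is_vfield xi /\
  forall c p, a c -> dom c p -> exists P Q : {poly {poly R}},
    \forall y \near cmap c p,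
      xi c (cinv c y) = row2 P.[(y 0 1)%:P].[y 0 0] Q.[(y 0 1)%:P].[y 0 0].

(* Covariant derivative of xi along itself: in affine charts the connection is
   the standard one. *)
Definition nabla_self (xi : vfield M) : vfield M :=
  fun c p => 'D_(xi c p) (fun y => xi c (cinv c y)) (cmap c p).

Definition det2 (u w : A2) : R := u 0 0 * w 0 1 - u 0 1 * w 0 0.

Definition contract (ze : vfield M) (om : aform M) : oneform M :=
  fun c p w => om c p * det2 (ze c p) w.

End Fields.

Section Periods.
Variable m : marked.
Local Notation a := (@matlas m).
Local Notation f := (fun x => mmap m (pi2 x)).

(* Coefficient at x of the pull-back to R^2 of an area form, computed in any
   chart around the image of x. *)
Definition pull_area (om : aform (msurf m)) (x : A2) : R :=
  xget 0 [set s | exists c, [/\ a c, dom c (f x)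
    & s = om c (f x) * \det (jacobian (fun y => cmap c (f y)) x)]].

Definition pull_oneform (eta : oneform (msurf m)) (x w : A2) : R :=
  xget 0 [set s | exists c, [/\ a c, dom c (f x)
    & s = eta c (f x) ('D_w (fun y => cmap c (f y)) x)]].

(* The integral over M of an area form, computed on T^2 by means of the
   (orientation preserving) marking. *)
Definition area_int (om : aform (msurf m)) : R :=
  \int[@lebesgue_measure R]_(y in `[0, 1])
    (\int[@lebesgue_measure R]_(x in `[0, 1]) pull_area om (row2 x y)).

(* The integral over the generator alpha_i of the pull-back of a 1-form. *)
Definition loop_int (i : 'I_2) (eta : oneform (msurf m)) : R :=
  \int[@lebesgue_measure R]_(t in `[0, 1])
    pull_oneform eta (t *: delta_mx 0 i) (delta_mx 0 i).

Definition normal_area (om : aform (msurf m)) :=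
  [/\ is_aform a om, parallel a om & area_int om = 1].

Definition normal_field (om : aform (msurf m)) (ze : vfield (msurf m)) :=
  [/\ is_vfield a ze, parallel a ze
    & exists2 xi, polynomial_vfield a xi &
        forall c p, a c -> dom c p ->
          ze c p = nabla_self xi c p /\ om c p * det2 (ze c p) (xi c p) = 1].

(* om and ze are unique for a complete non-Riemannian torus. *)
Definition period : A2 :=
  if `[< euclidean a >] then 0 else
  xget 0 [set v | exists om ze, [/\ normal_area om, normal_field om ze
    & v = \row_(i < 2) loop_int i (contract ze om)]].

End Periods.

(* The period map on isotopy classes; the value does not depend on the
   representative. *)
Definition Dc_period (C : marked -> Prop) : A2 :=
  xget 0 [set v | exists2 m, C m & v = period m].

(** ** Families *)

Record torus_family (B : Type) (n : nat) := TorusFamily {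
  tot : Type;
  tot_atlas : set (chart tot ('rV[R]_n * A2)%type);
  proj : tot -> B;
  fib_atlas : forall b, set (chart {e : tot | proj e = b} A2) }.

Definition fibre {B : Type} {n : nat} (X : torus_family B n) (b : B) : Type :=
  {e : tot X | proj e = b}.

Definition marked_fibre {B : Type} {n : nat} (X : torus_family B n) (b : B)
    (f : T2 -> fibre X b) : marked :=
  @Marked (fibre X b) (@fib_atlas B n X b) f.

Section FamilyPredicates.
Context {B : Type} {n : nat} (aB : set (chart B 'rV[R]_n))
  (X : torus_family B n).

(* The maps tau b for b in U form a trivialization U x T^2 -> proj^-1(U), of
   inverse e |-> (proj e, theta e); each one is a marking of the fibre. *)
Definition trivialization (U : set B) (tau : forall b, T2 -> fibre X b) :=
  [/\ forall b t, U b ->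
        smooth_at (prod_atlas aB T2_atlas) (@tot_atlas _ _ X)
          (fun z => sval (tau z.1 z.2)) (b, t),
      exists theta : tot X -> T2,
        (forall e, U (proj e) ->
           smooth_at (@tot_atlas _ _ X) T2_atlas theta e /\
           sval (tau (proj e) (theta e)) = e) /\
        (forall b t, U b -> theta (sval (tau b t)) = t)
    & forall b, U b -> complete_marked (marked_fibre (tau b))].

(* Differentiable families of complete affine tori: the affine structures vary
   smoothly in the sense that, over small open sets, the fibres have developing
   diffeomorphisms depending smoothly on the base point, so that the maps
   (b, dev b x) |-> tau b x are fibrewise affine trivializing charts. *)
Definition differentiable_family :=
  [/\ smooth_manifold aB,
      smooth_manifold (@tot_atlas _ _ X),
      smooth_map (@tot_atlas _ _ X) aB (@proj _ _ X),
      forall b, affine_surface (@fib_atlas _ _ X b)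
    & forall b0, exists (U : set B) (tau : forall b, T2 -> fibre X b)
        (dev : B -> A2 -> A2),
        [/\ mopen aB U, U b0, trivialization U tau,
            forall b x, U b ->
              smooth_at (prod_atlas aB (vec_atlas A2)) (vec_atlas A2)
                (fun z => dev z.1 z.2) (b, x)
          & forall b, U b ->
              exists h, complete_dev (marked_fibre (tau b)) (dev b) h]].

(* The differentiable structure of the deformation space is the one making the
   period map a diffeomorphism onto R^2. *)
Definition smooth_to_Dc (F : B -> marked -> Prop) :=
  smooth_map aB (vec_atlas A2) (fun b => Dc_period (F b)).

(* The family is induced by a smooth map F into the deformation space: for some
   smooth marking mu of the fibres, F b is the class of the marked fibre. *)
Definition induced_by_smooth_map :=
  exists F : B -> marked -> Prop,
    [/\ forall b, Dc (F b), smooth_to_Dc F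
      & exists2 mu : forall b, T2 -> fibre X b, trivialization setT mu &
          forall b, F b = iso_class (marked_fibre (mu b))].

End FamilyPredicates.

(** * The family of the maps Phi_a *)

Definition Phi (a : R) (v : A2) : A2 :=
  row2 (v 0 0) (v 0 1 + 2^-1 * a * v 0 0 ^+ 2).

Definition Phi_inv (a : R) (v : A2) : A2 :=
  row2 (v 0 0) (v 0 1 - 2^-1 * a * v 0 0 ^+ 2).

Definition hol (a : R) (g : Z2) : A2 -> A2 :=
  Phi a \o transl g \o Phi_inv a.

Definition E_act (g : Z2) (z : R * A2) : R * A2 := (z.1, hol z.1 g z.2).

Definition E_tot : Type := orbit_space E_act.

Definition E_cls (a : R) (v : A2) : E_tot := orbit_cls E_act (a, v).

Definition E_proj (e : E_tot) : R := (orbit_repr e).1.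

Lemma Phi_invK (a : R) : cancel (Phi_inv a) (Phi a).
Proof.
move=> v; apply/rowP => -[[|[|//]] j]; rewrite !mxE/= ?subrK.
  by congr (v 0 _); apply/val_inj.
by congr (v 0 _); apply/val_inj.
Qed.

Lemma E_projE (a : R) (v : A2) : E_proj (E_cls a v) = a.
Proof.
rewrite /E_proj /orbit_repr; case: cid => -[b w] /= e.
have: orb E_act (a, v) (a, v).
  exists 0 => //; rewrite /E_act /= /hol /= /transl.
  suff -> : zvec 0 = 0 by rewrite addr0 Phi_invK.
  by apply/rowP => j; rewrite !mxE.
by rewrite e => -[g _] [].
Qed.

(* The projection of A^2 onto the fibre E_a = A^2 / h_a(Z^2). *)
Definition E_fib_cls (a : R) (v : A2) : {e : E_tot | E_proj e = a} :=
  exist _ (E_cls a v) (E_projE a v).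

Definition E_family : torus_family R 1 :=
  @TorusFamily R 1 E_tot
    (cover_atlas (fun z : ('rV[R]_1 * A2)%type => E_cls (z.1 0 0) z.2))
    E_proj (fun a => cover_atlas (E_fib_cls a)).

(* f_a : T^2 -> E_a sends the class of x to the class of Phi_a(x). *)
Definition E_marking (a : R) (t : T2) : fibre E_family a :=
  E_fib_cls a (Phi a (orbit_repr t)).

Definition E_marked (a : R) : marked := marked_fibre (E_marking a).

Definition cbrt (a : R) : R := Num.sg a * `|a| `^ 3^-1.

End AffineTori.

Arguments trivialization {R B n} aB X U tau.
Arguments E_family : clear implicits.
Arguments marked : clear implicits.

(* Main.v *)
Require Import Defs.
From HB Require Import structures.
From mathcomp Require Import all_boot all_order all_algebra.
From mathcomp Require Import all_classical all_reals all_analysis.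
From mathcomp Require Import ring lra.
Import Order.TTheory GRing.Theory Num.Theory.
Import numFieldNormedType.Exports.
Local Open Scope classical_set_scope.
Local Open Scope ring_scope.

Set Implicit Arguments.
Unset Strict Implicit.
Unset Printing Implicit Defensive.

(** The cube root comes from a cubic equation satisfied by the normalized
    parallel field.  Lift the tensor fields of a torus affinely diffeomorphic
    to E_a to the plane, with coordinates (u, v), and let s du /\ dv be the
    parallel area form.  The linear holonomy of E_a is generated by the shear
    (u, v) |-> (u, v + a u).  If a is not zero, the parallel field zeta is
    constant and invariant under this shear, hence equal to (0, z) for some
    z.  The condition omega(zeta, xi) = 1 makes the first component of xi the
    constant x0 = - 1 / (s z); the second component is polynomial and periodic
    along vertical lines, hence a function of u alone; zeta = nabla_xi xi makes
    it affine in u with slope z / x0, while equivariance under the first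
    generator says that the slope is a x0.  So z = a x0 ^ 2, that is
    s ^ 2 z ^ 3 = a ([field_cube]), and the same formulas produce such fields
    ([normal_field_exists]).  For a = 0 the shear is trivial and the torus is
    Euclidean; it is not for other values of a ([euclidean_holonomy]).

    The marking of a complete torus m affinely diffeomorphic to E_a lifts to a
    map k of the plane with k (x + n) = k x + n A for a matrix A in GL(2, Z)
    ([lift_marking]).  The area of m is s det A, an integral of the Jacobian of
    k ([integral_jacobian_quasiperiodic]), so s = det A and z is the cube root
    of a.  As eta = - s z du, the period of m is - det A cbrt(a) times the first
    column of A ([period_fibre_cover]).  Two facts follow.

    A diffeomorphism in the identity component commutes with the integer
    translations after lifting to the plane ([diff0_lift]), so A = 1 when m is
    isotopic to E_a with its marking: the period is the same for the whole class
    and equals (- cbrt a, 0) ([period_isotopic]).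

    The first column of A is a nonzero integer vector, so the period of m has
    norm at least |cbrt a|, and it vanishes for a = 0 ([period_bound]).  This
    holds whatever the marking is, and a map with this growth is not
    differentiable at 0 ([cbrt_growth_not_derivable]): no choice of markings
    of the fibres gives a smooth map into the deformation space. *)

(** * Smooth maps between normed spaces *)

Section Smoothness.
Context {R : realType}.
Implicit Types V W : normedModType R.

Lemma open_near V (D : set V) x : open D -> D x -> \forall y \near x, D y.
Proof. by move=> oD Dx; exact: open_nbhs_nbhs. Qed.

Lemma Ck_on_cont V W k (D : set V) (f : V -> W) :
  Ck_on k D f -> forall x, D x -> {for x, continuous f}.
Proof. by case: k => [|k] []. Qed.

Lemma near_eq_continuous V W (f g : V -> W) x :
  (\forall y \near x, f y = g y) -> {for x, continuous f} ->
  {for x, continuous g}.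
Proof.
move=> fg cf; rewrite /prop_for /continuous_at -(nbhs_singleton fg).
exact: cvg_trans (near_eq_cvg fg) cf.
Qed.

Lemma Ck_on_eq V W k (D : set V) (f g : V -> W) : open D ->
  (forall x, D x -> f x = g x) -> Ck_on k D f -> Ck_on k D g.
Proof.
move=> oD; elim: k f g => [|k IH] f g fg /= [cf h].
  split=> // x Dx; apply: near_eq_continuous (cf _ Dx).
  by apply: filterS (open_near oD Dx) => y; exact: fg.
have nfg x : D x -> \forall y \near x, f y = g y.
  by move=> Dx; apply: filterS (open_near oD Dx) => y; exact: fg.
split=> [x Dx|v]; first exact: near_eq_continuous (nfg _ Dx) (cf _ Dx).
have [df dCk] := h v; split=> [x Dx|].
  exact: near_eq_derivable (nfg _ Dx) (df _ Dx).
by apply: IH dCk => x Dx; apply: near_eq_derive; exact: nfg.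
Qed.

Lemma Ck_on_sub V W k (D D' : set V) (f : V -> W) :
  D' `<=` D -> Ck_on k D f -> Ck_on k D' f.
Proof.
move=> DD; elim: k f => [|k IH] f /= [cf h].
  by split=> // x /DD; exact: cf.
split=> [x /DD|v]; first exact: cf.
by have [df dCk] := h v; split=> [x /DD|]; [exact: df|exact: IH].
Qed.

Lemma Ck_on_pred V W k (D : set V) (f : V -> W) :
  Ck_on k.+1 D f -> Ck_on k D f.
Proof.
elim: k f => [|k IH] f /= [cf h]; first by [].
by split=> // v; have [df dCk] := h v; split=> //; exact: IH.
Qed.

Lemma Ck_on_cst V W k (D : set V) (w : W) : Ck_on k D (fun _ : V => w).
Proof.
have cw (u : W) (x : V) : {for x, continuous (fun=> u)} by exact: cst_continuous.
elim: k w => [|k IH] w /=; split=> //; move=> v.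
split=> [x _|]; first exact: derivable_cst.
have -> : 'D_v (fun _ : V => w) = fun _ => 0.
  by apply/funext => x; exact: derive_cst.
exact: IH.
Qed.

Lemma lin0 V W (L : V -> W) : linear L -> L 0 = 0.
Proof. by move=> lL; have := lL (-1) 0 0; rewrite scaler0 addr0 scaleN1r addNr. Qed.

Lemma linZ V W (L : V -> W) : linear L -> forall a x, L (a *: x) = a *: L x.
Proof. by move=> lL a x; have := lL a x 0; rewrite (lin0 lL) !addr0. Qed.

Lemma linD V W (L : V -> W) : linear L -> forall x y, L (x + y) = L x + L y.
Proof. by move=> lL x y; have := lL 1 x y; rewrite !scale1r. Qed.

Lemma linB V W (L : V -> W) : linear L -> forall x y, L (x - y) = L x - L y.
Proof. by move=> lL x y; rewrite (linD lL) -scaleN1r (linZ lL) scaleN1r. Qed.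

Lemma is_derive_lincomp V W W' (L : W -> W') (f : V -> W) x v : linear L ->
  continuous L -> derivable f x v -> is_derive x v (L \o f) (L ('D_v f x)).
Proof.
move=> lL cL df.
have H : (h^-1 *: (((L \o f) \o shift x) (h *: v) - (L \o f) x)) @[h --> 0^']
    --> L ('D_v f x).
  rewrite (_ : (fun h => _) = L \o
      (fun h => h^-1 *: ((f \o shift x) (h *: v) - f x))); last first.
    by apply/funext => h /=; rewrite (linZ lL) (linB lL).
  by apply: (@cvg_comp _ _ _ _ _ _ (nbhs ('D_v f x))); [exact: df|exact: cL].
by split; [apply/cvg_ex; eexists; exact: H|exact: cvg_lim H].
Qed.

Lemma Ck_on_lincomp V W W' k (D : set V) (L : W -> W') (f : V -> W) :
  open D -> linear L -> continuous L -> Ck_on k D f -> Ck_on k D (L \o f).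
Proof.
move=> oD lL cL; elim: k f => [|k IH] f /= [cf h]; split=> //.
- by move=> x Dx; apply: continuous_comp; [exact: cf|exact: cL].
- by move=> x Dx; apply: continuous_comp; [exact: cf|exact: cL].
move=> v; have [df dCk] := h v; split=> [x Dx|].
  by have [] := is_derive_lincomp lL cL (df _ Dx).
apply: Ck_on_eq (IH _ dCk) => // x Dx.
by have [_ ->] := is_derive_lincomp lL cL (df _ Dx).
Qed.

Lemma is_derive_lin V W (L : V -> W) x v : linear L ->
  continuous L -> is_derive x v L (L v).
Proof.
move=> lL cL; have := is_derive_lincomp lL cL (@derivable_id _ _ x v).
by rewrite derive_id.
Qed.

Lemma Ck_on_lin V W k (D : set V) (L : V -> W) :
  linear L -> continuous L -> Ck_on k D L.
Proof.
move=> lL cL; have cL' (x : V) : D x -> {for x, continuous L} by move=> _; exact: cL.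
case: k => [|k] /=; split=> //; move=> v.
split=> [x _|]; first by have [] := is_derive_lin x v lL cL.
have -> : 'D_v L = fun _ => L v; last exact: Ck_on_cst.
by apply/funext => x; have [] := is_derive_lin x v lL cL.
Qed.

Lemma Ck_on_id V k (D : set V) : Ck_on k D (fun x : V => x).
Proof. by apply: Ck_on_lin => [a u v //|x]. Qed.

Lemma Ck_onD V W k (D : set V) (f g : V -> W) : open D ->
  Ck_on k D f -> Ck_on k D g -> Ck_on k D (fun x => f x + g x).
Proof.
move=> oD; elim: k f g => [|k IH] f g /= [cf hf] [cg hg]; split=> //.
- by move=> x Dx; apply: continuousD; [exact: cf|exact: cg].
- by move=> x Dx; apply: continuousD; [exact: cf|exact: cg].
move=> v; have [df dCf] := hf v; have [dg dCg] := hg v; split=> [x Dx|].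
  by apply: derivableD; [exact: df|exact: dg].
apply: Ck_on_eq (IH _ _ dCf dCg) => // x Dx.
by rewrite -deriveD//; [exact: df|exact: dg].
Qed.

Lemma Ck_onM V k (D : set V) (f g : V -> R^o) : open D ->
  Ck_on k D f -> Ck_on k D g -> Ck_on k D (fun x => f x * g x : R^o).
Proof.
move=> oD; elim: k f g => [|k IH] f g /= [cf hf] [cg hg]; split=> //.
- by move=> x Dx; apply: continuousM; [exact: cf|exact: cg].
- by move=> x Dx; apply: continuousM; [exact: cf|exact: cg].
move=> v; have [df dCf] := hf v; have [dg dCg] := hg v; split=> [x Dx|].
  by apply: derivableM; [exact: df|exact: dg].
have Cf : Ck_on k D f by apply: Ck_on_pred; split.
have Cg : Ck_on k D g by apply: Ck_on_pred; split.
apply: Ck_on_eq (Ck_onD oD (IH _ _ Cf dCg) (IH _ _ Cg dCf)) => // x Dx.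
by rewrite -[RHS]/('D_v (f * g) x) deriveM//; [exact: df|exact: dg].
Qed.

Lemma Ck_onZ V W k (D : set V) (a : R) (f : V -> W) : open D ->
  Ck_on k D f -> Ck_on k D (fun x => a *: f x).
Proof.
move=> oD; apply: (@Ck_on_lincomp V W W k D (fun w => a *: w)) => //.
  by move=> b u v; rewrite scalerDr !scalerA mulrC.
exact: scaler_continuous.
Qed.

Lemma Ck_onN V W k (D : set V) (f : V -> W) : open D ->
  Ck_on k D f -> Ck_on k D (fun x => - f x).
Proof.
move=> oD Cf; apply: Ck_on_eq (Ck_onZ (-1) oD Cf) => // x _.
by rewrite scaleN1r.
Qed.

Lemma Ck_onB V W k (D : set V) (f g : V -> W) : open D ->
  Ck_on k D f -> Ck_on k D g -> Ck_on k D (fun x => f x - g x).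
Proof. by move=> oD Cf Cg; apply: Ck_onD => //; exact: Ck_onN. Qed.

Lemma Ck_on_coord V m n k (D : set V) (f : V -> 'M[R]_(m, n)) i j : open D ->
  Ck_on k D f -> Ck_on k D (fun x => f x i j : R^o).
Proof.
move=> oD; apply: (@Ck_on_lincomp _ _ R^o k D (fun w : 'M[R]_(m, n) => w i j)).
- by [].
- by move=> a u v; rewrite !mxE.
- exact: coord_continuous.
Qed.

Lemma row2E (x y : R) :
  row2 x y = x *: delta_mx 0 0 + y *: delta_mx 0 1 :> 'rV[R]_2.
Proof.
by apply/rowP => -[[|[|//]] j]; rewrite !mxE/= ?mulr1 ?mulr0 ?addr0 ?add0r.
Qed.

Lemma row2_eta (v : 'rV[R]_2) : row2 (v 0 0) (v 0 1) = v.
Proof.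
by apply/rowP => -[[|[|//]] j]; rewrite !mxE/=; congr (v 0 _); exact/val_inj.
Qed.

Lemma Ck_on_row2 V k (D : set V) (f g : V -> R^o) : open D ->
  Ck_on k D f -> Ck_on k D g -> Ck_on k D (fun x => row2 (f x) (g x)).
Proof.
move=> oD Cf Cg.
have H (h : V -> R^o) (w : 'rV[R]_2) : Ck_on k D h ->
    Ck_on k D (fun x => h x *: w).
  apply: (@Ck_on_lincomp V R^o 'rV[R]_2 k D (fun a => a *: w)) => //.
    by move=> a u v; rewrite scalerDl scalerA.
  exact: scalel_continuous.
apply: Ck_on_eq (Ck_onD oD (H _ (delta_mx 0 0) Cf) (H _ (delta_mx 0 1) Cg)) => //.
by move=> x _; rewrite row2E.
Qed.

Lemma Ck_on_pair V W W' k (D : set V) (f : V -> W) (g : V -> W') : open D ->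
  Ck_on k D f -> Ck_on k D g -> Ck_on k D (fun x => (f x, g x)).
Proof.
move=> oD Cf Cg.
have H1 : Ck_on k D (fun x => (f x, 0 : W')).
  apply: (@Ck_on_lincomp _ _ (W * W')%type k D (fun w => (w, 0))) Cf => //.
    move=> a u v; apply: (@injective_projections W W'); rewrite //=.
    by rewrite scaler0 addr0.
  by move=> x; apply: cvg_pair => //=; exact: cvg_cst.
have H2 : Ck_on k D (fun x => (0 : W, g x)).
  apply: (@Ck_on_lincomp _ _ (W * W')%type k D (fun w => (0, w))) Cg => //.
    move=> a u v; apply: (@injective_projections W W'); rewrite //=.
    by rewrite scaler0 addr0.
  by move=> x; apply: cvg_pair => //=; exact: cvg_cst.
apply: Ck_on_eq (Ck_onD oD H1 H2) => // x _.
by apply: (@injective_projections W W'); rewrite /= ?addr0 ?add0r.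
Qed.

Lemma smooth_near_eq V W (f g : V -> W) x :
  (\forall y \near x, f y = g y) -> smooth_near f x -> smooth_near g x.
Proof.
move=> /nbhs_interior fg [D [oD Dx Cf]].
exists (D `&` (fun y => f y = g y)^°); split.
- by apply: openI => //; exact: open_interior.
- by split => //; exact: nbhs_singleton fg.
move=> k; apply: (@Ck_on_eq _ _ _ _ f).
- by apply: openI => //; exact: open_interior.
- by move=> y [_] /interior_subset.
- by apply: Ck_on_sub (Cf k) => y [].
Qed.

Lemma smooth_on_near V W (f : V -> W) x : smooth_on setT f -> smooth_near f x.
Proof. by move=> sf; exists setT; split=> //; exact: openT. Qed.

End Smoothness.

(** * Differential calculus in the plane *)

Section Calculus.
Context {R : realType}.
Implicit Types V W : normedModType R.

Local Notation A2 := 'rV[R]_2.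
Local Notation e0 := (delta_mx 0 0 : A2).
Local Notation e1 := (delta_mx 0 1 : A2).

Lemma is_derive_line V W (f : V -> W) x v (s : R) :
  derivable f (s *: v + x) v ->
  is_derive s 1 (fun t => f (t *: v + x)) ('D_v f (s *: v + x)).
Proof.
have E : (fun h : R => h^-1 *: (((fun t => f (t *: v + x)) \o shift s) (h *: 1)
     - f (s *: v + x))) =
   (fun h => h^-1 *: ((f \o shift (s *: v + x)) (h *: v) - f (s *: v + x))).
  apply/funext => h /=; congr (_ *: (f _ - _)).
  by rewrite [h *: 1]mulr1 scalerDl addrA.
by move=> df; split; rewrite /derivable /derive E.
Qed.

Lemma MVT_line V (f : V -> R^o) x v (t : R) :
  (forall s : R, `|s| <= `|t| -> derivable f (s *: v + x) v) ->
  exists2 s : R, `|s| <= `|t| &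
    f (t *: v + x) - f x = t * 'D_v f (s *: v + x).
Proof.
move=> df; pose g (s : R) : R := f (s *: v + x).
have dg (s : R) : `|s| <= `|t| -> is_derive s 1 g ('D_v f (s *: v + x)).
  by move=> st; apply: is_derive_line; exact: df.
have [t0|t0] := leP 0 t.
  have Hin (s : R) : s \in `[0, t] -> `|s| <= `|t|.
    by rewrite in_itv/= => /andP[? ?]; rewrite !ger0_norm.
  have [||c ct E] := @MVT_segment _ g (fun s => 'D_v f (s *: v + x)) 0 t t0.
  - by move=> s st; apply: dg; apply: Hin; exact: subset_itv_oo_cc st.
  - apply: derivable_within_continuous => s st.
    by have [] := dg _ (Hin _ st).
  exists c; first exact: Hin.
  by move: E; rewrite subr0 mulrC /g scale0r add0r.
have Hin (s : R) : s \in `[t, 0] -> `|s| <= `|t|.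
  rewrite in_itv/= => /andP[? ?]; rewrite !ler0_norm ?lerN2//.
  exact: ltW.
have [||c ct E] := @MVT_segment _ g (fun s => 'D_v f (s *: v + x)) t 0 (ltW t0).
- by move=> s st; apply: dg; apply: Hin; exact: subset_itv_oo_cc st.
- apply: derivable_within_continuous => s st.
  by have [] := dg _ (Hin _ st).
exists c; first exact: Hin.
move: E; rewrite sub0r mulrC /g scale0r add0r => E.
by rewrite -(opprB (f x)) E mulNr opprK.
Qed.

Lemma A2_eta (v : A2) : v = v 0 0 *: e0 + v 0 1 *: e1.
Proof. by rewrite -row2E row2_eta. Qed.

Lemma A2_norm_coord (v : A2) i : `|v 0 i| <= `|v|.
Proof.
by rewrite [leRHS]/Num.Def.normr/= mx_normrE; exact: (le_bigmax _ _ (0, i)).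
Qed.

Lemma A2_norm_le (v : A2) e : 0 <= e -> (forall i, `|v 0 i| <= e) -> `|v| <= e.
Proof.
move=> e0 h; rewrite /Num.Def.normr/= mx_normrE; apply: bigmax_le => // -[i j] _.
by rewrite ord1; exact: h.
Qed.

Lemma norm_delta i : `|delta_mx 0 i : A2| <= 1.
Proof.
apply: A2_norm_le => // j; rewrite mxE /=.
by case: (_ == _); rewrite ?normr1 ?normr0.
Qed.

Lemma continuous_row2 (T : topologicalType) (f g : T -> R) x :
  {for x, continuous f} -> {for x, continuous g} ->
  {for x, continuous (fun x => row2 (f x) (g x))}.
Proof.
move=> cf cg; rewrite (_ : (fun x => _) = fun x => f x *: e0 + g x *: e1).
  by apply: (@continuousD _ A2); apply: cvgZr_tmp.
by apply/funext => y; rewrite row2E.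
Qed.

Lemma differentiable_of_littleo V W (f : V -> W) (L : {linear V -> W}) x :
  continuous L ->
  (forall e : R, 0 < e ->
     \forall h \near (0 : V), `|f (h + x) - f x - L h| <= e * `|h|) ->
  differentiable f x.
Proof.
move=> cL H; have Hlit : f \o shift x = cst (f x) + L +o_ 0 id.
  apply/eqaddoP => e egt0; apply: filterS (H e egt0) => h.
  by rewrite !fctE /cst /= opprD addrA.
by apply/diff_locallyP; rewrite (diff_unique cL Hlit).
Qed.

(** The mean value theorem is applied along the two sides of a rectangle from
    [x] to [h + x], where the partial derivatives stay within [e / 2] of their
    values at [x]. *)
Lemma C1_differentiable (f : A2 -> A2) (D : set A2) x :
  open D -> D x -> Ck_on 1 D f -> differentiable f x.
Proof.
move=> oD Dx [cf df].
pose B : 'M[R]_2 := \matrix_(i, j) 'D_(delta_mx 0 i) (fun y => f y 0 j) x.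
pose L : {linear A2 -> A2} := mulmxr B.
have LE h j : L h 0 j = h 0 0 * B 0 j + h 0 1 * B 1 j.
  by rewrite /L /= mxE big_ord_recl big_ord1; congr (_ + h 0 _ * B _ j);
     exact: val_inj.
have cL : continuous L.
  have -> : (L : A2 -> A2) = fun h => row2 (h 0 0 * B 0 0 + h 0 1 * B 1 0)
      (h 0 0 * B 0 1 + h 0 1 * B 1 1).
    by apply/funext => h; rewrite -[LHS]row2_eta !LE.
  have cl (a b : R) : continuous (fun h : A2 => h 0 0 * a + h 0 1 * b).
    move=> h; apply: (@continuousD _ R^o _ (fun h : A2 => h 0 0 * a)
      (fun h : A2 => h 0 1 * b)).
      by apply: (@continuousM _ _ (fun h : A2 => h 0 0) (cst a));
        [exact: coord_continuous|exact: cst_continuous].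
    by apply: (@continuousM _ _ (fun h : A2 => h 0 1) (cst b));
      [exact: coord_continuous|exact: cst_continuous].
  move=> h; apply: (@continuous_row2 _ (fun h : A2 => h 0 0 * B 0 0 + h 0 1 * B 1 0)
     (fun h : A2 => h 0 0 * B 0 1 + h 0 1 * B 1 1)); exact: cl.
have dc v j y : D y -> derivable (fun y => f y 0 j) y v.
  by move=> Dy; have [/(_ _ Dy)/derivable_mxP] := df v.
have cdc v j y : D y -> {for y, continuous ('D_v (fun y => f y 0 j : R^o))}.
  have [dv [cdv _]] := df v.
  move=> Dy; apply: (@near_eq_continuous _ _ _ (fun y => ('D_v f y) 0 j : R^o)).
    apply: filterS (open_near oD Dy) => z Dz.
    by rewrite derive_mx ?mxE//; exact: dv.
  apply: (@continuous_comp _ _ _ ('D_v f) (fun w : A2 => w 0 j)).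
    exact: cdv.
  exact: coord_continuous.
apply: (@differentiable_of_littleo _ _ f L x cL) => e egt0.
have e2 : 0 < e / 2 by rewrite divr_gt0.
have Hnear (i j : 'I_2) : \forall y \near x,
    `|'D_(delta_mx 0 i) (fun y => f y 0 j) y - B i j| <= e / 2.
  rewrite /B mxE.
  have /cvgrPdist_le/(_ _ e2) := cdc (delta_mx 0 i) j x Dx.
  by apply: filterS => y; rewrite distrC.
have : \forall y \near x, D y /\ forall i j : 'I_2,
    `|'D_(delta_mx 0 i) (fun y => f y 0 j) y - B i j| <= e / 2.
  have h1 := open_near oD Dx.
  have h2 : \forall y \near x, forall i j : 'I_2,
      `|'D_(delta_mx 0 i) (fun y => f y 0 j) y - B i j| <= e / 2.
    apply: (@filter_forall _ _ _ (nbhs x)) => i.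
    by apply: (@filter_forall _ _ _ (nbhs x)) => j; exact: Hnear.
  by apply: filterS2 h1 h2 => y Dy h; split.
move=> /nbhs_ballP[d /= d0 Hd].
have Hb z : `|z| < d -> D (z + x) /\ forall i j : 'I_2,
    `|'D_(delta_mx 0 i) (fun y => f y 0 j) (z + x) - B i j| <= e / 2.
  move=> zd; apply: Hd; rewrite -ball_normE /= opprD addrCA subrr addr0.
  by rewrite normrN.
apply/nbhs_ballP; exists (d / 2); first by rewrite /= divr_gt0.
move=> h; rewrite -ball_normE /= sub0r normrN => hd.
apply: A2_norm_le; first by rewrite mulr_ge0// ltW.
move=> j.
have small (s t : R) : `|s| <= `|h 0 0| -> `|t| <= `|h 0 1| ->
    `|s *: e0 + t *: e1| < d.
  move=> hs ht; apply: le_lt_trans (ler_normD _ _) _.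
  rewrite [ltRHS]splitr !normrZ; apply: ltr_leD.
    apply: le_lt_trans hd; apply: le_trans (A2_norm_coord h 0).
    by rewrite -[leRHS]mulr1 ler_pM// norm_delta.
  apply: le_trans (ltW hd); apply: le_trans (A2_norm_coord h 1).
  by rewrite -[leRHS]mulr1 ler_pM// norm_delta.
have [s hs E0] : exists2 s : R, `|s| <= `|h 0 0| &
   f (h 0 0 *: e0 + x) 0 j - f x 0 j =
     h 0 0 * 'D_e0 (fun y => f y 0 j) (s *: e0 + x).
  apply: (@MVT_line _ (fun y => f y 0 j)) => s hs; apply: dc.
  have := small s 0 hs; rewrite normr0 scale0r addr0 => /(_ (normr_ge0 _)).
  by move/Hb => [].
have [t ht E1] : exists2 t : R, `|t| <= `|h 0 1| &
   f (h 0 1 *: e1 + (h 0 0 *: e0 + x)) 0 j - f (h 0 0 *: e0 + x) 0 j =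
     h 0 1 * 'D_e1 (fun y => f y 0 j) (t *: e1 + (h 0 0 *: e0 + x)).
  apply: (@MVT_line _ (fun y => f y 0 j)) => t ht; apply: dc.
  by rewrite addrA [t *: _ + _]addrC; have [] := Hb _ (small _ _ (lexx _) ht).
have -> : (f (h + x) - f x - L h) 0 j =
   h 0 0 * ('D_e0 (fun y => f y 0 j) (s *: e0 + x) - B 0 j) +
   h 0 1 * ('D_e1 (fun y => f y 0 j) (t *: e1 + (h 0 0 *: e0 + x)) - B 1 j).
  have mxB (u w : A2) : (u - w) 0 j = u 0 j - w 0 j by rewrite !mxE.
  rewrite !mulrBr -E0 -E1 !mxB LE.
  have <- : h + x = h 0 1 *: e1 + (h 0 0 *: e0 + x).
    by rewrite addrA [_ *: e1 + _]addrC; congr (_ + x); exact: A2_eta.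
  by ring.
apply: le_trans (ler_normD _ _) _.
rewrite [e]splitr mulrDl lerD// normrM mulrC ler_pM//; try exact: A2_norm_coord.
  have := small s 0 hs; rewrite normr0 scale0r addr0 => /(_ (normr_ge0 _)).
  by move/Hb => [_]; exact.
rewrite addrA [t *: _ + _]addrC.
by have [_] := Hb _ (small _ _ (lexx _) ht); exact.
Qed.

Lemma smooth_differentiable (f : A2 -> A2) x :
  smooth_near f x -> differentiable f x.
Proof. by move=> [D [oD Dx Cf]]; exact: C1_differentiable (Cf 1%N). Qed.

Lemma smooth_near_derivable V W (f : V -> W) x v :
  smooth_near f x -> derivable f x v.
Proof. by move=> [D [oD Dx Cf]]; have [_ /(_ v)[df _]] := Cf 1%N; exact: df. Qed.

Lemma smooth_near_continuous V W (f : V -> W) x :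
  smooth_near f x -> {for x, continuous f}.
Proof. by move=> [D [oD Dx Cf]]; exact: (Ck_on_cont (Cf 0%N)). Qed.

Lemma jacobian_smooth (f : A2 -> A2) x : smooth_near f x ->
  jacobian f x = \matrix_(i, j) 'D_(delta_mx 0 i) f x 0 j.
Proof.
move=> sf; apply/matrixP => i j; rewrite !mxE.
by rewrite deriveE//; exact: smooth_differentiable.
Qed.

Lemma det_mx22 (K : comNzRingType) (A : 'M[K]_2) :
  \det A = A 0 0 * A 1 1 - A 0 1 * A 1 0.
Proof.
rewrite (expand_det_row _ 0) !big_ord_recl big_ord0 /cofactor !det_mx11 !mxE /=.
rewrite addr0 /= !expr0 mul1r expr1 mulN1r mulrN.
congr (_ * A _ _ - A _ _ * A _ _); exact: val_inj.
Qed.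

Lemma mul_rV2 (x : A2) (B : 'M[R]_2) j :
  (x *m B) 0 j = x 0 0 * B 0 j + x 0 1 * B 1 j.
Proof.
rewrite mxE big_ord_recl big_ord1; congr (_ + x 0 _ * B _ _); exact: val_inj.
Qed.

Lemma Ck_on_mulmx V k (D : set V) (f : V -> A2) (B : 'M[R]_2) : open D ->
  Ck_on k D f -> Ck_on k D (fun y => f y *m B).
Proof.
move=> oD Cf; have C i j : Ck_on k D (fun y => f y 0 i * B i j : R^o).
  by apply: Ck_onM; [|exact: Ck_on_coord|exact: Ck_on_cst].
apply: (@Ck_on_eq _ _ _ _ _ (fun y =>
    row2 (f y 0 0 * B 0 0 + f y 0 1 * B 1 0)
         (f y 0 0 * B 0 1 + f y 0 1 * B 1 1))) => //.
  by move=> y _; rewrite -[RHS]row2_eta !mul_rV2.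
by apply: Ck_on_row2 => //; apply: Ck_onD => //; exact: C.
Qed.

Lemma affine_smooth (B : 'M[R]_2) (b : A2) :
  smooth_on setT (fun y : A2 => y *m B + b).
Proof.
move=> k; apply: Ck_onD; [exact: openT| |exact: Ck_on_cst].
by apply: Ck_on_mulmx; [exact: openT|exact: Ck_on_id].
Qed.

Lemma jacobian_affine (f : A2 -> A2) (B : 'M[R]_2) b x :
  (\forall y \near x, f y = y *m B + b) -> jacobian f x = B.
Proof.
move=> fE; have sB := affine_smooth B b.
have sf : smooth_near f x.
  apply: smooth_near_eq (smooth_on_near _ sB).
  by apply: filterS fE => y ->.
apply/row_matrixP => i; rewrite !rowE.
rewrite -(deriveEjacobian _ (smooth_differentiable sf)).
rewrite (near_eq_derive _ fE) /derive.
rewrite (_ : (fun h => _) = fun h : R => (h^-1 * h) *: (delta_mx 0 i *m B)).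
  apply/cvg_lim => //; rewrite -[X in _ --> X]scale1r.
  apply: cvgZr_tmp; apply: cvg_near_cst.
  by rewrite near_withinE; near=> h => h0; rewrite mulVf.
apply/funext => h /=; rewrite mulmxDl -[_ + _ + b]addrA addrK.
by rewrite -scalemxAl scalerA.
Unshelve. all: by end_near. Qed.

Lemma derive_translate V W (f : V -> W) w x v :
  'D_v (fun y => f (y + w)) x = 'D_v f (x + w).
Proof.
rewrite /derive; set u := fun h => _; set u' := fun h => _.
suff -> : u = u' by [].
by apply/funext => h /=; rewrite /u /u' /= addrA.
Qed.

Lemma derivable_translate V W (f : V -> W) w x v :
  derivable f (x + w) v -> derivable (fun y => f (y + w)) x v.
Proof.
rewrite /derivable; set u := fun h => _; set u' := fun h => _.
suff -> : u' = u by [].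
by apply/funext => h /=; rewrite /u /u' /= addrA.
Qed.

(** The mean value theorem in the direction [u], then in the direction [v].  The
    left-hand side does not depend on the order of [u] and [v]. *)
Lemma second_difference V (f : V -> R^o) u v x (t : R) : Ck_on 2 setT f ->
  exists r s : R, [/\ `|r| <= `|t|, `|s| <= `|t| &
    f (t *: u + t *: v + x) - f (t *: u + x) - (f (t *: v + x) - f x) =
    t * t * 'D_v ('D_u f) (s *: v + (r *: u + x))].
Proof.
move=> Cf; have Df w y : derivable f y w by have [_ /(_ w)[d _]] := Cf; exact: d.
have DDf w w' y : derivable ('D_w f) y w'.
  by have [_ /(_ w)[_ [_ /(_ w')[d _]]]] := Cf; exact: d.
pose g y := f (y + t *: v) - f y.
have dg r : is_derive (r *: u + x) u g
    ('D_u f ((r *: u + x) + t *: v) - 'D_u f (r *: u + x)).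
  rewrite -derive_translate; apply: is_deriveB; apply/derivableP => //.
  exact: derivable_translate.
have [r _|r rt] := @MVT_line _ g x u t; first by have [] := dg r.
have [_ ->] := dg r => E.
have [s _|s st Es] := @MVT_line _ ('D_u f) (r *: u + x) v t; first exact: DDf.
exists r, s; split => //.
rewrite [r *: u + x + _]addrC Es in E; rewrite -mulrA -E /g.
by rewrite [t *: v + x]addrC [t *: u + x + _]addrAC.
Qed.

Fact common_limit_lt (a b c e : R) :
  `|a - c| < e / 2 -> `|b - c| < e / 2 -> `|a - b| < e.
Proof.
move=> h1 h2; rewrite -(subrKA c); apply: le_lt_trans (ler_normD _ _) _.
by rewrite [ltRHS]splitr ltrD// distrC.
Qed.

Fact second_difference_sym (a b c d t X Y : R) : t != 0 ->
  a - b - (c - d) = t * t * X -> a - c - (b - d) = t * t * Y -> X = Y.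
Proof.
move=> t0 h1 h2; apply: (@mulfI _ (t * t)); first by rewrite mulf_neq0.
by rewrite -h1 -h2; ring.
Qed.

(** The second difference over a small parallelogram is [t * t] times each of the
    two mixed derivatives at points near [x]; continuity brings both within
    [e / 2] of their values at [x]. *)
Lemma Schwarz V (f : V -> R^o) u v x : Ck_on 2 setT f ->
  'D_v ('D_u f) x = 'D_u ('D_v f) x.
Proof.
move=> Cf; have cDD w w' : {for x, continuous ('D_w' ('D_w f))}.
  by have [_ /(_ w)[_ [_ /(_ w')[_ [cD _]]]]] := Cf; exact: cD.
apply/eqP; rewrite -subr_eq0 -normr_eq0 eq_le normr_ge0 andbT.
apply/ler_addgt0Pr => e egt0; rewrite add0r; apply/ltW.
have e2 : 0 < e / 2 by rewrite divr_gt0.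
have /cvgrPdist_lt/(_ _ e2)/nbhs_ballP[d1 /= d1gt0 H1] := cDD u v.
have /cvgrPdist_lt/(_ _ e2)/nbhs_ballP[d2 /= d2gt0 H2] := cDD v u.
pose d := Num.min d1 d2; have d0 : 0 < d by rewrite lt_min d1gt0.
(* With t K = d / 2, every intermediate point is at distance less than d of x. *)
pose K := `|u| + `|v| + 1; have K0 : 0 < K by rewrite ltr_wpDl// addr_ge0.
pose t := d / (2 * K); have t0 : 0 < t by rewrite divr_gt0// mulr_gt0.
have small (a b : R) (p q : V) : `|p| + `|q| + 1 = K -> `|a| <= `|t| ->
    `|b| <= `|t| -> `|x - (a *: p + (b *: q + x))| < d.
  move=> pq hs hr; rewrite addrA opprD addrCA subrr addr0 normrN.
  apply: le_lt_trans (ler_normD _ _) _; rewrite !normrZ.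
  apply: (@le_lt_trans _ _ (t * K)).
    rewrite -pq !mulrDr -[leLHS]addr0 !lerD//.
    - by rewrite ler_wpM2r// -(gtr0_norm t0).
    - by rewrite ler_wpM2r// -(gtr0_norm t0).
    - by rewrite mulr1 ltW.
  rewrite /t invfM mulrA -mulrA mulVf ?gt_eqF// mulr1.
  by rewrite ltr_pdivrMr// ltr_pMr// ltr1n.
have [r [s [rt st E1]]] := second_difference u v x t Cf.
have [r' [s' [rt' st' E2]]] := second_difference v u x t Cf.
have E : 'D_v ('D_u f) (s *: v + (r *: u + x)) =
         'D_u ('D_v f) (s' *: u + (r' *: v + x)).
  rewrite [t *: v + t *: u]addrC in E2.
  by apply: second_difference_sym E1 E2; rewrite gt_eqF.
have B1 : `|'D_v ('D_u f) x - 'D_v ('D_u f) (s *: v + (r *: u + x))| < e / 2.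
  apply: H1; rewrite -ball_normE /=.
  have pq : `|v| + `|u| + 1 = K by rewrite /K [`|v| + _]addrC.
  by apply: lt_le_trans (small _ _ _ _ pq st rt) _; rewrite ge_min lexx.
have B2 : `|'D_u ('D_v f) x - 'D_u ('D_v f) (s' *: u + (r' *: v + x))| < e / 2.
  apply: H2; rewrite -ball_normE /=.
  by apply: lt_le_trans (small _ _ _ _ erefl st' rt') _; rewrite ge_min lexx orbT.
by rewrite -E in B2; exact: common_limit_lt B1 B2.
Qed.

(** * The area of a quasi-periodic map *)

Local Notation mu := (@lebesgue_measure R).

(** The hypotheses are local around the unit interval because the integrals
    depending on a parameter are differentiated on a bounded interval only. *)
Lemma FTC01_in (F f : R -> R) :
  (forall x : R, x \in `]-1, 2[ -> is_derive x (1 : R) F (f x)) ->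
  (forall x : R, x \in `]-1, 2[ -> {for x, continuous f}) ->
  \int[mu]_(x in `[0, 1]) f x = F 1 - F 0.
Proof.
move=> dF cf; have sub (x : R) : x \in `[0, 1] -> x \in `]-1, 2[.
  rewrite !in_itv /= => /andP[x0 x1].
  by rewrite (lt_le_trans _ x0) ?ltrN10// (le_lt_trans x1)// ltr1n.
have cF (x : R) : x \in `[0, 1] -> {for x, continuous F}.
  move=> /sub xI; apply/differentiable_continuous/derivable1_diffP.
  by have [] := dF x xI.
rewrite /Rintegral (@continuous_FTC2 _ f F 0 1)//.
- by apply: continuous_in_subspaceT => x /set_mem /sub; exact: cf.
- split=> [x xI| |].
  + by have [] := dF x (sub _ (subset_itv_oo_cc xI)).
  + by apply: cvg_at_right_filter; apply: cF; rewrite in_itv /= lexx ler01.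
  + by apply: cvg_at_left_filter; apply: cF; rewrite in_itv /= lexx ler01.
- move=> x xI; rewrite derive1E.
  by have [] := dF x (sub _ (subset_itv_oo_cc xI)).
Qed.

Lemma FTC01 (F f : R -> R) : (forall x, is_derive x (1 : R) F (f x)) ->
  continuous f -> \int[mu]_(x in `[0, 1]) f x = F 1 - F 0.
Proof. by move=> dF cf; apply: FTC01_in => x _; exact: cf. Qed.

Lemma row2_e0 (x y : R) : row2 x y = x *: e0 + row2 0 y.
Proof. by rewrite !row2E scale0r add0r. Qed.

Lemma row2_e1 (x y : R) : row2 x y = y *: e1 + row2 x 0.
Proof. by rewrite !row2E scale0r addr0 addrC. Qed.

Lemma row2_0 (x y : R) : (row2 x y) 0 0 = x. Proof. by rewrite mxE. Qed.
Lemma row2_1 (x y : R) : (row2 x y) 0 1 = y. Proof. by rewrite mxE. Qed.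

Lemma continuous_slice0 (h : A2 -> R) (y : R) : continuous h ->
  continuous (fun x => h (row2 x y)).
Proof.
move=> ch x; apply: (@continuous_comp _ _ _ (fun x => row2 x y) h); last exact: ch.
by apply: (@continuous_row2 _ id (cst y)); [exact: cvg_id|exact: cst_continuous].
Qed.

Lemma continuous_slice1 (h : A2 -> R) (x : R) : continuous h ->
  continuous (fun y => h (row2 x y)).
Proof.
move=> ch y; apply: (@continuous_comp _ _ _ (fun y => row2 x y) h); last exact: ch.
by apply: (@continuous_row2 _ (cst x) id); [exact: cst_continuous|exact: cvg_id].
Qed.

Lemma Ck1_derivable V W k (f : V -> W) x v : Ck_on k.+1 setT f -> derivable f x v.
Proof. by move=> [_ /(_ v)[d _]]; exact: d. Qed.

Lemma Ck1_continuous_derive V W k (f : V -> W) v : Ck_on k.+1 setT f ->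
  continuous ('D_v f).
Proof. by move=> [_ /(_ v)[_ /Ck_on_cont c]] x; exact: c. Qed.

Lemma FTC_slice0 (g : A2 -> R^o) (y : R) : Ck_on 1 setT g ->
  \int[mu]_(x in `[0, 1]) 'D_e0 g (row2 x y) = g (row2 1 y) - g (row2 0 y).
Proof.
move=> Cg; apply: (@FTC01 (fun x => g (row2 x y))) => [x|].
  rewrite (_ : (fun x => _) = fun x => g (x *: e0 + row2 0 y)).
    by rewrite [row2 x y]row2_e0; apply: is_derive_line; exact: Ck1_derivable Cg.
  by apply/funext => z; rewrite row2_e0.
by apply: (@continuous_slice0 ('D_e0 g)); exact: Ck1_continuous_derive Cg.
Qed.

Lemma FTC_slice1 (g : A2 -> R^o) (x : R) : Ck_on 1 setT g ->
  \int[mu]_(y in `[0, 1]) 'D_e1 g (row2 x y) = g (row2 x 1) - g (row2 x 0).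
Proof.
move=> Cg; apply: (@FTC01 (fun y => g (row2 x y))) => [y|].
  rewrite (_ : (fun y => _) = fun y => g (y *: e1 + row2 x 0)).
    by rewrite [row2 x y]row2_e1; apply: is_derive_line; exact: Ck1_derivable Cg.
  by apply/funext => z; rewrite row2_e1.
by apply: (@continuous_slice1 ('D_e1 g)); exact: Ck1_continuous_derive Cg.
Qed.

Lemma bounded_on_strip (h : A2 -> R) : continuous h -> exists M : R,
  forall x y : R, x \in `[0, 1] -> y \in `[-1, 2] -> `|h (row2 x y)| <= M.
Proof.
move=> ch; pose A (i : 'I_2) : set R := if i == 0 then `[0, 1]%classic else `[-1, 2]%classic.
have cA : compact [set v : 'rV[R]_2 | forall i, A i (v ord0 i)].
  by apply: rV_compact => i; rewrite /A; case: ifP => _; exact: segment_compact.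
have A0 : [set v : 'rV[R]_2 | forall i, A i (v ord0 i)] !=set0.
  exists (row2 0 0) => i; rewrite /A mxE; case: ifP => _ /=.
    by rewrite in_itv /= lexx ler01.
  by rewrite in_itv /= lerN10 ler0n.
have [|c _ Hc] := @compact_EVT_max _ _ (fun v => `|h v|) _ A0 cA.
  apply: continuous_subspaceT => v.
  by apply: (@continuous_comp _ _ _ h Num.norm); [exact: ch|exact: norm_continuous].
exists `|h c| => x y xI yI; apply: Hc; rewrite inE => i; rewrite /A mxE.
by case: ifP.
Qed.

Lemma integrable01 (f : R -> R) : continuous f ->
  mu.-integrable `[0, 1] (EFin \o f).
Proof.
move=> cf; apply: continuous_compact_integrable; first exact: segment_compact.
exact: continuous_subspaceT.
Qed.

Lemma continuous_integral_slice (h : A2 -> R) : continuous h ->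
  {in (`]-1, 2[%classic : set R),
    continuous (fun y => \int[mu]_(x in `[0, 1]) h (row2 x y))}.
Proof.
move=> ch; have [M HM] := bounded_on_strip ch.
apply: (@continuity_under_integral R _ _ mu (fun y x => h (row2 x y)) `[0, 1] _
  (-1) 2 _ _ (cst M)).
- exact: measurable_itv.
- by move=> y _; apply: integrable01; exact: continuous_slice0.
- by apply/aeW => x _ y _; exact: continuous_slice1.
- by apply: integrable01 => x; exact: cst_continuous.
- move=> y yI; apply/aeW => x xI; apply: HM => //.
  by rewrite in_itv; move: yI; rewrite /= in_itv /= => /andP[/ltW -> /ltW ->].
Qed.

(** Differentiation under the integral sign, which replaces an exchange of the two
    integrals: the outer integrand is the derivative of
    y |-> \int g(x, y) dx. *)
Lemma iterated_integral_derive1 (g : A2 -> R^o) : Ck_on 1 setT g ->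
  \int[mu]_(y in `[0, 1]) (\int[mu]_(x in `[0, 1]) 'D_e1 g (row2 x y)) =
  \int[mu]_(x in `[0, 1]) (g (row2 x 1) - g (row2 x 0)).
Proof.
move=> Cg; have cg : continuous g by move=> x; exact: (Ck_on_cont Cg).
have cdg := @Ck1_continuous_derive _ _ _ _ e1 Cg.
have [M HM] := bounded_on_strip cdg.
rewrite RintegralB//; last 2 first.
- by apply: integrable01; exact: continuous_slice0.
- by apply: integrable01; exact: continuous_slice0.
pose F y := \int[mu]_(x in `[0, 1]) g (row2 x y).
have M0 : 0 <= M.
  by apply: le_trans (HM 0 0 _ _) => //; rewrite in_itv /= ?lexx ?ler01// lerN10 ler0n.
have slice (x y : R) : is_derive y (1 : R) (fun y => g (row2 x y)) ('D_e1 g (row2 x y)).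
  rewrite (_ : (fun y => _) = fun y => g (y *: e1 + row2 x 0)).
    by rewrite [row2 x y]row2_e1; apply: is_derive_line; exact: Ck1_derivable Cg.
  by apply/funext => z; rewrite row2_e1.
have p1 (x y : R) : partial1of2 (fun y x => g (row2 x y)) y x = 'D_e1 g (row2 x y).
  by rewrite partial1of2E; have [] := slice x y.
apply: (@FTC01_in F) => y yI; last first.
  by apply: (@continuous_integral_slice ('D_e1 g) cdg y); exact/mem_set.
have H1 : forall x : R, `]-1, 2[%classic x ->
    mu.-integrable `[0, 1] (EFin \o (fun t => g (row2 t x))).
  by move=> x _; apply: integrable01; exact: continuous_slice0.
have H2 : forall x y : R, `]-1, 2[%classic x -> `[0, 1]%classic y ->
    derivable (fun x => g (row2 y x)) x 1.
  by move=> x z _ _; have [] := slice z x.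
have H3 : mu.-integrable `[0, 1] (EFin \o (fun=> M)).
  by apply: integrable01 => x; exact: cst_continuous.
have H4 : forall x y : R, `]-1, 2[%classic x -> `[0, 1]%classic y ->
    `|partial1of2 (fun y x => g (row2 x y)) x y| <= M.
  move=> x z xI zI; rewrite p1; apply: HM => //.
  by move: xI; rewrite /= !in_itv /= => /andP[/ltW -> /ltW ->].
split.
  exact: (@derivable_under_integral R _ _ mu (fun y x => g (row2 x y)) `[0, 1]
    (@measurable_itv _ _) y (-1) 2 yI H1 H2 (fun=> M) (fun=> M0) H3 H4).
rewrite -derive1E (@differentiation_under_integral R _ _ mu
    (fun y x => g (row2 x y)) `[0, 1]
    (@measurable_itv _ _) y (-1) 2 yI H1 H2 (fun=> M) (fun=> M0) H3 H4).
by apply: eq_Rintegral => x _; exact: p1.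
Qed.

Lemma det_jacobian_smooth (k : A2 -> A2) x : smooth_near k x ->
  \det (jacobian k x) =
  'D_e0 (fun y => k y 0 0 : R^o) x * 'D_e1 (fun y => k y 0 1 : R^o) x -
  'D_e1 (fun y => k y 0 0 : R^o) x * 'D_e0 (fun y => k y 0 1 : R^o) x.
Proof.
move=> sk; have Dk w j : 'D_w k x 0 j = 'D_w (fun y => k y 0 j : R^o) x.
  by rewrite derive_mx ?mxE//; exact: smooth_near_derivable sk.
rewrite (jacobian_smooth sk) det_mx22 4!mxE -4!Dk.
by congr (_ - _); rewrite mulrC.
Qed.

(** The mixed second derivatives of [v] cancel, so that the integral of the
    Jacobian determinant of (u, v) depends only on boundary values. *)
Lemma jacobian_det_divergence (u v : A2 -> R^o) x :
  Ck_on 1 setT u -> Ck_on 2 setT v ->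
  'D_e0 u x * 'D_e1 v x - 'D_e1 u x * 'D_e0 v x =
  'D_e0 (fun x => u x * 'D_e1 v x : R^o) x
  - 'D_e1 (fun x => u x * 'D_e0 v x : R^o) x.
Proof.
move=> Cu Cv.
have CDv w : Ck_on 1 setT ('D_w v) by have [_ /(_ w)[]] := Cv.
have prod w w' : 'D_w (fun x => u x * 'D_w' v x : R^o) x =
    u x * 'D_w ('D_w' v) x + 'D_w' v x * 'D_w u x.
  rewrite -[LHS]/('D_w (u * 'D_w' v) x).
  by apply: deriveM; [exact: Ck1_derivable Cu|exact: Ck1_derivable (CDv w')].
rewrite (prod e0 e1) (prod e1 e0) (Schwarz e0 e1 x Cv).
move: ('D_e0 u x) ('D_e1 u x) ('D_e0 v x) ('D_e1 v x) ('D_e0 ('D_e1 v) x) => p q r s t.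
by rewrite opprD addrACA subrr add0r [q * r]mulrC [p * s]mulrC.
Qed.

(** Opposite sides of the unit square have images that differ by a translation.
    The boundary terms reduce to entries of [A] times increments of the second
    coordinate along the sides, which are entries of [A] too. *)
Lemma integral_jacobian_quasiperiodic (k : A2 -> A2) (A : 'M[R]_2) :
  smooth_on setT k -> (forall i x, k (x + delta_mx 0 i) = k x + row i A) ->
  \int[mu]_(y in `[0, 1]) (\int[mu]_(x in `[0, 1])
    \det (jacobian k (row2 x y))) = \det A.
Proof.
move=> sk kA; pose u x : R^o := k x 0 0; pose v x : R^o := k x 0 1.
have Cu n : Ck_on n setT u by apply: Ck_on_coord; [exact: openT|exact: sk].
have Cv n : Ck_on n setT v by apply: Ck_on_coord; [exact: openT|exact: sk].
have CDv n w : Ck_on n setT ('D_w v) by have [_ /(_ w)[]] := Cv n.+1.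
pose a x : R^o := u x * 'D_e1 v x; pose b x : R^o := u x * 'D_e0 v x.
have Ca n : Ck_on n setT a by apply: Ck_onM => //; exact: openT.
have Cb n : Ck_on n setT b by apply: Ck_onM => //; exact: openT.
have detE x : \det (jacobian k x) = 'D_e0 a x - 'D_e1 b x.
  by rewrite (det_jacobian_smooth (smooth_on_near _ sk)); exact: jacobian_det_divergence.
have kper i x : u (x + delta_mx 0 i) = u x + A i 0 /\
    v (x + delta_mx 0 i) = v x + A i 1 by rewrite /u /v kA !mxE.
have Dvper i w x : 'D_w v (x + delta_mx 0 i) = 'D_w v x.
  rewrite -derive_translate.
  have -> : (fun y => v (y + delta_mx 0 i)) = v + cst (A i 1).
    by apply/funext => y; have [_ ->] := kper i y.
  rewrite deriveD; [|exact: Ck1_derivable (Cv 1%N)|exact: derivable_cst].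
  by rewrite derive_cst addr0.
have r10 y : row2 1 y = row2 0 y + e0 :> A2 by rewrite row2_e0 scale1r addrC.
have r11 x : row2 x 1 = row2 x 0 + e1 :> A2 by rewrite row2_e1 scale1r addrC.
have cD0a := @Ck1_continuous_derive _ _ _ _ e0 (Ca 1%N).
have cD1b := @Ck1_continuous_derive _ _ _ _ e1 (Cb 1%N).
have inner y : \int[mu]_(x in `[0, 1]) \det (jacobian k (row2 x y)) =
    A 0 0 * 'D_e1 v (row2 0 y) - \int[mu]_(x in `[0, 1]) 'D_e1 b (row2 x y).
  under eq_Rintegral do rewrite detE.
  rewrite RintegralB//; last 2 first.
  - exact: (integrable01 (@continuous_slice0 ('D_e0 a) y cD0a)).
  - exact: (integrable01 (@continuous_slice0 ('D_e1 b) y cD1b)).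
  congr (_ - _); rewrite FTC_slice0 // /a r10 Dvper; have [-> _] := kper 0 (row2 0 y).
  by ring.
under eq_Rintegral do rewrite inner.
have cv1 : continuous (fun y => 'D_e1 v (row2 0 y)).
  by apply: (@continuous_slice1 ('D_e1 v)); exact: Ck1_continuous_derive (Cv 1%N).
have cAv : continuous (fun y : R => A 0 0 * 'D_e1 v (row2 0 y) : R).
  by move=> y; apply: cvgM; [exact: cvg_cst|exact: cv1].
rewrite RintegralB//; last 2 first.
- exact: (integrable01 cAv).
- apply: continuous_compact_integrable; first exact: segment_compact.
  apply: continuous_in_subspaceT => y /set_mem yI.
  apply: (@continuous_integral_slice ('D_e1 b) cD1b y); apply/mem_set.
  move: yI; rewrite /= !in_itv /= => /andP[y0 y1].
  by rewrite (lt_le_trans _ y0) ?ltrN10// (le_lt_trans y1)// ltr1n.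
rewrite iterated_integral_derive1// RintegralZl//; last exact: integrable01.
rewrite FTC_slice1//.
have -> : \int[mu]_(x in `[0, 1]) (b (row2 x 1) - b (row2 x 0)) =
    \int[mu]_(x in `[0, 1]) (A 1 0 * 'D_e0 v (row2 x 0)).
  apply: eq_Rintegral => x _; rewrite /b r11 Dvper.
  by have [-> _] := kper 1 (row2 x 0); ring.
have cv0 : continuous (fun x => 'D_e0 v (row2 x 0)).
  by apply: (@continuous_slice0 ('D_e0 v)); exact: Ck1_continuous_derive (Cv 1%N).
rewrite RintegralZl//; last exact: integrable01.
rewrite FTC_slice0// r11 r10 det_mx22.
have [_ ->] := kper 0 (row2 0 0); have [_ ->] := kper 1 (row2 0 0).
by ring.
Qed.

End Calculus.

(** * Connectedness and lattices *)

Section Connectedness.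
Context {R : realType}.
Local Notation A2 := 'rV[R]_2.

(** Connectedness in the form used by the continuation arguments. *)
Lemma R_clopen (P : R -> Prop) :
  (forall t, \forall s \near t, P t <-> P s) -> forall s t, P s -> P t.
Proof.
move=> locP s t Ps; have cT : connected [set: R].
  by apply/connected_intervalP.
have PT : [set x | P x] = setT.
  apply: cT; first by exists s.
  - exists [set x | P x]; last by rewrite setTI.
    rewrite openE => x Px; apply: filterS (locP x) => y [xy _]; exact: xy.
  - exists [set x | P x]; last by rewrite setTI.
    rewrite -[X in closed X]setCK; apply: open_closedC.
    rewrite openE => x Px; apply: filterS (locP x) => y [_ yx] /yx; exact: Px.
by have : [set x | P x] t by rewrite PT.
Qed.

Lemma locally_iff_global (V : normedModType R) (P : V -> Prop) :
  (forall x, \forall y \near x, P x <-> P y) -> forall x y, P x -> P y.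
Proof.
move=> locP x y Px; pose g (t : R) := t *: (y - x) + x.
have cg : continuous g.
  by move=> t; apply: cvgD; [apply: cvgZr_tmp; exact: cvg_id|exact: cvg_cst].
have := @R_clopen (fun t => P (g t)) (fun t => cg t _ (locP (g t))) 0 1.
by rewrite /g scale0r add0r scale1r subrK; exact.
Qed.

Lemma locally_constant (V : normedModType R) (T : Type) (f : V -> T) :
  (forall x, \forall y \near x, f y = f x) -> forall x y, f x = f y.
Proof.
move=> lf x y; have H : forall z, \forall w \near z, (f x = f z) <-> (f x = f w).
  by move=> z; apply: filterS (lf z) => w ->.
exact: (locally_iff_global H).
Qed.

Lemma zvecE (n : 'rV[int]_2) i : zvec n 0 i = (n 0 i)%:~R :> R.
Proof. by rewrite mxE. Qed.

Lemma zvecD m n : zvec (m + n) = zvec m + zvec n :> A2.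
Proof. by apply/rowP => i; rewrite !mxE intrD. Qed.

Lemma zvec0 : zvec 0 = 0 :> A2.
Proof. by apply/rowP => i; rewrite !mxE. Qed.

Lemma zvecN n : zvec (- n) = - zvec n :> A2.
Proof. by apply/rowP => i; rewrite !mxE intrN. Qed.

Lemma zvecB m n : zvec (m - n) = zvec m - zvec n :> A2.
Proof. by rewrite zvecD zvecN. Qed.

Lemma zvec_inj : injective (@zvec R).
Proof.
move=> m n /rowP E; apply/rowP => i; have := E i; rewrite !mxE.
exact: intr_inj.
Qed.

Lemma zvec_delta i : zvec (delta_mx 0 i) = delta_mx 0 i :> A2.
Proof. by apply/rowP => j; rewrite !mxE /=; case: (_ == _). Qed.

Lemma int_small (n : int) : `|n%:~R : R| < 1 -> n = 0.
Proof.
rewrite -intr_norm => h; apply/eqP; rewrite -normr_eq0.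
have : (`|n| < 1)%R by rewrite -(ltr_int R).
by case: (`|n|) (normr_ge0 n) => // -[|].
Qed.

Lemma zvec_small (n : 'rV[int]_2) : `|zvec n : A2| < 1 -> n = 0.
Proof.
move=> h; apply/rowP => i; rewrite mxE; apply: int_small.
by rewrite -zvecE; apply: le_lt_trans h; exact: A2_norm_coord.
Qed.

(** Distinct integer vectors are at distance at least 1. *)
Lemma lattice_valued_locally_constant (T : topologicalType) (f : T -> A2) x :
  (\forall y \near x, exists n, f y = zvec n) -> {for x, continuous f} ->
  \forall y \near x, f y = f x.
Proof.
move=> fz cf; have [m Em] := nbhs_singleton fz.
have /cvgrPdist_lt/(_ 1 ltr01) H : f y @[y --> x] --> f x by exact: cf.
apply: filterS2 fz H => y [n En]; rewrite En Em -zvecB => /zvec_small /eqP.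
by rewrite subr_eq0 => /eqP ->.
Qed.

End Connectedness.

(** * Coverings and their atlases *)

Section Orbits.
Context {G : zmodType} {T : Type} (act : G -> T -> T).
Hypothesis act0 : forall x, act 0 x = x.
Hypothesis actD : forall g h x, act (g + h) x = act g (act h x).

Lemma orbit_cls_eq x y : orbit_cls act x = orbit_cls act y <->
  exists g, y = act g x.
Proof.
split=> [/(congr1 sval) /= E|[g ->]].
  have : orb act y y by exists 0.
  by rewrite -E => -[g _ <-]; exists g.
apply/eq_exist; apply/seteqP; split=> z [h _ <-].
  by exists (h - g) => //; rewrite -actD subrK.
by exists (h + g) => //; rewrite actD.
Qed.

Lemma orbit_cls_repr C : orbit_cls act (orbit_repr C) = C.
Proof.
case: C => C HC; apply/eq_exist; rewrite /orbit_repr.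
by case: cid.
Qed.

End Orbits.

Section Covers.
Context {R : realType}.
Local Notation A2 := 'rV[R]_2.

Lemma cover_inv (M : Type) (V : normedModType R) (q : V -> M) c p :
  cover_atlas q c -> dom c p -> q (cmap c p) = p.
Proof. by move=> [[_ h] <-] /h. Qed.

Lemma cover_chart_near (M : Type) (V : normedModType R) (T : topologicalType)
    (q : V -> M) (g : T -> V) d x0 :
  cover_atlas q d -> dom d (q (g x0)) -> cmap d (q (g x0)) = g x0 ->
  {for x0, continuous g} ->
  \forall y \near x0, dom d (q (g y)) /\ cmap d (q (g y)) = g y.
Proof.
move=> ad dd E cg; have [[oU Ud] qd] := ad.
have : \forall y \near x0, (cmap d @` dom d) (g y).
  by apply: cg; apply: open_near => //; rewrite -E; exists (q (g x0)).
by apply: filterS => y [p dp <-]; rewrite (cover_inv ad dp).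
Qed.

Lemma smooth_at_sub (M N : Type) (V W : normedModType R)
    (a b : set (chart M V)) (a' b' : set (chart N W)) (f : M -> N) p :
  b `<=` a -> b' `<=` a' -> smooth_at a a' f p -> smooth_at b b' f p.
Proof. by move=> ba ba' H c d /ba ac /ba' ad; exact: H. Qed.

(** Charts of a covering atlas are local sections, so that smoothness can be
    tested on smooth local lifts. *)
Lemma smooth_at_cover (M N : Type) (V W : normedModType R) (q : V -> M)
    (q' : W -> N) (f : M -> N) p :
  (forall x0 x1, q x0 = p -> q' x1 = f p -> exists F : V -> W,
     [/\ F x0 = x1, smooth_near F x0 & \forall y \near x0, f (q y) = q' (F y)]) ->
  smooth_at (cover_atlas q) (cover_atlas q') f p.
Proof.
move=> lift c d ac ad cp dfp.
have [F [F0 sF fF]] := lift _ _ (cover_inv ac cp) (cover_inv ad dfp).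
have -> : cinv c = q by case: ac.
have Fx : q' (F (cmap c p)) = f p by rewrite F0 (cover_inv ad).
have := @cover_chart_near _ _ _ q' F d (cmap c p) ad.
rewrite Fx => /(_ dfp (esym F0) (smooth_near_continuous sF)) nF.
split.
  by apply: filterS2 fF nF => y -> [].
by apply: smooth_near_eq sF; apply: filterS2 fF nF => y -> [].
Qed.

Lemma prod_cover (M N : Type) (V W : normedModType R) (q : V -> M)
    (q' : W -> N) :
  prod_atlas (cover_atlas q) (cover_atlas q') `<=`
  cover_atlas (fun z : (V * W)%type => (q z.1, q' z.2)).
Proof.
move=> e [c [d [[[oc cK] cq] [[od dK] dq] ->]]]; split; last first.
  by rewrite /= cq dq.
split=> /= [|[p p'] [/= /cK -> /dK ->] //].
rewrite (_ : _ @` _ = (fst @^-1` (cmap c @` dom c)) `&`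
    (snd @^-1` (cmap d @` dom d))).
  apply: openI.
    by apply: open_comp => //= x _; exact: cvg_fst.
  by apply: open_comp => //= x _; exact: cvg_snd.
apply/seteqP; split=> [_ [[p p'] /= [dp dp'] <-]|[y y'] /= [[p dp <-] [p' dp' <-]]].
  by split; [exists p|exists p'].
by exists (p, p').
Qed.

(** The deck transformations of [q] act as integer translations: [r] is constant
    on the orbits, [s] changes by integer vectors along them, and the two
    together separate the points.  The line, the torus, the Euclidean tori, the
    fibres of the family and its total space are all of this kind. *)
Record straightened (M : Type) (V U : normedModType R) (q : V -> M) (r : V -> U)
    (s : V -> A2) : Prop := Straightened {
  st_surj : forall p, exists x, q x = p;
  st_deck : forall x y, q x = q y -> exists g : V -> V,
     [/\ g x = y, smooth_on setT g & forall z, q (g z) = q z];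
  st_contr : continuous r;
  st_conts : continuous s;
  st_inj : forall x y, r x = r y -> s x = s y -> x = y;
  st_eqr : forall x y, q x = q y -> r x = r y;
  st_eqs : forall x y, q x = q y -> exists n, s y = s x + zvec n;
  st_eq : forall x y n, r x = r y -> s y = s x + zvec n -> q x = q y }.

Fact integer_gap (a x b y n m e : R) : b = a + n ->
  e * 2 <= y - x - m -> e * 2 <= m + 1 - (y - x) ->
  - e < a - x -> a - x < e -> - e < b - y -> b - y < e -> m < n /\ n < m + 1.
Proof. by move=> -> *; split; lra. Qed.

Section Straightened.
Context (M : Type) (V U : normedModType R) (q : V -> M) (r : V -> U)
  (s : V -> A2) (S : straightened q r s).

Definition st_box (w : A2) : set V := [set x | forall i, `|s x 0 i - w 0 i| < 2^-1].

Lemma st_box_open w : open (st_box w).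
Proof.
rewrite openE => x xw; rewrite /interior.
apply: (@filter_forall _ _ _ (nbhs x)) => i.
have ci : {for x, continuous (fun y => `|s y 0 i - w 0 i| : R)}.
  apply: (@continuous_comp _ _ _ (fun y => s y 0 i - w 0 i) Num.norm).
    apply: cvgB; last exact: cvg_cst.
    apply: (@continuous_comp _ _ _ s (fun v : A2 => v 0 i)).
      exact: (st_conts S).
    exact: coord_continuous.
  exact: norm_continuous.
by have := cvgr_lt _ ci; exact.
Qed.

(** Two points of a box have images under [s] with coordinates that differ by less
    than 1, so they are not related by a nonzero integer translation. *)
Lemma st_box_inj w x y : st_box w x -> st_box w y -> q x = q y -> x = y.
Proof.
move=> xw yw qxy; apply: (st_inj S); first exact: (st_eqr S qxy).
have [n E] := st_eqs S qxy; suff n0 : n = 0 by rewrite E n0 zvec0 addr0.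
apply/rowP => i; rewrite mxE; apply: (@int_small R).
have -> : (n 0 i)%:~R = (s y 0 i - w 0 i) - (s x 0 i - w 0 i) :> R.
  by rewrite E mxE zvecE; ring.
apply: le_lt_trans (ler_normB _ _) _.
by rewrite [ltRHS](splitr 1) !mul1r ltrD// ?xw ?yw.
Qed.

Definition st_chart (w : A2) : chart M V :=
  Chart (q @` st_box w) (fun p => xget 0 [set x | st_box w x /\ q x = p]) q.

Lemma st_chartE w x : st_box w x -> cmap (st_chart w) (q x) = x.
Proof.
move=> xw; rewrite /=; case: xgetP => [y _ [yw qy]|/(_ x)]; last by case.
exact: st_box_inj yw xw qy.
Qed.

Lemma st_chart_atlas w : cover_atlas q (st_chart w).
Proof.
split=> //; split=> [|p [x xw <-]]; last by rewrite st_chartE.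
rewrite (_ : _ @` _ = st_box w); first exact: st_box_open.
apply/seteqP; split=> [_ [_ [x xw <-] <-]|x xw]; first by rewrite st_chartE.
by exists (q x); [exists x|rewrite st_chartE].
Qed.

Lemma st_chart_at x : exists c,
  [/\ cover_atlas q c, dom c (q x) & cmap c (q x) = x].
Proof.
have xw : st_box (s x) x by move=> i; rewrite subrr normr0 invr_gt0.
by exists (st_chart (s x)); split; [exact: st_chart_atlas|exists x|exact: st_chartE].
Qed.

Lemma st_mopen (O : set V) : open O -> mopen (cover_atlas q) (q @` O).
Proof.
move=> oO c p ac dp [z Oz qz]; have -> : cinv c = q by case: ac.
have [g [gx sg qg]] := st_deck S (etrans (cover_inv ac dp) (esym qz)).
have : \forall y \near cmap c p, O (g y).
  apply: (Ck_on_cont (sg 0%N)) => //; rewrite gx; exact: open_near.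
by apply: filterS => y Oy; exists (g y).
Qed.

(** If [r] does not separate the two points, then some coordinate of the
    difference of their images under [s] is not an integer; its distance to the
    integers is at least [2 * e], and moving each point by less than [e] keeps
    it away from them. *)
Lemma st_hausdorff : mhausdorff (cover_atlas q).
Proof.
move=> p p' pp'; have [x qx] := st_surj S p; have [x' qx'] := st_surj S p'.
subst p p'.
suff : exists O O' : set V,
    [/\ open O, open O', O x, O' x' & forall z z', O z -> O' z' -> q z <> q z'].
  move=> [A [B [oA oB Ax Bx H]]]; exists (q @` A), (q @` B); split.
  - exact: st_mopen.
  - exact: st_mopen.
  - by exists x.
  - by exists x'.
  by apply/seteqP; split=> // _ [[z Az <-] [z' Bz' /esym]]; exact: H.
have [rxx|rxx] := pselect (r x = r x'); last first.
  have := @norm_hausdorff _ U; rewrite open_hausdorff => /(_ (r x) (r x')).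
  case=> [|[A B] /= [/set_mem Ax /set_mem Bx] [oA oB /eqP AB]]; first exact/eqP.
  exists (r @^-1` A), (r @^-1` B); split => //.
  - by apply: open_comp => // z _; exact: (st_contr S).
  - by apply: open_comp => // z _; exact: (st_contr S).
  - move=> z z' Az Bz qz; suff : (A `&` B) (r z) by rewrite AB.
    by split=> //; rewrite (st_eqr S qz).
have [i Hi] : exists i, forall n : int, s x' 0 i != s x 0 i + n%:~R.
  apply: contrapT => /forallNP Hn; apply: pp'.
  have /choice[f Hf] : forall i, exists n : int, s x' 0 i = s x 0 i + n%:~R.
    by move=> i; have /existsNP[n /negP/negPn/eqP] := Hn i; exists n.
  apply: (@st_eq _ _ _ _ _ _ S x x' (\row_i f i)) => //.
  by apply/rowP => i; rewrite !mxE Hf.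
pose d := s x' 0 i - s x 0 i; pose m := Num.floor d.
have md : m%:~R < d.
  rewrite lt_neqAle floor_le andbT; apply: contraNneq (Hi m) => E.
  by rewrite E /d addrC subrK.
have dm : d < (m + 1)%:~R by exact: floorD1_gt.
pose e := Num.min (d - m%:~R) ((m + 1)%:~R - d) / 2.
have e0 : 0 < e by rewrite divr_gt0// lt_min !subr_gt0 md dm.
have oB (w : V) : open [set z | `|s z 0 i - s w 0 i| < e].
  rewrite openE => z zw; rewrite /interior.
  have ci : {for z, continuous (fun y => `|s y 0 i - s w 0 i| : R)}.
    apply: (@continuous_comp _ _ _ (fun y => s y 0 i - s w 0 i) Num.norm).
      apply: cvgB; last exact: cvg_cst.
      apply: (@continuous_comp _ _ _ s (fun v : A2 => v 0 i)).
        exact: (st_conts S).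
      exact: coord_continuous.
    exact: norm_continuous.
  by have := cvgr_lt _ ci; exact.
exists [set z | `|s z 0 i - s x 0 i| < e], [set z | `|s z 0 i - s x' 0 i| < e].
split; try exact: oB; rewrite /= ?subrr ?normr0 //.
move=> z z' zx zx' qz; have [n E] := st_eqs S qz.
have Ei : s z' 0 i = s z 0 i + (n 0 i)%:~R by rewrite E mxE zvecE.
have e1 : e * 2 <= d - m%:~R by rewrite /e divfK ?pnatr_eq0// ge_min lexx.
have e2 : e * 2 <= (m + 1)%:~R - d by rewrite /e divfK ?pnatr_eq0// ge_min lexx orbT.
move: zx zx'; rewrite /= !ltr_norml => /andP[a1 a2] /andP[b1 b2].
rewrite intrD in e2; have [] := integer_gap Ei e1 e2 a1 a2 b1 b2.
by rewrite -(intrD _ m 1) !ltr_int ltzD1 => mn; rewrite leNgt mn.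
Qed.

Lemma st_smooth_id : smooth_map (cover_atlas q) (cover_atlas q) id.
Proof.
move=> p; apply: smooth_at_cover => x0 x1 q0 q1.
have [g [g0 sg qg]] := st_deck S (etrans q0 (esym q1)).
exists g; split => //; first exact: smooth_on_near.
by apply: nearW => y; rewrite qg.
Qed.

Lemma st_manifold : smooth_manifold (cover_atlas q).
Proof.
split; [by move=> c []| |exact: st_smooth_id|exact: st_hausdorff|].
  move=> p; have [x <-] := st_surj S p.
  by have [c [ac dc _]] := st_chart_at x; exists c.
(* Boxes have half-side 1/2: those centred at halves of integer vectors cover. *)
pose w (k : nat) : A2 := 2^-1 *: zvec (odflt 0 (unpickle k : option 'rV[int]_2)).
exists (fun k => st_chart (w k)); split=> [k|p]; first exact: st_chart_atlas.
have [x <-] := st_surj S p.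
pose n : 'rV[int]_2 := \row_i Num.floor (2 * s x 0 i).
exists (pickle n); exists x => // i; rewrite /w pickleK /= !mxE.
have := floor_le (2 * s x 0 i); have := floorD1_gt (2 * s x 0 i).
rewrite intrD; move: (_%:~R) => m h1 h2.
rewrite ger0_norm; last by rewrite subr_ge0 ler_pdivrMl.
by rewrite ltrBlDr -[X in X + _]mulr1 -mulrDr ltr_pdivlMl// addrC.
Qed.

End Straightened.

Lemma st_affine_surface (M : Type) (U : normedModType R) (q : A2 -> M)
    (r : A2 -> U) (s : A2 -> A2) : straightened q r s ->
  (forall x y, q x = q y -> exists g : A2 -> A2,
     [/\ g x = y, Aff2 g & forall z, q (g z) = q z]) ->
  affine_surface (cover_atlas q).
Proof.
move=> S deck; split=> [|c d p ac ad cp dp]; first exact: st_manifold S.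
have [g [g0 Ag qg]] := deck _ _ (etrans (cover_inv ac cp) (esym (cover_inv ad dp))).
exists g => //; have -> : cinv c = q by case: ac.
have cg : {for cmap c p, continuous g}.
  have [B [b [_ ->]]] := Ag.
  by apply: smooth_near_continuous; apply: smooth_on_near; exact: affine_smooth.
have := @cover_chart_near _ _ _ q g d (cmap c p) ad.
rewrite qg (cover_inv ac cp) g0 => /(_ dp erefl cg).
by apply: filterS => y [_]; rewrite qg.
Qed.

End Covers.

(** * The coverings of the family *)

Section Family.
Context {R : realType}.
Local Notation A2 := 'rV[R]_2.
Local Notation L1 := 'rV[R]_1.
Implicit Types V W : normedModType R.

Lemma row2P (u v : A2) : u 0 0 = v 0 0 -> u 0 1 = v 0 1 -> u = v.
Proof. by move=> h0 h1; rewrite -[u]row2_eta -[v]row2_eta h0 h1. Qed.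

Lemma PhiK (a : R) : cancel (Phi a) (Phi_inv a).
Proof. by move=> v; apply: row2P; rewrite /Phi_inv /Phi !(row2_0, row2_1) ?addrK. Qed.

Lemma Phi_invE (a : R) : Phi_inv a = Phi (- a).
Proof. by apply/funext => v; rewrite /Phi_inv /Phi mulrN mulNr. Qed.

Lemma Ck_on_Phi V k (D : set V) (f : V -> R^o) (g : V -> A2) : open D ->
  Ck_on k D f -> Ck_on k D g -> Ck_on k D (fun y => Phi (f y) (g y)).
Proof.
move=> oD Cf Cg; have Cg0 i : Ck_on k D (fun y => g y 0 i : R^o).
  exact: Ck_on_coord.
apply: Ck_on_row2 => //; apply: Ck_onD => //.
apply: Ck_onM => //; last exact: Ck_onM.
by apply: Ck_onM => //; exact: Ck_on_cst.
Qed.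

Lemma Ck_on_Phi_inv V k (D : set V) (f : V -> R^o) (g : V -> A2) : open D ->
  Ck_on k D f -> Ck_on k D g -> Ck_on k D (fun y => Phi_inv (f y) (g y)).
Proof.
move=> oD Cf Cg.
apply: (@Ck_on_eq _ _ _ _ _ (fun y => Phi (- f y : R^o) (g y))) => //.
  by move=> y _; rewrite Phi_invE.
by apply: Ck_on_Phi => //; exact: Ck_onN.
Qed.

Lemma holE (a : R) n v : hol a n v = Phi a (Phi_inv a v + zvec n).
Proof. by []. Qed.

Lemma hol0 (a : R) v : hol a 0 v = v.
Proof. by rewrite holE zvec0 addr0 Phi_invK. Qed.

Lemma holD (a : R) m n v : hol a (m + n) v = hol a m (hol a n v).
Proof. by rewrite !holE PhiK -addrA -zvecD [n + m]addrC. Qed.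

Lemma hol_Phi (a : R) n x : hol a n (Phi a x) = Phi a (x + zvec n).
Proof. by rewrite holE PhiK. Qed.

(** The linear holonomy is unipotent: it fixes the vertical direction. *)
Definition hol_lin (a : R) (n : 'rV[int]_2) : 'M[R]_2 :=
  1%:M + (a * (n 0 0)%:~R) *: delta_mx 0 1.

Lemma mul_hol_lin (a : R) n (v : A2) :
  v *m hol_lin a n = row2 (v 0 0) (v 0 1 + a * (n 0 0)%:~R * v 0 0).
Proof.
rewrite /hol_lin mulmxDr mulmx1 -scalemxAr.
have -> : v *m (delta_mx 0 1 : 'M[R]_2) = row2 0 (v 0 0).
  apply/row2P; rewrite ?row2_0 ?row2_1 mxE big_ord_recl big_ord1 !mxE /=.
    by rewrite !mulr0 addr0.
  by rewrite mulr1 mulr0 addr0; congr (v 0 _); exact: val_inj.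
by apply: row2P; rewrite ?row2_0 ?row2_1 !mxE /= ?mulr0 ?addr0.
Qed.

Lemma hol_affine (a : R) n v : hol a n v = v *m hol_lin a n +
  row2 (n 0 0)%:~R ((n 0 1)%:~R + 2^-1 * a * (n 0 0)%:~R ^+ 2).
Proof.
rewrite holE mul_hol_lin; apply: row2P; rewrite /Phi /Phi_inv;
  rewrite !(row2_0, row2_1, mxE) /= ?zvecE //.
by field.
Qed.

Lemma det_hol_lin (a : R) n : \det (hol_lin a n) = 1.
Proof. by rewrite det_mx22 /hol_lin !mxE /=; ring. Qed.

Lemma hol_Aff2 (a : R) n : Aff2 (hol a n).
Proof.
exists (hol_lin a n); eexists; split; first by rewrite det_hol_lin.
by apply/funext => v; rewrite hol_affine.
Qed.

Lemma straightened_line :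
  straightened (fun y : L1 => y 0 0) (fun y : L1 => y) (fun=> 0 : A2).
Proof.
have inj (x y : L1) : x 0 0 = y 0 0 -> x = y.
  by move=> E; apply/rowP => i; rewrite ord1.
split.
- by move=> p; exists (const_mx p); rewrite mxE.
- move=> x y /inj <-; exists (fun z => z); split => // k; exact: Ck_on_id.
- by move=> x; exact: cvg_id.
- by move=> x; exact: cst_continuous.
- by [].
- by move=> x y /inj.
- by move=> x y _; exists 0; rewrite zvec0 addr0.
- by move=> x y n ->.
Qed.

Lemma transl_deck (x y : A2) n : y = x + zvec n ->
  [/\ x + zvec n = y, smooth_on setT (fun z : A2 => z + zvec n) &
      Aff2 (fun z : A2 => z + zvec n)].
Proof.
move=> ->; split=> // [k|].
  by apply: Ck_onD; [exact: openT|exact: Ck_on_id|exact: Ck_on_cst].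
exists 1%:M, (zvec n); rewrite det1 ltr01; split=> //.
by apply/funext => v; rewrite mulmx1.
Qed.

Lemma pi2_eq (x y : A2) : pi2 x = pi2 y <-> exists n, y = x + zvec n.
Proof.
apply: (@orbit_cls_eq _ _ transl) => [z|m n z]; rewrite /transl.
  by rewrite zvec0 addr0.
by rewrite zvecD [zvec m + _]addrC addrA.
Qed.

Lemma pi2_repr (t : @T2 R) : pi2 (orbit_repr t) = t.
Proof. exact: orbit_cls_repr. Qed.

Lemma pi2_transl (x : A2) n : pi2 (x + zvec n) = pi2 x.
Proof. by apply/esym/pi2_eq; exists n. Qed.

Lemma straightened_T2 : straightened (@pi2 R) (fun=> 0 : A2) (fun x : A2 => x).
Proof.
split.
- by move=> t; exists (orbit_repr t); exact: pi2_repr.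
- move=> x y /pi2_eq[n /transl_deck[gx sg _]]; exists (fun z => z + zvec n).
  by split => // z; exact: pi2_transl.
- by move=> x; exact: cst_continuous.
- by move=> x; exact: cvg_id.
- by [].
- by [].
- by move=> x y /pi2_eq.
- by move=> x y n _ E; apply/pi2_eq; exists n.
Qed.

Lemma lattice_cls_eq (L : 'M[R]_2) x y :
  orbit_cls (lattice_act L) x = orbit_cls (lattice_act L) y <->
  exists n, y = x + zvec n *m L.
Proof.
apply: (@orbit_cls_eq _ _ (lattice_act L)) => [z|m n z]; rewrite /lattice_act.
  by rewrite zvec0 mul0mx addr0.
by rewrite zvecD mulmxDl [zvec m *m _ + _]addrC addrA.
Qed.

Lemma straightened_lattice (L : 'M[R]_2) : L \in unitmx ->
  straightened (orbit_cls (lattice_act L)) (fun=> 0 : A2)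
    (fun x : A2 => x *m invmx L).
Proof.
move=> uL; split.
- move=> t; exists (orbit_repr t); exact: orbit_cls_repr.
- move=> x y /lattice_cls_eq[n ->]; exists (fun z => z + zvec n *m L); split => //.
    by move=> k; apply: Ck_onD; [exact: openT|exact: Ck_on_id|exact: Ck_on_cst].
  by move=> z; apply/esym/lattice_cls_eq; exists n.
- by move=> x; exact: cst_continuous.
- have C : Ck_on 0 setT (fun y : A2 => y *m invmx L).
    by apply: Ck_on_mulmx; [exact: openT|exact: Ck_on_id].
  by move=> x; exact: (Ck_on_cont C).
- by move=> x y _ /(congr1 (mulmx^~ L)) /=; rewrite !mulmxKV.
- by [].
- by move=> x y /lattice_cls_eq[n ->]; exists n; rewrite mulmxDl mulmxK.
- move=> x y n _ /(congr1 (mulmx^~ L)) /=; rewrite mulmxDl !mulmxKV // => E.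
  by apply/lattice_cls_eq; exists n.
Qed.

Lemma E_cls_eq (a b : R) v w : E_cls a v = E_cls b w <->
  b = a /\ exists n, w = hol a n v.
Proof.
rewrite /E_cls; split=> [/orbit_cls_eq|[-> [n ->]]].
- by case=> [z|m n z|n [-> ->]]; rewrite /E_act ?hol0 ?holD;
    [case: z| |split=> //; exists n].
- apply/orbit_cls_eq => [z|m k z|]; rewrite /E_act ?hol0 ?holD //.
    by case: z.
  by exists n.
Qed.

Lemma E_fib_eq (a : R) v w : E_fib_cls a v = E_fib_cls a w <->
  exists n, w = hol a n v.
Proof.
split=> [/(congr1 sval) /E_cls_eq[]//|wn].
by apply/eq_exist/E_cls_eq.
Qed.

Lemma E_fib_surj (a : R) (e : fibre (E_family R) a) :
  exists v, E_fib_cls a v = e.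
Proof.
case: e => e Pe; exists (orbit_repr e).2; apply/eq_exist.
rewrite /E_cls -{1}Pe /proj /= /E_proj -surjective_pairing.
exact: orbit_cls_repr.
Qed.

Lemma Phi_inv_hol (a : R) n v : Phi_inv a (hol a n v) = Phi_inv a v + zvec n.
Proof. by rewrite holE PhiK. Qed.

Lemma hol_of_Phi_inv (a : R) n v w : Phi_inv a w = Phi_inv a v + zvec n ->
  w = hol a n v.
Proof. by move=> E; rewrite holE -E Phi_invK. Qed.

Lemma smooth_Phi (a : R) : smooth_on setT (Phi a).
Proof.
by move=> k; apply: (@Ck_on_Phi _ k setT (cst a : A2 -> R^o) (fun x => x));
  [exact: openT|exact: Ck_on_cst|exact: Ck_on_id].
Qed.

Lemma smooth_Phi_inv (a : R) : smooth_on setT (Phi_inv a).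
Proof. by rewrite Phi_invE; exact: smooth_Phi. Qed.

Lemma smooth_hol (a : R) n : smooth_on setT (hol a n).
Proof.
have -> : hol a n = fun v => v *m hol_lin a n +
    row2 (n 0 0)%:~R ((n 0 1)%:~R + 2^-1 * a * (n 0 0)%:~R ^+ 2).
  by apply/funext => v; rewrite hol_affine.
exact: affine_smooth.
Qed.

Lemma straightened_fibre (a : R) :
  straightened (E_fib_cls a) (fun=> 0 : A2) (Phi_inv a).
Proof.
split.
- exact: E_fib_surj.
- move=> x y /E_fib_eq[n ->]; exists (hol a n); split=> //.
    exact: smooth_hol.
  by move=> z; apply/esym/E_fib_eq; exists n.
- by move=> x; exact: cst_continuous.
- by move=> x; exact: smooth_near_continuous (smooth_on_near _ (@smooth_Phi_inv a)).
- by move=> x y _; exact: (can_inj (Phi_invK a)).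
- by [].
- by move=> x y /E_fib_eq[n ->]; exists n; exact: Phi_inv_hol.
- by move=> x y n _ /hol_of_Phi_inv E; apply/E_fib_eq; exists n.
Qed.

Definition E_cov (z : (L1 * A2)%type) : @E_tot R := E_cls (z.1 0 0) z.2.

Lemma continuous_smooth V W (f : V -> W) : smooth_on setT f -> continuous f.
Proof. by move=> sf x; exact: (smooth_near_continuous (smooth_on_near x sf)). Qed.

Lemma smooth_param V (g : V -> L1) : smooth_on setT g ->
  forall k, Ck_on k setT (fun y => g y 0 0 : R^o).
Proof. by move=> sg k; apply: Ck_on_coord; [exact: openT|exact: sg]. Qed.

Lemma smooth_fst V W : smooth_on setT (fun z : V * W => z.1).
Proof. by move=> k; apply: Ck_on_lin => [a [u u'] [v v'] //|z]; exact: cvg_fst. Qed.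

Lemma smooth_snd V W : smooth_on setT (fun z : V * W => z.2).
Proof. by move=> k; apply: Ck_on_lin => [a [u u'] [v v'] //|z]; exact: cvg_snd. Qed.

Lemma smooth_Phi_pair : smooth_on setT (fun z : L1 * A2 => Phi (z.1 0 0) z.2).
Proof.
move=> k; apply: Ck_on_Phi; first exact: openT.
  by apply: smooth_param; exact: smooth_fst.
exact: smooth_snd.
Qed.

Lemma smooth_Phi_inv_pair n :
  smooth_on setT (fun z : L1 * A2 => Phi_inv (z.1 0 0) z.2 + zvec n).
Proof.
move=> k; apply: Ck_onD; [exact: openT| |exact: Ck_on_cst].
apply: Ck_on_Phi_inv; first exact: openT.
  by apply: smooth_param; exact: smooth_fst.
exact: smooth_snd.
Qed.

Lemma smooth_hol_pair n :
  smooth_on setT (fun z : L1 * A2 => (z.1, hol (z.1 0 0) n z.2)).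
Proof.
move=> k; apply: Ck_on_pair; [exact: openT|exact: smooth_fst|].
apply: Ck_on_Phi; first exact: openT.
  by apply: smooth_param; exact: smooth_fst.
exact: smooth_Phi_inv_pair.
Qed.

Lemma L1_inj (x y : L1) : x 0 0 = y 0 0 -> x = y.
Proof. by move=> E; apply/rowP => i; rewrite ord1. Qed.

Lemma E_cov_eq x y : E_cov x = E_cov y <->
  y.1 = x.1 /\ exists n, y.2 = hol (x.1 0 0) n x.2.
Proof.
rewrite /E_cov; split=> [/E_cls_eq[/L1_inj -> ?]|[-> E]]; first by split.
by apply/E_cls_eq.
Qed.

Lemma straightened_E : straightened E_cov (fun z => z.1)
  (fun z => Phi_inv (z.1 0 0) z.2).
Proof.
split.
- move=> e; exists (const_mx (orbit_repr e).1, (orbit_repr e).2).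
  rewrite /E_cov /= mxE /E_cls -surjective_pairing.
  exact: orbit_cls_repr.
- move=> x y /E_cov_eq[xy1 [n xy2]].
  exists (fun z : L1 * A2 => (z.1, hol (z.1 0 0) n z.2)); split.
  + by rewrite [RHS]surjective_pairing xy1 xy2.
  + exact: smooth_hol_pair.
  + by move=> z; apply/esym/E_cov_eq; split=> //; exists n.
- exact: continuous_smooth (@smooth_fst _ _).
- apply: continuous_smooth => k.
  apply: (@Ck_on_eq _ _ _ _ _ (fun z : L1 * A2 => Phi_inv (z.1 0 0) z.2 + zvec 0)).
  + exact: openT.
  + by move=> z _; rewrite zvec0 addr0.
  + exact: smooth_Phi_inv_pair.
- move=> [x v] [y w] /= -> /(can_inj (Phi_invK _)) -> //.
- by move=> x y /E_cov_eq[].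
- by move=> x y /E_cov_eq[-> [n ->]]; exists n; exact: Phi_inv_hol.
- move=> x y n xy; rewrite -xy => /hol_of_Phi_inv E; apply/E_cov_eq.
  by split=> //; exists n.
Qed.

Lemma E_marking_pi2 (a : R) x : E_marking a (pi2 x) = E_fib_cls a (Phi a x).
Proof.
apply/E_fib_eq; have /pi2_eq[n E] : pi2 (orbit_repr (pi2 x)) = pi2 x.
  exact: pi2_repr.
by exists n; rewrite hol_Phi -E.
Qed.

End Family.

(** * The family is differentiable *)

Section FamilyStructure.
Context {R : realType}.
Local Notation A2 := 'rV[R]_2.
Local Notation L1 := 'rV[R]_1.

Lemma near_everywhere (V : normedModType R) (P : V -> Prop) (x : V) :
  (forall y, P y) -> \forall y \near x, P y.
Proof. by move=> h; apply: nearW. Qed.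

Lemma smooth_map_Phi :
  smooth_map (prod_atlas line_atlas (vec_atlas A2)) (vec_atlas A2)
    (fun z : R * A2 => Phi z.1 z.2).
Proof.
move=> p; apply: smooth_at_sub (@prod_cover _ _ _ _ _ _ _) (@subset_refl _ _) _.
apply: smooth_at_cover => x0 x1 <- /= ->.
exists (fun z : L1 * A2 => Phi (z.1 0 0) z.2); split => //.
  exact: smooth_on_near smooth_Phi_pair.
by apply: near_everywhere.
Qed.

Lemma diffeo_Phi (a : R) : diffeo (Phi a).
Proof.
exists (Phi_inv a); split; [exact: PhiK|exact: Phi_invK|exact: smooth_Phi|].
exact: smooth_Phi_inv.
Qed.

Lemma diffeo_local_diffeo (f : A2 -> A2) : diffeo f -> local_diffeo f.
Proof.
move=> [g [fK gK sf sg]] x; exists setT, g.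
have -> : f @` setT = setT by apply/seteqP; split=> // y _; exists (g y).
by split; [exact: openT| |exact: openT|split].
Qed.

Lemma developing_Phi (a : R) : developing_map (Phi a) (hol a).
Proof.
split; [exact/diffeo_local_diffeo/diffeo_Phi|exact: hol_Aff2| |].
  by move=> m n; apply/funext => v; rewrite holD.
by move=> n x; rewrite hol_Phi.
Qed.

Lemma fibre_affine_surface (a : R) : affine_surface (@fib_atlas _ _ _ (E_family R) a).
Proof.
apply: st_affine_surface (straightened_fibre a) _ => x y /E_fib_eq[n ->].
exists (hol a n); split=> //; first exact: hol_Aff2.
by move=> z; apply/esym/E_fib_eq; exists n.
Qed.

Lemma fibre_complete_dev (a : R) : complete_dev (E_marked a) (Phi a) (hol a).
Proof.
split; [exact: developing_Phi| |exact: diffeo_Phi].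
move=> x d ad; rewrite /= E_marking_pi2 => dx.
have /E_fib_eq[n E] := esym (cover_inv ad dx).
pose g x := hol a n (Phi a x).
have gE y : E_fib_cls a (g y) = E_fib_cls a (Phi a y).
  by apply/esym/E_fib_eq; exists n.
have cg : continuous g.
  move=> z; apply: (@continuous_comp _ _ _ (Phi a) (hol a n)).
    exact: continuous_smooth (@smooth_Phi _ a) z.
  exact: continuous_smooth (@smooth_hol _ a n) _.
have := @cover_chart_near _ _ _ _ (E_fib_cls a) g d x ad.
rewrite gE -/(g x) in E *; rewrite E => /(_ dx erefl (cg x)) H.
split; first by apply: filterS H => y [+ _]; rewrite gE E_marking_pi2.
exists (hol a n); first exact: hol_Aff2.
by apply: filterS H => y [_]; rewrite gE E_marking_pi2.
Qed.

Lemma fibre_mdiffeo (a : R) :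
  mdiffeo T2_atlas (@fib_atlas _ _ _ (E_family R) a) (E_marking a).
Proof.
pose theta (e : fibre (E_family R) a) : T2 :=
  pi2 (Phi_inv a (sval (cid (E_fib_surj e)))).
have thetaE v : theta (E_fib_cls a v) = pi2 (Phi_inv a v).
  rewrite /theta; case: cid => w /= /E_fib_eq[n ->].
  by rewrite Phi_inv_hol pi2_transl.
exists theta; split.
- move=> t; rewrite -[t in LHS]pi2_repr E_marking_pi2 thetaE PhiK.
  exact: pi2_repr.
- move=> e; have [v <-] := E_fib_surj e.
  by rewrite thetaE E_marking_pi2 Phi_invK.
- move=> p; apply: smooth_at_cover => x0 x1 <-; rewrite E_marking_pi2 => E.
  have /E_fib_eq[n ->] := esym E.
  exists (fun x => Phi a (x + zvec n)); split; first by rewrite hol_Phi.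
    apply: smooth_on_near => k.
    apply: (@Ck_on_Phi _ _ k setT (cst a : A2 -> R^o)); first exact: openT.
      exact: Ck_on_cst.
    by apply: Ck_onD; [exact: openT|exact: Ck_on_id|exact: Ck_on_cst].
  by apply: near_everywhere => y; rewrite E_marking_pi2; apply/E_fib_eq; exists n; rewrite hol_Phi.
- move=> p; apply: smooth_at_cover => x0 x1 <-; rewrite thetaE => E.
  have /pi2_eq[n ->] := esym E.
  exists (fun v => Phi_inv a v + zvec n); split=> //.
    apply: smooth_on_near => k.
    by apply: Ck_onD; [exact: openT|exact: smooth_Phi_inv|exact: Ck_on_cst].
  by apply: near_everywhere => y; rewrite thetaE pi2_transl.
Qed.

(** [Phi a] is a shear along the vertical direction, hence preserves areas. *)
Lemma det_jacobian_Phi (a : R) (k : A2 -> A2) x : smooth_near k x ->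
  \det (jacobian (fun y => Phi a (k y)) x) = \det (jacobian k x).
Proof.
move=> sk; have [D [oD Dx Ck]] := sk.
have sP : smooth_near (fun y => Phi a (k y)) x.
  exists D; split=> // n; apply: (@Ck_on_Phi _ _ n D (cst a : A2 -> R^o)) => //.
  exact: Ck_on_cst.
apply: (etrans (det_jacobian_smooth sP)).
apply: (etrans _ (esym (det_jacobian_smooth sk))).
pose u y : R^o := k y 0 0; pose v y : R^o := k y 0 1.
have du w : derivable u x w.
  have C : Ck_on 1 D u by apply: Ck_on_coord.
  by have [_ /(_ w)[d _]] := C; exact: d.
have dv w : derivable v x w.
  have C : Ck_on 1 D v by apply: Ck_on_coord.
  by have [_ /(_ w)[d _]] := C; exact: d.
have E0 w : 'D_w (fun y => Phi a (k y) 0 0 : R^o) x = 'D_w u x.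
  by congr ('D_w _ x); apply/funext => y; rewrite /Phi row2_0.
have E1 w : 'D_w (fun y => Phi a (k y) 0 1 : R^o) x =
    'D_w v x + (a * u x) * 'D_w u x.
  have -> : (fun y => Phi a (k y) 0 1 : R^o) = v + (2^-1 * a) *: (u * u).
    by apply/funext => y; rewrite /Phi row2_1.
  have duu : derivable (u * u) x w by exact: derivableM.
  have dZ := @derivableZ _ _ _ (u * u) (2^-1 * a) x w duu.
  rewrite (@deriveD _ _ _ v ((2^-1 * a) *: (u * u)) x w (dv w) dZ).
  rewrite (@deriveZ _ _ _ (u * u) (2^-1 * a) x w duu).
  rewrite (@deriveM _ _ u u x w (du w) (du w)).
  move: ('D_w u x) (u x) ('D_w v x) => p q r.
  by rewrite -[_ *: (_ + _)]/(2^-1 * a * (q * p + q * p)); field.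
rewrite (E0 (delta_mx 0 0)) (E0 (delta_mx 0 1)).
rewrite (E1 (delta_mx 0 0)) (E1 (delta_mx 0 1)) -/u -/v.
move: ('D_(delta_mx 0 0) u x) ('D_(delta_mx 0 1) u x) ('D_(delta_mx 0 0) v x)
  ('D_(delta_mx 0 1) v x) (u x) => p q r s t.
by ring.
Qed.

Lemma fibre_orientation (a : R) : orientation_preserving T2_atlas
  (@fib_atlas _ _ _ (E_family R) a) (E_marking a).
Proof.
move=> c d p ac ad cp dp.
have E : E_fib_cls a (Phi a (cmap c p)) = E_marking a p.
  by rewrite -E_marking_pi2 (cover_inv ac cp).
have /E_fib_eq[n En] := etrans E (esym (cover_inv ad dp)).
have -> : cinv c = pi2 by case: ac.
pose g x := Phi a (x + zvec n).
have gE y : E_fib_cls a (g y) = E_marking a (pi2 y).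
  by rewrite E_marking_pi2; apply/esym/E_fib_eq; exists n; rewrite hol_Phi.
have g0 : g (cmap c p) = cmap d (E_marking a p) by rewrite En hol_Phi.
have sk : smooth_on setT (fun x : A2 => x *m 1%:M + zvec n) by exact: affine_smooth.
have sg : smooth_on setT g.
  move=> k; apply: (@Ck_on_Phi _ _ k setT (cst a : A2 -> R^o)); first exact: openT.
    exact: Ck_on_cst.
  by apply: Ck_onD; [exact: openT|exact: Ck_on_id|exact: Ck_on_cst].
have cg : continuous g by exact: continuous_smooth.
have := @cover_chart_near _ _ _ _ (E_fib_cls a) g d (cmap c p) ad.
rewrite gE (cover_inv ac cp) g0 => /(_ dp erefl (cg _)) H.
have Hg : \forall y \near cmap c p, g y = cmap d (E_marking a (pi2 y)).
  by apply: filterS H => y [_]; rewrite gE.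
rewrite (_ : jacobian _ _ = jacobian g (cmap c p)).
  rewrite det_jacobian_Phi; last first.
    apply: smooth_near_eq (smooth_on_near _ sk).
    by apply: near_everywhere => y; rewrite mulmx1.
  rewrite (@jacobian_affine _ _ 1%:M (zvec n)) ?det1 ?ltr01//.
  by apply: near_everywhere => y; rewrite mulmx1.
have sgn := smooth_on_near (cmap c p) sg.
rewrite !jacobian_smooth //; last exact: smooth_near_eq sgn.
by apply/matrixP => i j; rewrite !mxE; rewrite (near_eq_derive _ Hg).
Qed.

Lemma fibre_complete_marked (a : R) : complete_marked (E_marked a).
Proof.
split; [exact: fibre_affine_surface|exact: fibre_mdiffeo|
        exact: fibre_orientation|].
by exists (Phi a), (hol a); exact: fibre_complete_dev.
Qed.

Lemma E_trivialization : trivialization line_atlas (E_family R) setT E_marking.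
Proof.
split=> [b t _| |b _]; last exact: fibre_complete_marked.
  apply: smooth_at_sub (@prod_cover _ _ _ _ _ _ _) (@subset_refl _ _) _.
  pose f (z : R * @T2 R) : @E_tot R := sval (E_marking z.1 z.2).
  suff : smooth_at (cover_atlas (fun z : L1 * A2 => (z.1 0 0, pi2 z.2)))
    (cover_atlas E_cov) f (b, t) by [].
  have fE c x : f (c, pi2 x) = E_cls c (Phi c x).
    by rewrite -[LHS]/(sval (E_marking c (pi2 x))) E_marking_pi2.
  apply: smooth_at_cover => x0 x1 [<- <-]; rewrite fE => /esym E.
  have {E} /E_cov_eq[/= E1 [n E2]] :
    E_cov (x0.1, Phi (x0.1 0 0) x0.2) = E_cov x1 by exact: E.
  exists (fun z : L1 * A2 => (z.1, Phi (z.1 0 0) (z.2 + zvec n))); split.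
  - by rewrite [RHS]surjective_pairing E1 E2 hol_Phi.
  - apply: smooth_on_near => k; apply: Ck_on_pair; first exact: openT.
      exact: smooth_fst.
    apply: Ck_on_Phi; first exact: openT.
      by apply: smooth_param; exact: smooth_fst.
    by apply: Ck_onD; [exact: openT|exact: smooth_snd|exact: Ck_on_cst].
  - apply: near_everywhere => z; rewrite fE.
    rewrite -[LHS]/(E_cov (z.1, Phi (z.1 0 0) z.2)); apply/E_cov_eq; split=> //.
    by exists n; rewrite hol_Phi.
pose theta (e : tot (E_family R)) : T2 := pi2 (Phi_inv (orbit_repr e).1 (orbit_repr e).2).
have thetaE z : theta (E_cov z) = pi2 (Phi_inv (z.1 0 0) z.2).
  rewrite /theta; have /E_cls_eq[-> [n ->]] : E_cls (z.1 0 0) z.2 =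
      E_cls (orbit_repr (E_cov z)).1 (orbit_repr (E_cov z)).2.
    by rewrite {2}/E_cls -surjective_pairing; apply/esym; exact: orbit_cls_repr.
  by rewrite Phi_inv_hol pi2_transl.
exists theta; split=> [e _|b t _]; last first.
  rewrite -[t in LHS]pi2_repr E_marking_pi2 /=.
  have -> : E_cls b (Phi b (orbit_repr t)) =
      E_cov (const_mx b, Phi b (orbit_repr t)) by rewrite /E_cov /= mxE.
  by rewrite thetaE /= mxE PhiK pi2_repr.
split.
  apply: smooth_at_cover => x0 x1 <-; rewrite -[X in theta X]/(E_cov x0) thetaE.
  move=> /esym /pi2_eq[n ->].
  exists (fun z : L1 * A2 => Phi_inv (z.1 0 0) z.2 + zvec n); split=> //.
    by apply: smooth_on_near; exact: smooth_Phi_inv_pair.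
  apply: near_everywhere => z; rewrite -[X in theta X]/(E_cov z) thetaE.
  by rewrite pi2_transl.
have [z <-] := st_surj straightened_E e.
rewrite thetaE E_marking_pi2 /= E_projE Phi_invK //.
Qed.

Lemma E_differentiable : differentiable_family line_atlas (E_family R).
Proof.
split.
- exact: st_manifold straightened_line.
- exact: st_manifold straightened_E.
- move=> e; apply: smooth_at_cover => x0 x1 <- E.
  exists (fun z : L1 * A2 => z.1); split.
  + by apply: L1_inj; rewrite E /= E_projE.
  + by apply: smooth_on_near; exact: smooth_fst.
  + by apply: near_everywhere => z; rewrite /= E_projE.
- exact: fibre_affine_surface.
- move=> b0; exists setT, E_marking, Phi; split=> //.
  + by move=> c p _ _ _; apply: near_everywhere.
  + exact: E_trivialization.
  + by move=> b x _; exact: smooth_map_Phi.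
  + by move=> b _; exists (hol b); exact: fibre_complete_dev.
Qed.

End FamilyStructure.

(** * Surfaces covered like a fibre *)

Section FibreCover.
Context {R : realType}.
Local Notation A2 := 'rV[R]_2.

Lemma near_comp (V W : normedModType R) (f : V -> W) x (P : W -> Prop) :
  {for x, continuous f} -> (\forall w \near f x, P w) ->
  \forall y \near x, P (f y).
Proof. by move=> cf; exact: cf. Qed.

(** An affine diffeomorphism from the fibre over [a] onto a surface, seen from the
    plane: a map [Q] which is affine in the charts and identifies exactly the
    orbits of the deck group of the fibre.  Tensor fields of the surface have
    global components on the plane, where all computations take place. *)
Record fibre_cover (a : R) (M : Type) (at_ : set (chart M A2)) (Q : A2 -> M)
    : Prop := FibreCover {
  fc_ok : forall c, at_ c -> chart_ok c;
  fc_chart : forall p, exists2 c, at_ c & dom c p;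
  fc_surj : forall p, exists v, Q v = p;
  fc_eq : forall v w, Q v = Q w <-> exists n, w = hol a n v;
  fc_aff : forall c v, at_ c -> dom c (Q v) ->
    exists (B : 'M[R]_2) (b : A2), B \in unitmx /\
      \forall w \near v, dom c (Q w) /\ cmap c (Q w) = w *m B + b }.

Context {a : R} {M : Type} {at_ : set (chart M A2)} {Q : A2 -> M}.
Hypothesis FC : fibre_cover a at_ Q.

(** The linear part of [Q] read in the chart [c], acting on row vectors; it is
    locally constant in [v]. *)
Definition lin (c : chart M A2) (v : A2) : 'M[R]_2 :=
  jacobian (fun w => cmap c (Q w)) v.

Lemma linP c v : at_ c -> dom c (Q v) -> lin c v \in unitmx /\
  \forall w \near v, [/\ dom c (Q w),
     cmap c (Q w) = (w - v) *m lin c v + cmap c (Q v) & lin c w = lin c v].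
Proof.
move=> ac cv; have [B [b [uB H]]] := fc_aff FC ac cv.
have nE w : (\forall y \near w, dom c (Q y) /\ cmap c (Q y) = y *m B + b) ->
    lin c w = B.
  by move=> Hw; apply: (@jacobian_affine _ _ B b); apply: filterS Hw => y [].
rewrite (nE v H); split=> //; have [_ E] := nbhs_singleton H.
apply: filterS2 H (nbhs_interior H) => w [dw Ew] /nE Hw.
by split=> //; rewrite Ew E mulmxBl addrA subrK.
Qed.

(** The affine section of [Q] through [v], in the coordinates of the chart [c]. *)
Definition lift_chart (c : chart M A2) (v y : A2) : A2 :=
  v + (y - cmap c (Q v)) *m invmx (lin c v).

Lemma lift_chart_cvg c v :
  lift_chart c v y @[y --> cmap c (Q v)] --> v.
Proof.
pose y0 := cmap c (Q v); pose B := invmx (lin c v).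
have E : lift_chart c v = fun y => y *m B + (v - y0 *m B).
  by apply/funext => y; rewrite /lift_chart mulmxBl addrCA.
have := continuous_smooth (affine_smooth B (v - y0 *m B)) (x := y0).
by rewrite -E /continuous_at {2}/lift_chart subrr mul0mx addr0.
Qed.

Lemma lift_chart_near c v (P : A2 -> Prop) : (\forall w \near v, P w) ->
  \forall y \near cmap c (Q v), P (lift_chart c v y).
Proof. by move=> H; exact: (@lift_chart_cvg c v _ H). Qed.

Lemma lift_chartP c v : at_ c -> dom c (Q v) ->
  \forall y \near cmap c (Q v), [/\ cinv c y = Q (lift_chart c v y),
    dom c (Q (lift_chart c v y)), lin c (lift_chart c v y) = lin c v
    & cmap c (Q (lift_chart c v y)) = y].
Proof.
move=> ac cv; have [uL H] := linP ac cv.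
apply: filterS (lift_chart_near c H) => y /= [dy Ey ->].
have Ey' : cmap c (Q (lift_chart c v y)) = y.
  by rewrite Ey /lift_chart addrAC subrr add0r mulmxKV// subrK.
by split=> //; rewrite -{1}Ey'; have [_ ->] := fc_ok FC ac.
Qed.

Lemma cmap_continuous c v : at_ c -> dom c (Q v) ->
  {for v, continuous (fun w => cmap c (Q w))}.
Proof.
move=> ac cv; have [_ H] := linP ac cv.
pose g w := w *m lin c v + (cmap c (Q v) - v *m lin c v).
have cg : continuous g by apply: continuous_smooth; exact: affine_smooth.
apply: near_eq_continuous (cg v).
by apply: filterS H => w [_ -> _]; rewrite /g mulmxBl addrA addrAC.
Qed.

Lemma parallel_pull {W : Type} (F : chart M A2 -> M -> W) c v :
  parallel at_ F -> at_ c -> dom c (Q v) ->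
  \forall w \near v, F c (Q w) = F c (Q v).
Proof.
move=> pF ac cv; have [_ H] := linP ac cv.
have := near_comp (cmap_continuous ac cv) (pF c _ ac cv).
apply: filterS2 H => w [dw _ _] /= <-.
by have [_ ->] := fc_ok FC ac.
Qed.

Lemma transitionP c d v : at_ c -> at_ d -> dom c (Q v) -> dom d (Q v) ->
  \forall y \near cmap c (Q v), cmap d (cinv c y) =
    y *m (invmx (lin c v) *m lin d v) +
    (cmap d (Q v) - cmap c (Q v) *m (invmx (lin c v) *m lin d v)).
Proof.
move=> ac ad cv dv; have [_ H] := linP ad dv.
have := lift_chart_near c H.
apply: filterS2 (lift_chartP ac cv) => y [-> _ _ _] /= [_ -> _].
rewrite /lift_chart addrAC subrr add0r mulmxBl mulmxBl -!mulmxA.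
by rewrite -addrA [- _ + _]addrC.
Qed.

Lemma jacobian_transition c d v : at_ c -> at_ d -> dom c (Q v) ->
  dom d (Q v) ->
  jacobian (fun y => cmap d (cinv c y)) (cmap c (Q v)) =
  invmx (lin c v) *m lin d v.
Proof. by move=> ac ad cv dv; exact: jacobian_affine (transitionP ac ad cv dv). Qed.

Lemma derive_affine (B : 'M[R]_2) (b u x : A2) :
  is_derive x u (fun y : A2 => y *m B + b) (u *m B).
Proof.
have s := smooth_on_near x (affine_smooth B b).
have d : derivable (fun y : A2 => y *m B + b) x u by exact: smooth_near_derivable s.
split=> //; rewrite (deriveEjacobian _ (smooth_differentiable s)).
by congr (u *m _); apply: jacobian_affine; exact: near_everywhere.
Qed.

Lemma derive_transition c d v u : at_ c -> at_ d -> dom c (Q v) ->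
  dom d (Q v) ->
  'D_u (fun y => cmap d (cinv c y)) (cmap c (Q v)) =
  u *m (invmx (lin c v) *m lin d v).
Proof.
move=> ac ad cv dv; rewrite (near_eq_derive _ (transitionP ac ad cv dv)).
by have [] := derive_affine (invmx (lin c v) *m lin d v)
  (cmap d (Q v) - cmap c (Q v) *m (invmx (lin c v) *m lin d v)) u (cmap c (Q v)).
Qed.

Lemma Q_hol n v : Q (hol a n v) = Q v.
Proof. by apply/esym/(fc_eq FC); exists n. Qed.

Lemma hol_lin_unit n : hol_lin a n \in unitmx.
Proof. by rewrite unitmxE det_hol_lin unitr1. Qed.

(** This rule makes a field on the surface out of a field on the plane that is
    equivariant under the deck group, and conversely. *)
Lemma lin_hol c n v : at_ c -> dom c (Q v) ->
  lin c v = hol_lin a n *m lin c (hol a n v).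
Proof.
move=> ac cv; have cv' : dom c (Q (hol a n v)) by rewrite Q_hol.
have [_ H] := linP ac cv'.
pose B := lin c (hol a n v).
pose b := row2 (n 0 0)%:~R ((n 0 1)%:~R + 2^-1 * a * (n 0 0)%:~R ^+ 2) : A2.
apply: (@jacobian_affine _ _ _ (b *m B - hol a n v *m B + cmap c (Q v))).
have ch : {for v, continuous (hol a n)}.
  exact: smooth_near_continuous (smooth_on_near v (@smooth_hol _ a n)).
apply: filterS (near_comp ch H) => w /= [_ + _]; rewrite Q_hol => ->.
by rewrite Q_hol (hol_affine a n w) -/b -/B mulmxBl mulmxDl -mulmxA !addrA.
Qed.

Lemma derive_precomp_affine (X : A2 -> A2) (B : 'M[R]_2) (v y0 u : A2) :
  'D_u (fun y => X (v + (y - y0) *m B)) y0 = 'D_(u *m B) X v.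
Proof.
rewrite /derive; set p := fun h => _; set p' := fun h => _.
suff -> : p = p' by [].
apply/funext => h; rewrite /p /p' /= addrK subrr mul0mx addr0.
by rewrite -scalemxAl [v + _]addrC.
Qed.

Lemma mulmx_linear (B : 'M[R]_2) : linear (fun v : A2 => v *m B).
Proof. by move=> t u v; rewrite mulmxDl scalemxAl. Qed.

Lemma mulmx_continuous (B : 'M[R]_2) : continuous (fun v : A2 => v *m B).
Proof.
apply: continuous_smooth => k.
by apply: Ck_on_mulmx; [exact: openT|exact: Ck_on_id].
Qed.

(** [Q] is affine in the charts, hence preserves the flat connection. *)
Lemma nabla_pull (xi : vfield M) (X : A2 -> A2) c v :
  at_ c -> dom c (Q v) -> smooth_near X v ->
  (\forall w \near v, xi c (Q w) = X w *m lin c w) ->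
  nabla_self xi c (Q v) = 'D_(X v) X v *m lin c v.
Proof.
move=> ac cv sX xiX; have [uL _] := linP ac cv.
have xv := nbhs_singleton xiX.
pose L := lin c v; pose Y y := X (v + (y - cmap c (Q v)) *m invmx L).
have E : \forall y \near cmap c (Q v), xi c (cinv c y) = Y y *m L.
  have := lift_chart_near c xiX.
  by apply: filterS2 (lift_chartP ac cv) => y [-> _ E _] /= ->; rewrite E.
rewrite /nabla_self (near_eq_derive _ E) xv.
have dY : derivable Y (cmap c (Q v)) (X v *m L).
  have dX : derivable X v (X v) by exact: smooth_near_derivable sX.
  have EY : Y = fun y => X (v + (y - cmap c (Q v)) *m invmx L) by [].
  rewrite /derivable; move: dX; rewrite /derivable.
  set p := fun h => _; set p' := fun h => _.
  suff -> : p = p' by [].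
  apply/funext => h; rewrite /p /p' /= /Y addrK subrr mul0mx addr0.
  by rewrite -scalemxAl mulmxK// [v + _]addrC.
have [_ ->] := is_derive_lincomp (@mulmx_linear L) (@mulmx_continuous L) dY.
by rewrite derive_precomp_affine mulmxK.
Qed.

Lemma det2_mul (u w : A2) (B : 'M[R]_2) :
  det2 (u *m B) (w *m B) = det2 u w * \det B.
Proof.
by rewrite /det2 !mul_rV2 det_mx22; ring.
Qed.

End FibreCover.

#[global] Opaque lin.

(** * Polynomials and cube roots *)

Section Polynomials.
Context {R : realType}.
Local Notation A2 := 'rV[R]_2.

Lemma Ck_on_poly (V : normedModType R) k (D : set V) (p : {poly R}) (f : V -> R^o) :
  open D -> Ck_on k D f -> Ck_on k D (fun w => p.[f w] : R^o).
Proof.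
move=> oD Cf; elim/poly_ind: p => [|p c IH].
  by apply: (@Ck_on_eq _ _ _ _ _ (fun=> 0)) => // [w _|];
    [rewrite horner0|exact: Ck_on_cst].
apply: (@Ck_on_eq _ _ _ _ _ (fun w => p.[f w] * f w + c : R^o)) => //.
  by move=> w _; rewrite hornerMXaddC.
by apply: Ck_onD; [|exact: Ck_onM|exact: Ck_on_cst].
Qed.

Lemma Ck_on_bipoly (V : normedModType R) k (D : set V) (p : {poly {poly R}})
    (f g : V -> R^o) : open D -> Ck_on k D f -> Ck_on k D g ->
  Ck_on k D (fun w => p.[(g w)%:P].[f w] : R^o).
Proof.
move=> oD Cf Cg; elim/poly_ind: p => [|p c IH].
  by apply: (@Ck_on_eq _ _ _ _ _ (fun=> 0)) => // [w _|];
    [rewrite !horner0|exact: Ck_on_cst].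
apply: (@Ck_on_eq _ _ _ _ _
    (fun w => p.[(g w)%:P].[f w] * g w + c.[f w] : R^o)) => //.
  by move=> w _; rewrite hornerMXaddC hornerD hornerM hornerC.
by apply: Ck_onD => //; [exact: Ck_onM|exact: Ck_on_poly].
Qed.

Lemma bipoly_line (p : {poly {poly R}}) (f g : {poly R}) :
  exists r : {poly R}, forall t, r.[t] = p.[(g.[t])%:P].[f.[t]].
Proof.
elim/poly_ind: p => [|p c [r IH]].
  by exists 0 => t; rewrite !horner0.
exists (r * g + (c \Po f)) => t.
by rewrite hornerMXaddC !hornerD !hornerM hornerC horner_comp IH.
Qed.

Lemma poly_zero_of_infinite (p : {poly R}) (x : nat -> R) :
  injective x -> (forall n, p.[x n] = 0) -> p = 0.
Proof.
move=> ix px; apply: (@roots_geq_poly_eq0 _ p [seq x n | n <- iota 0 (size p)]).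
- by apply/allP => _ /mapP[n _ ->]; rewrite rootE px.
- by rewrite map_inj_uniq ?iota_uniq.
- by rewrite size_map size_iota.
Qed.

Lemma poly_zero_near (p : {poly R}) (s : R) :
  (\forall x \near s, p.[x] = 0) -> p = 0.
Proof.
move=> /nbhs_ballP[e /= e0 H].
have p0 n : (0 : R) < n.+2%:R by rewrite ltr0n.
apply: (@poly_zero_of_infinite p (fun n => s + e / n.+2%:R)).
  move=> m n /addrI /(mulfI (lt0r_neq0 e0)) /invr_inj /eqP.
  by rewrite eqr_nat => /eqP[].
move=> n; apply: H; rewrite -ball_normE /= opprD addrA subrr sub0r normrN.
rewrite gtr0_norm ?divr_gt0// ltr_pdivrMr// ltr_pMr//.
by rewrite ltr1n.
Qed.

(** Polynomials that agree near a point are equal, so the local ones are all the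
    same by connectedness. *)
Lemma locally_polynomial (g : R -> R) :
  (forall t : R, exists P : {poly R}, \forall s \near t, g s = P.[s]) ->
  exists P : {poly R}, forall t, g t = P.[t].
Proof.
move=> locg; have [P P0] := locg 0; exists P.
pose S (t : R) := \forall s \near t, g s = P.[s].
suff H : forall t, S t by move=> t; exact: nbhs_singleton (H t).
move=> t; apply: (@R_clopen R S _ 0 t) => // u.
have [Q Qu] := locg u.
have [Su|nSu] := pselect (S u).
  by apply: filterS (nbhs_interior Su) => s Ss; split=> _.
apply: filterS (nbhs_interior Qu) => s Qs; split=> // Ss; exfalso; apply: nSu.
have PQ : P - Q = 0.
  apply: (@poly_zero_near _ s); apply: filterS2 Ss Qs => y Py Qy.
  by rewrite hornerD hornerN -Py -Qy subrr.
by apply: filterS Qu => y ->; rewrite -[P](subrK Q) PQ add0r.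
Qed.

(** A polynomial that takes the same value at all natural numbers is constant. *)
Lemma locally_polynomial_periodic (g : R -> R) :
  (forall t : R, exists P : {poly R}, \forall s \near t, g s = P.[s]) ->
  (forall t, g (t + 1) = g t) -> forall t, g t = g 0.
Proof.
move=> /locally_polynomial[P gP] per.
have gn n : g n%:R = g 0.
  by elim: n => [|n IH] //; rewrite -addn1 natrD per.
suff : P - (g 0)%:P = 0.
  by move=> P0 t; rewrite gP -[P](subrK (g 0)%:P) P0 add0r hornerC.
apply: (@poly_zero_of_infinite _ (fun n => n%:R)).
  by move=> m n /eqP; rewrite eqr_nat => /eqP.
by move=> n; rewrite hornerD hornerN hornerC -gP gn subrr.
Qed.

Lemma cbrtK (a : R) : cbrt a ^+ 3 = a.
Proof.
rewrite /cbrt exprMn -[X in _ * X]powR_mulrn ?powR_ge0// -powRrM mulVf ?pnatr_eq0//.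
rewrite powRr1//; have -> : Num.sg a ^+ 3 = Num.sg a.
  by rewrite exprS sqr_sg; case: (eqVneq a 0) => [->|_]; rewrite ?sgr0 ?mul0r ?mulr1.
by rewrite -numEsg.
Qed.

Lemma cube_inj (x y : R) : x ^+ 3 = y ^+ 3 -> x = y.
Proof.
move=> E; apply/eqP; rewrite -subr_eq0; apply/eqP.
have : (x - y) * (x ^+ 2 + x * y + y ^+ 2) = 0.
  by rewrite (_ : _ * _ = x ^+ 3 - y ^+ 3); [rewrite E subrr|ring].
move=> /eqP; rewrite mulf_eq0 => /orP[/eqP //|/eqP h].
have y0 : y ^+ 2 <= 0 by have := sqr_ge0 (2 * x + y); lra.
have x0 : x ^+ 2 <= 0 by have := sqr_ge0 (2 * y + x); lra.
have z0 (u : R) : u ^+ 2 <= 0 -> u = 0.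
  by move=> u0; apply/eqP; rewrite -sqrf_eq0 eq_le u0 sqr_ge0.
by rewrite (z0 x x0) (z0 y y0) subrr.
Qed.

Lemma cbrt_unique (a z : R) : z ^+ 3 = a -> z = cbrt a.
Proof. by move=> za; apply: cube_inj; rewrite cbrtK. Qed.

Lemma cbrt_eq0 (a : R) : (cbrt a == 0) = (a == 0).
Proof.
apply/eqP/eqP => [h|->]; first by rewrite -(cbrtK a) h expr0n.
by apply/esym/cbrt_unique; rewrite expr0n.
Qed.

End Polynomials.

(** * The cubic equation of the normalized field *)

Section PullBack.
Context {R : realType}.
Local Notation A2 := 'rV[R]_2.
Context {a : R} {M : Type} {at_ : set (chart M A2)} {Q : A2 -> M}.
Hypothesis FC : fibre_cover a at_ Q.
Local Notation lin := (@lin R M Q).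

(** The value does not depend on the chart and is locally constant in a given
    chart: connectedness of the plane makes it constant. *)
Lemma chart_constant {T : Type} (F : chart M A2 -> A2 -> T) :
  (forall c d v, at_ c -> at_ d -> dom c (Q v) -> dom d (Q v) -> F c v = F d v) ->
  (forall c v, at_ c -> dom c (Q v) -> \forall w \near v, F c w = F c v) ->
  exists s, forall c v, at_ c -> dom c (Q v) -> F c v = s.
Proof.
move=> Fcd Fc; pose ch v := sval (cid2 (fc_chart FC (Q v))).
have ach v : at_ (ch v) by rewrite /ch; case: cid2.
have dch v : dom (ch v) (Q v) by rewrite /ch; case: cid2.
exists (F (ch 0) 0) => c v ac cv.
rewrite (Fcd _ (ch v) v ac (ach v) cv (dch v)).
apply: (@locally_constant _ _ _ (fun v => F (ch v) v)) => w.
have [_ H] := linP FC (ach w) (dch w).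
apply: filterS2 H (Fc _ _ (ach w) (dch w)) => x [dx _ _] <-.
exact: Fcd.
Qed.

Lemma aform_constant (om : aform M) : is_aform at_ om -> parallel at_ om ->
  exists s, forall c v, at_ c -> dom c (Q v) ->
    om c (Q v) * \det (lin c v) = s.
Proof.
move=> ao po; apply: (chart_constant (F := fun c v => om c (Q v) * \det (lin c v))).
  move=> c d v ac ad cv dv; have [uc _] := linP FC ac cv.
  rewrite (ao c d _ ac ad cv dv) (jacobian_transition FC ac ad cv dv).
  rewrite det_mulmx det_inv -mulrA; congr (_ * _).
  by rewrite mulrAC mulVr ?mul1r// -unitmxE.
move=> c v ac cv; have [_ H] := linP FC ac cv.
by apply: filterS2 H (parallel_pull FC po ac cv) => w [_ _ ->] ->.
Qed.

Lemma vfield_chart (ze : vfield M) c d v : is_vfield at_ ze ->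
  at_ c -> at_ d -> dom c (Q v) -> dom d (Q v) ->
  ze c (Q v) *m invmx (lin c v) = ze d (Q v) *m invmx (lin d v).
Proof.
move=> vz ac ad cv dv; have [ud _] := linP FC ad dv.
rewrite (vz c d _ ac ad cv dv) (derive_transition FC _ ac ad cv dv).
by rewrite mulmxA mulmxK.
Qed.

Lemma vfield_hol (ze : vfield M) c n v : at_ c -> dom c (Q v) ->
  ze c (Q v) *m invmx (lin c v) *m hol_lin a n =
  ze c (Q (hol a n v)) *m invmx (lin c (hol a n v)).
Proof.
move=> ac cv; have cv' : dom c (Q (hol a n v)) by rewrite (Q_hol FC).
have [u' _] := linP FC ac cv'; have [u _] := linP FC ac cv; rewrite (Q_hol FC).
have E : ze c (Q v) *m invmx (lin c v) *m hol_lin a n *m lin c (hol a n v) =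
    ze c (Q v).
  by rewrite -mulmxA -(lin_hol FC n ac cv) mulmxKV.
exact: (canRL (mulmxK u') E).
Qed.

Section VectorFields.
Variables (om : @aform R M) (ze xi : @vfield R M) (s : R).
Hypothesis (a0 : a != 0).
Hypothesis omE : forall c v, at_ c -> dom c (Q v) -> om c (Q v) * \det (lin c v) = s.
Hypothesis (vz : is_vfield at_ ze) (pz : parallel at_ ze).
Hypothesis px : polynomial_vfield at_ xi.
Hypothesis zexi : forall c p, at_ c -> dom c p ->
  ze c p = nabla_self xi c p /\ om c p * det2 (ze c p) (xi c p) = 1.

Lemma vfield_constant : exists Z : A2, forall c v, at_ c -> dom c (Q v) ->
  ze c (Q v) = Z *m lin c v.
Proof.
have [|c v ac cv|Z ZE] := chart_constant (F := fun c v => ze c (Q v) *m invmx (lin c v)).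
- by move=> c d v ac ad cv dv; exact: vfield_chart.
- have [_ H] := linP FC ac cv.
  by apply: filterS2 H (parallel_pull FC pz ac cv) => w [_ _ ->] ->.
exists Z => c v ac cv; have [u _] := linP FC ac cv.
by rewrite -(ZE c v ac cv) mulmxKV.
Qed.

Lemma vfield_pull : exists X : A2 -> A2,
  (forall c v, at_ c -> dom c (Q v) -> xi c (Q v) = X v *m lin c v) /\
  (forall n v, X (hol a n v) = X v *m hol_lin a n).
Proof.
pose ch v := sval (cid2 (fc_chart FC (Q v))).
have ach v : at_ (ch v) by rewrite /ch; case: cid2.
have dch v : dom (ch v) (Q v) by rewrite /ch; case: cid2.
pose X v := xi (ch v) (Q v) *m invmx (lin (ch v) v).
have XE c v : at_ c -> dom c (Q v) -> xi c (Q v) *m invmx (lin c v) = X v.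
  by move=> ac cv; apply: vfield_chart => //; have [] := px.
exists X; split=> [c v ac cv|n v].
  by rewrite -(XE c v)//; have [u _] := linP FC ac cv; rewrite mulmxKV.
rewrite -(XE (ch v)) ?(Q_hol FC)// -[xi _ (Q v)](congr1 (xi (ch v)) (Q_hol FC n v)).
by rewrite -(@vfield_hol xi (ch v) n v).
Qed.

Variable X : A2 -> A2.
Hypothesis XE : forall c v, at_ c -> dom c (Q v) -> xi c (Q v) = X v *m lin c v.
Hypothesis Xhol : forall n v, X (hol a n v) = X v *m hol_lin a n.

(** In the coordinates [w *m B + b] of one chart the field is polynomial, and [B']
    brings its components back to the plane. *)
Lemma pull_polynomial (v : A2) : exists (p q : {poly {poly R}}) (B B' : 'M[R]_2) (b : A2),
  \forall w \near v, X w = row2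
    p.[((w *m B + b) 0 1)%:P].[(w *m B + b) 0 0]
    q.[((w *m B + b) 0 1)%:P].[(w *m B + b) 0 0] *m B'.
Proof.
have [c ac cv] := fc_chart FC (Q v); have [u H] := linP FC ac cv.
have [_ /(_ c (Q v) ac cv)[p [q pq]]] := px.
exists p, q, (lin c v), (invmx (lin c v)), (cmap c (Q v) - v *m lin c v).
have H2 := near_comp (cmap_continuous FC ac cv) pq.
apply: filterS2 H H2 => w [dw Ew Lw] Pw.
have cK : cinv c (cmap c (Q w)) = Q w by have [_ cK] := fc_ok FC ac; exact: cK.
rewrite cK in Pw.
have E : w *m lin c v + (cmap c (Q v) - v *m lin c v) = cmap c (Q w).
  by rewrite Ew mulmxBl addrA addrAC.
rewrite E -Pw (XE ac dw) Lw.
exact: (esym (mulmxK u _)).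
Qed.

Lemma pull_smooth (v : A2) : smooth_near X v.
Proof.
have [p [q [B [B' [b H]]]]] := pull_polynomial v.
have sB := affine_smooth B b.
pose Y (w : A2) := row2
    p.[((w *m B + b) 0 1)%:P].[(w *m B + b) 0 0]
    q.[((w *m B + b) 0 1)%:P].[(w *m B + b) 0 0] *m B'.
have sY : smooth_on setT Y.
  move=> k; apply: Ck_on_mulmx; first exact: openT.
  apply: Ck_on_row2; first exact: openT.
    by apply: Ck_on_bipoly; first exact: openT;
      apply: Ck_on_coord; [exact: openT|exact: sB|exact: openT|exact: sB].
  by apply: Ck_on_bipoly; first exact: openT;
    apply: Ck_on_coord; [exact: openT|exact: sB|exact: openT|exact: sB].
apply: smooth_near_eq (smooth_on_near v sY).
by apply: filterS H => w ->.
Qed.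

Lemma pull_vertical_polynomial (u t : R) :
  exists P : {poly R}, \forall s' \near t, X (row2 u s') 0 1 = P.[s'].
Proof.
have [p [q [B [B' [b H]]]]] := pull_polynomial (row2 u t).
pose f i : {poly R} := (B 1 i) *: 'X + (u * B 0 i + b 0 i)%:P.
have fE i s' : (row2 u s' *m B + b) 0 i = (f i).[s'].
  by rewrite /f !hornerE /= mxE mul_rV2 row2_0 row2_1; ring.
have [rp rpE] := bipoly_line p (f 0) (f 1).
have [rq rqE] := bipoly_line q (f 0) (f 1).
exists (B' 0 1 *: rp + B' 1 1 *: rq).
have cr : {for t, continuous (fun s' : R => row2 u s')}.
  by apply: (@continuous_row2 _ _ (cst u) id); [exact: cst_continuous|exact: cvg_id].
apply: filterS (near_comp cr H) => s' ->.
by rewrite !fE -rpE -rqE mul_rV2 row2_0 row2_1 !hornerE /=; ring.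
Qed.

(** The argument described at the beginning: [x0] is the first component of [X] and
    [h] the second one, as a function of the first coordinate. *)
Lemma field_cube (Z : A2) :
  (forall c v, at_ c -> dom c (Q v) -> ze c (Q v) = Z *m lin c v) ->
  Z 0 0 = 0 /\ s ^+ 2 * Z 0 1 ^+ 3 = a.
Proof.
move=> ZE.
have pull_Z c v : at_ c -> dom c (Q v) -> ze c (Q v) *m invmx (lin c v) = Z.
  by move=> ac cv; have [u _] := linP FC ac cv; rewrite (ZE _ _ ac cv) mulmxK.
(* A constant field that descends is invariant under the linear holonomy. *)
have Zinv : Z *m hol_lin a (delta_mx 0 0) = Z.
  have [c ac cv] := fc_chart FC (Q 0).
  have cv' : dom c (Q (hol a (delta_mx 0 0) 0)) by rewrite (Q_hol FC).
  rewrite -[X in X *m _](pull_Z c 0 ac cv) -[RHS](pull_Z c _ ac cv').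
  exact: vfield_hol.
have Z00 : Z 0 0 = 0.
  move: Zinv; rewrite mul_hol_lin => /(congr1 (fun v : A2 => v 0 1)).
  rewrite row2_1 mxE /= mulr1 -[RHS]addr0 => /addrI /eqP.
  by rewrite mulf_eq0 (negbTE a0) => /eqP.
split=> //; set z := Z 0 1.
(* The condition omega(zeta, xi) = 1, read on the plane. *)
have eq1 v : s * - (z * X v 0 0) = 1.
  have [c ac cv] := fc_chart FC (Q v); have [_] := zexi ac cv.
  rewrite (ZE _ _ ac cv) (XE ac cv) det2_mul /det2 Z00 mul0r sub0r => <-.
  by rewrite mulrCA (omE ac cv) mulrC.
have s0 : s != 0 by apply: contra_eq_neq (eq1 0) => ->; rewrite mul0r eq_sym oner_eq0.
have z0 : z != 0.
  by apply: contra_eq_neq (eq1 0) => ->; rewrite mul0r oppr0 mulr0 eq_sym oner_eq0.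
pose x0 := - (s * z)^-1.
have x00 : x0 != 0 by rewrite oppr_eq0 invr_eq0 mulf_neq0.
have X0 v : X v 0 0 = x0.
  apply: (mulfI (mulf_neq0 s0 z0)); rewrite /x0 mulrN mulfV ?mulf_neq0//.
  by rewrite -(eq1 v); ring.
(* The condition nabla_xi xi = zeta, read on the plane. *)
have DX v : 'D_(X v) X v = Z.
  have [c ac cv] := fc_chart FC (Q v); have [+ _] := zexi ac cv.
  have [u H] := linP FC ac cv.
  have HX : \forall w \near v, xi c (Q w) = X w *m lin c w.
    by apply: filterS H => w [dw _ _]; exact: XE.
  rewrite (ZE _ _ ac cv) (nabla_pull FC ac cv (pull_smooth v) HX).
  by move=> /(congr1 (mulmx^~ (invmx (lin c v)))) /=; rewrite !(mulmxK u).
pose h u := X (row2 u 0) 0 1.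
(* The second deck generator is the unit vertical translation, of trivial linear
   part, so that the second component is periodic on vertical lines. *)
have Xvert u t : X (row2 u t) 0 1 = h u.
  apply: (@locally_polynomial_periodic R (fun t => X (row2 u t) 0 1)) => t'.
    exact: pull_vertical_polynomial.
  have -> : row2 u (t' + 1) = hol a (delta_mx 0 1) (row2 u t').
    rewrite hol_affine mul_hol_lin; apply: row2P;
      rewrite !(row2_0, row2_1, mxE) /=; ring.
  rewrite Xhol mul_hol_lin row2_1 mxE /=.
  by rewrite !mulr0 mul0r addr0.
have XhE u t : X (row2 u t) = row2 x0 (h u).
  by apply: row2P; rewrite ?row2_0 ?row2_1 ?X0 ?Xvert.
(* Equivariance under the first deck generator. *)
have hstep u : h (u + 1) = h u + a * x0.
  have E : hol a (delta_mx 0 0) (row2 u 0) = row2 (u + 1) (a * u + 2^-1 * a).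
    rewrite hol_affine mul_hol_lin; apply: row2P;
      rewrite !(row2_0, row2_1, mxE) /=; ring.
  have := congr1 (fun v : A2 => v 0 1) (Xhol (delta_mx 0 0) (row2 u 0)).
  by rewrite /= E Xvert mul_hol_lin row2_1 X0 mxE /= mulr1 => ->.
(* As h does not see the vertical coordinate, the derivative of the second
   component along X is that of h at speed x0. *)
have dh t : is_derive t (1 : R) (fun t => h (t * x0)) z.
  pose v := row2 (t * x0) 0 : A2.
  have dX : derivable X v (X v) by exact: smooth_near_derivable (pull_smooth v).
  have dX1 : derivable (fun w => X w 0 1) v (X v).
    by have /derivable_mxP := dX; exact.
  have D1 : 'D_(X v) (fun w => X w 0 1 : R^o) v = z.
    by have := DX v; rewrite derive_mx // => /(congr1 (fun v : A2 => v 0 1)); rewrite mxE.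
  have E : (fun e : R => e^-1 *: (((fun w => X w 0 1) \o shift v) (e *: X v)
     - X v 0 1)) =
     (fun e : R => e^-1 *: (((fun t => h (t * x0)) \o shift t) (e *: 1)
     - h (t * x0))).
    apply/funext => e /=; rewrite {3}/v Xvert; congr (_ *: (_ - _)).
    have -> : e *: X v + v = row2 ((e *: 1 + t) * x0) (e * h (t * x0)).
      rewrite /v XhE; apply: row2P; rewrite !(row2_0, row2_1, mxE) ?addr0 //.
      by rewrite -[e *: 1]/(e * 1) mulr1 mulrDl.
    exact: Xvert.
  split; first by rewrite /derivable -E.
  by rewrite /derive -E.
have hlin t : h (t * x0) = h 0 + t * z.
  pose F t := h (t * x0) - t * z.
  have dF u : is_derive u (1 : R) F 0.
    rewrite -(subrr z); apply: is_deriveB.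
    have := @is_derive_lin R R^o R^o (fun t => t *: (z : R^o)) u 1.
    by rewrite scale1r; apply; [move=> b x y; rewrite scalerDl scalerA|
      exact: scalel_continuous].
  have := is_derive_0_is_cst t 0 dF; rewrite /F !mul0r subr0 => <-.
  by rewrite subrK.
have E : x0^-1 * z = a * x0.
  have h1 : h 1 = h 0 + x0^-1 * z by rewrite -hlin mulVf.
  by have := hstep 0; rewrite add0r h1; exact: addrI.
have az : z = a * x0 ^+ 2 by rewrite expr2 mulrA -E mulrAC mulVf// mul1r.
have sz : s * z * x0 = -1 by rewrite /x0 mulrN mulfV ?mulf_neq0.
have : (s * z) ^+ 2 * z = (s * z * x0) ^+ 2 * a by rewrite {2}az; ring.
by rewrite sz sqrrN expr1n mul1r => <-; ring.
Qed.

End VectorFields.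

End PullBack.

#[local] Opaque jacobian derive determinant.

(** * Integrals computed through a marking *)

Section PeriodComputation.
Context {R : realType}.
Local Notation A2 := 'rV[R]_2.
Local Notation mu := (@lebesgue_measure R).

Lemma xget_eq (T : choiceType) (x0 x : T) (P : set T) :
  P x -> (forall y, P y -> y = x) -> xget x0 P = x.
Proof. by move=> Px H; case: xgetP => [y _ /H //|/(_ x)]. Qed.

Lemma derive_affine_post (g : A2 -> A2) (B : 'M[R]_2) b x w :
  derivable g x w -> is_derive x w (fun y => g y *m B + b) ('D_w g x *m B).
Proof.
move=> dg; have := is_derive_lincomp (@mulmx_linear _ B) (@mulmx_continuous _ B) dg.
move=> H; rewrite -[X in is_derive _ _ _ X]addr0.
by apply: is_deriveD; apply: is_derive_cst.
Qed.

Lemma det_jacobian_post (g : A2 -> A2) (B : 'M[R]_2) b x : smooth_near g x ->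
  \det (jacobian (fun y => g y *m B + b) x) = \det (jacobian g x) * \det B.
Proof.
move=> sg; have [D [oD Dx Cg]] := sg.
have sg' : smooth_near (fun y => g y *m B + b) x.
  exists D; split=> // n; apply: Ck_onD => //; last exact: Ck_on_cst.
  exact: Ck_on_mulmx.
rewrite -det_mulmx; congr (\det _); apply/row_matrixP => i; rewrite !rowE mulmxA.
have E (f : A2 -> A2) : smooth_near f x ->
    delta_mx 0 i *m jacobian f x = 'D_(delta_mx 0 i) f x.
  by move=> sf; rewrite deriveEjacobian//; exact: smooth_differentiable.
have dg : derivable g x (delta_mx 0 i) by exact: smooth_near_derivable sg.
have [_ EB] := derive_affine_post B b dg.
apply: (etrans (E _ sg')); apply: (etrans EB).
by congr (_ *m B); exact: esym (E _ sg).
Qed.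

Context {a : R} {m : marked R} {Q : A2 -> msurf m}.
Hypothesis FC : fibre_cover a (@matlas R m) Q.
Local Notation at_ := (@matlas R m).
Local Notation lin := (@lin R (msurf m) Q).
Variables (k : A2 -> A2) (A : 'M[R]_2).
Hypothesis sk : smooth_on setT k.
Hypothesis kA : forall i x, k (x + delta_mx 0 i) = k x + row i A.
Hypothesis fE : forall x, mmap m (pi2 x) = Q (Phi a (k x)).

Let g x := Phi a (k x).

Lemma smooth_marking : smooth_on setT g.
Proof.
move=> n; apply: (@Ck_on_Phi _ _ n setT (cst a : A2 -> R^o)).
- exact: openT.
- exact: Ck_on_cst.
- exact: sk.
Qed.

Lemma marking_chart c x : at_ c -> dom c (Q (g x)) ->
  \forall y \near x, cmap c (mmap m (pi2 y)) =
    g y *m lin c (g x) + (cmap c (Q (g x)) - g x *m lin c (g x)).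
Proof.
move=> ac cx; have [_ H] := linP FC ac cx.
have cg : {for x, continuous g}.
  exact: smooth_near_continuous (smooth_on_near x smooth_marking).
apply: filterS (near_comp cg H) => y [_ E _].
by rewrite fE E mulmxBl addrA addrAC.
Qed.

Lemma jacobian_near (f f' : A2 -> A2) x : smooth_near f x ->
  (\forall y \near x, f' y = f y) -> jacobian f' x = jacobian f x.
Proof.
move=> sf E; have E' : \forall y \near x, f y = f' y by apply: filterS E => y ->.
rewrite (jacobian_smooth (smooth_near_eq E' sf)) (jacobian_smooth sf).
by apply/matrixP => i j; rewrite !mxE (near_eq_derive _ E).
Qed.

Section Forms.
Variables (om : @aform R (msurf m)) (s : R).
Hypothesis omE : forall c v, at_ c -> dom c (Q v) -> om c (Q v) * \det (lin c v) = s.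

(** The linear part of the chart cancels between the coefficient of the form and
    the Jacobian of the marking, and [Phi a] preserves areas. *)
Lemma pull_areaE x : pull_area om x = s * \det (jacobian k x).
Proof.
have val c : at_ c -> dom c (Q (g x)) ->
    om c (Q (g x)) * \det (jacobian (fun y => cmap c (mmap m (pi2 y))) x) =
    s * \det (jacobian k x).
  move=> ac cx; have sg := smooth_on_near x smooth_marking.
  have sg' : smooth_near (fun y => g y *m lin c (g x) +
      (cmap c (Q (g x)) - g x *m lin c (g x))) x.
    apply: smooth_on_near => n; apply: Ck_onD; [exact: openT| |exact: Ck_on_cst].
    by apply: Ck_on_mulmx; [exact: openT|exact: smooth_marking].
  have E1 : \det (jacobian (fun y => cmap c (mmap m (pi2 y))) x) =
      \det (jacobian k x) * \det (lin c (g x)).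
    have Eg : \det (jacobian g x) = \det (jacobian k x).
      exact: det_jacobian_Phi (smooth_on_near x sk).
    apply: (etrans (congr1 determinant (jacobian_near sg' (marking_chart ac cx)))).
    apply: (etrans (det_jacobian_post _ _ sg)).
    exact: (congr1 (fun t => t * \det (lin c (g x))) Eg).
  have fin (o J l j : R) : o * l = s -> J = j * l -> o * J = s * j.
    by move=> <- ->; rewrite mulrCA mulrC.
  exact: (fin _ _ _ _ (omE ac cx) E1).
apply: xget_eq => [|_ [c [ac + ->]]].
  have [c ac cx] := fc_chart FC (Q (g x)); exists c; rewrite fE.
    by split; [exact: ac|exact: cx|exact/esym/val].
by rewrite fE -/(g x) => cx; exact: val.
Qed.

Lemma area_intE : area_int om = s * \det A.
Proof.
(* The factor s is absorbed into the map, whose Jacobian is then integrated. *)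
pose B : 'M[R]_2 := diag_mx (row2 s 1).
have detB : \det B = s by rewrite det_diag big_ord_recl big_ord1 !mxE /= mulr1.
have skB : smooth_on setT (fun y => k y *m B + 0).
  move=> n; apply: Ck_onD; [exact: openT| |exact: Ck_on_cst].
  by apply: Ck_on_mulmx; [exact: openT|exact: sk].
have kBA i x : k (x + delta_mx 0 i) *m B + 0 = k x *m B + 0 + row i (A *m B).
  by rewrite !addr0 kA mulmxDl !rowE mulmxA.
rewrite mulrC -{1}detB -det_mulmx -(integral_jacobian_quasiperiodic skB kBA).
apply: eq_Rintegral => y _; apply: eq_Rintegral => x _.
have E2 := det_jacobian_post B 0 (smooth_on_near (row2 x y) sk).
apply: (etrans (pull_areaE _)); apply: (etrans (mulrC _ _)).
apply: (etrans _ (esym E2)).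
exact: (congr1 (fun t => \det (jacobian k (row2 x y)) * t) (esym detB)).
Qed.

(** Contracting with a vertical field leaves the form - (s z) du, whose integral is
    the increment of the first coordinate of [k] along the loop. *)
Lemma loop_intE (ze : @vfield R (msurf m)) (Z : A2) i : Z 0 0 = 0 ->
  (forall c v, at_ c -> dom c (Q v) -> ze c (Q v) = Z *m lin c v) ->
  loop_int i (Defs.contract ze om) = - (s * Z 0 1 * A i 0).
Proof.
move=> Z00 ZE; pose u y : R^o := k y 0 0.
have Cu n : Ck_on n setT u by apply: Ck_on_coord; [exact: openT|exact: sk].
have E x w : pull_oneform (Defs.contract ze om) x w = - (s * Z 0 1) * 'D_w u x.
  have val c : at_ c -> dom c (Q (g x)) ->
      Defs.contract ze om c (Q (g x)) ('D_w (fun y => cmap c (mmap m (pi2 y))) x) =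
      - (s * Z 0 1) * 'D_w u x.
    move=> ac cx; rewrite (near_eq_derive _ (marking_chart ac cx)).
    have dg : derivable g x w.
      exact: smooth_near_derivable (smooth_on_near x smooth_marking).
    have [_ ->] := derive_affine_post (lin c (g x))
      (cmap c (Q (g x)) - g x *m lin c (g x)) dg.
    rewrite /Defs.contract (ZE _ _ ac cx) det2_mul /det2 Z00 mul0r sub0r.
    have -> : 'D_w g x 0 0 = 'D_w u x.
      rewrite derive_mx // mxE; congr ('D_w _ x); apply/funext => y.
      by rewrite /g /Phi row2_0.
    rewrite mulrCA (omE ac cx); move: ('D_w u x : R) => d.
    by ring.
  apply: xget_eq => [|_ [c [ac + ->]]].
    have [c ac cx] := fc_chart FC (Q (g x)); exists c; rewrite fE.
    by split; [exact: ac|exact: cx|exact/esym/val].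
  by rewrite fE -/(g x) => cx; exact: val.
rewrite /loop_int; under eq_Rintegral do rewrite E.
pose F (t : R) := - (s * Z 0 1) * u (t *: delta_mx 0 i + 0).
pose f (t : R) : R := - (s * Z 0 1) * 'D_(delta_mx 0 i) u (t *: delta_mx 0 i).
have dF (t : R) : is_derive t (1 : R) F (f t).
  have du : derivable u (t *: delta_mx 0 i + 0) (delta_mx 0 i).
    exact: Ck1_derivable (Cu 1%N).
  have := is_derive_line du; rewrite /f -[in X in _ -> X](addr0 (t *: _)) => dl.
  exact: is_deriveZ.
have cf : continuous f.
  move=> t; apply: cvgM; first exact: cvg_cst.
  apply: (@continuous_comp _ _ _ (fun t : R => t *: delta_mx 0 i) ('D_(delta_mx 0 i) u)).
    exact: scalel_continuous.
  exact: (@Ck1_continuous_derive _ _ _ _ _ (delta_mx 0 i) (Cu 1%N)).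
rewrite (FTC01 dF cf) /F scale1r scale0r !add0r addr0 /u.
have -> : k (delta_mx 0 i) = k 0 + row i A by rewrite -kA add0r.
by rewrite !mxE; ring.
Qed.

End Forms.
End PeriodComputation.

(** * Euclidean fibres *)

Section Euclidean.
Context {R : realType}.
Local Notation A2 := 'rV[R]_2.
Context {a : R} {M : Type} {at_ : set (chart M A2)} {Q : A2 -> M}.
Hypothesis FC : fibre_cover a at_ Q.
Local Notation lin := (@lin R M Q).
Local Notation lift_chart := (@lift_chart R M Q).

Lemma affine_germ_unique (B B' : 'M[R]_2) (b b' v : A2) :
  (\forall w \near v, w *m B + b = w *m B' + b') -> B = B'.
Proof.
move=> H; rewrite -(@jacobian_affine R (fun w => w *m B + b) B b v).
  exact: (@jacobian_affine R (fun w => w *m B + b) B' b' v).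
exact: near_everywhere.
Qed.

(** The linear part of a Euclidean developing map is the same at all points of the
    plane, because lattice translations have trivial linear part; so the linear
    holonomy is trivial. *)
Lemma euclidean_holonomy : euclidean at_ -> a = 0.
Proof.
move=> [L uL [f [_ faff]]]; pose q := orbit_cls (lattice_act L).
have S := straightened_lattice uL.
(* T v B says that near v a Euclidean developing map has linear part B. *)
pose T (v : A2) (B : 'M[R]_2) := B \in unitmx /\ exists (b : A2) d,
  [/\ cover_atlas q d & \forall w \near v,
     dom d (f (Q w)) /\ cmap d (f (Q w)) = w *m B + b].
have Tex v : exists B, T v B.
  have [c ac cv] := fc_chart FC (Q v); have [x qx] := st_surj S (f (Q v)).
  have [d [ad dx _]] := st_chart_at S x; rewrite qx in dx.
  have [B [b [uB H]]] := faff c d _ ac ad cv dx.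
  have [uLc Hc] := linP FC ac cv.
  exists (lin c v *m B); split; first by rewrite unitmx_mul uLc uB.
  exists ((cmap c (Q v) - v *m lin c v) *m B + b), d; split=> //.
  apply: filterS2 Hc (near_comp (cmap_continuous FC ac cv) H) => w [dw Ew _].
  have [_ ->] := fc_ok FC ac => // -[dfw ->]; split=> //.
  rewrite Ew mulmxA addrA -mulmxDl; congr (_ *m B + b).
  by rewrite mulmxBl addrA addrAC.
have Tuniq v B B' : T v B -> T v B' -> B = B'.
  move=> [_ [b [d [ad H]]]] [_ [b' [d' [ad' H']]]].
  pose e (w : A2) := ((w *m B' + b') - (w *m B + b)) *m invmx L.
  have ez : \forall w \near v, exists n, e w = zvec n.
    apply: filterS2 H H' => w [dw Ew] [dw' Ew'].
    have /lattice_cls_eq[n En] : q (cmap d (f (Q w))) = q (cmap d' (f (Q w))).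
      by rewrite (cover_inv ad dw) (cover_inv ad' dw').
    by exists n; rewrite /e -Ew -Ew' En [_ + zvec n *m L]addrC addrK mulmxK.
  have ce : {for v, continuous e}.
    apply: (@smooth_near_continuous R A2 A2 e); apply: smooth_on_near => k.
    apply: Ck_on_mulmx; first exact: openT.
    by apply: Ck_onB; [exact: openT|exact: affine_smooth|exact: affine_smooth].
  have Hc := lattice_valued_locally_constant ez ce.
  apply: (@affine_germ_unique B B' b (b' - e v *m L) v).
  apply: filterS Hc => w; rewrite /e => /(congr1 (mulmx^~ L)) /=.
  by rewrite !mulmxKV// => <-; rewrite addrA opprB addrC subrK.
have [B0 TB0] : exists B0, forall v, T v B0.
  have /choice[Bf TBf] := Tex; exists (Bf 0) => v.
  rewrite (@locally_constant R A2 _ Bf _ 0 v); first exact: TBf.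
  move=> x; have [uB [b [d [ad H]]]] := TBf x.
  apply: filterS (nbhs_interior H) => w Hw; apply: Tuniq (TBf w) _.
  by split=> //; exists b, d.
pose n : 'rV[int]_2 := delta_mx 0 0.
have [uB [b [d [ad H]]]] := TB0 (hol a n 0).
pose t := row2 (n 0 0)%:~R ((n 0 1)%:~R + 2^-1 * a * (n 0 0)%:~R ^+ 2) : A2.
have TH : T 0 (hol_lin a n *m B0).
  split; first by rewrite unitmx_mul uB hol_lin_unit.
  exists (t *m B0 + b), d; split=> //.
  have ch : {for (0 : A2), continuous (hol a n)}.
    exact: smooth_near_continuous (smooth_on_near 0 (@smooth_hol _ a n)).
  apply: filterS (near_comp ch H) => w /=; rewrite (Q_hol FC) => -[dw ->].
  by split=> //; rewrite hol_affine -/t mulmxDl mulmxA addrA.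
have E : hol_lin a n *m B0 = B0 by exact: Tuniq TH (TB0 0).
have : hol_lin a n = 1%:M by rewrite -[LHS](mulmxK uB) E mulmxV.
move=> /matrixP /(_ 0 1); rewrite /hol_lin !mxE /= add0r !mulr1.
by [].
Qed.

Lemma hol_flat n (v : A2) : hol 0 n v = v + zvec n.
Proof.
have P0 : Phi (0 : R) =1 id.
  by move=> x; apply: row2P; rewrite /Phi ?row2_0 ?row2_1 ?mulr0 ?mul0r ?addr0.
by rewrite holE P0 Phi_invE oppr0 P0.
Qed.

(** For [a = 0] the deck group consists of the integer translations. *)
Lemma flat_euclidean : a = 0 -> euclidean at_.
Proof.
move=> a0; exists 1%:M; first exact: unitmx1.
pose q := orbit_cls (lattice_act (1%:M : 'M[R]_2)).
have Qeq v w : Q v = Q w <-> q v = q w.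
  split=> [/(fc_eq FC)[n ->]|/lattice_cls_eq[n ->]].
    by rewrite a0 hol_flat; apply/lattice_cls_eq; exists n; rewrite mulmx1.
  by apply/(fc_eq FC); exists n; rewrite a0 hol_flat mulmx1.
pose r p := sval (cid (fc_surj FC p)).
have rK p : Q (r p) = p by rewrite /r; case: cid.
have fQ v : q (r (Q v)) = q v by apply/Qeq; rewrite rK.
exists (q \o r); split.
  exists (fun C => Q (orbit_repr C)) => [p|C] /=.
    by rewrite -[RHS]rK; apply/Qeq; exact: orbit_cls_repr.
  by rewrite fQ; exact: orbit_cls_repr.
move=> c d p ac ad cp dp; have [v Ev] := fc_surj FC p; subst p.
rewrite [(q \o r) _]fQ in dp.
have [uL Hc] := linP FC ac cp.
have [n En] : exists n, cmap d (q v) = v + zvec n *m 1%:M.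
  by apply/lattice_cls_eq; rewrite (cover_inv ad dp).
pose B := invmx (lin c v); pose b := v + zvec n - cmap c (Q v) *m B.
exists B, b; split; first by rewrite unitmx_inv.
pose h (y : A2) := y *m B + b.
have hE y : h y = lift_chart c v y + zvec n.
  have E (x v' z w : A2) : x + (v' + z - w) = v' + (x - w) + z.
    by rewrite addrCA addrAC.
  by rewrite /h /lift_chart mulmxBl; exact: E.
have qh y : q (h y) = q (lift_chart c v y).
  by apply/esym/lattice_cls_eq; exists n; rewrite mulmx1.
have h0 : h (cmap c (Q v)) = v + zvec n.
  by rewrite hE /lift_chart subrr mul0mx addr0.
have ch : {for cmap c (Q v), continuous h}.
  exact: smooth_near_continuous (smooth_on_near _ (affine_smooth B b)).
have := @cover_chart_near _ _ _ _ q h d (cmap c (Q v)) ad.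
have -> : q (h (cmap c (Q v))) = q v.
  by rewrite qh /lift_chart subrr mul0mx addr0.
rewrite h0 En mulmx1 => /(_ dp erefl ch) H.
apply: filterS2 H (lift_chartP FC ac cp) => y [dy Ey] [-> _ _ _] /=.
by rewrite fQ -qh; split.
Qed.

End Euclidean.

(** * Existence of the normalized field *)

Section NormalFields.
Context {R : realType}.
Local Notation A2 := 'rV[R]_2.
Context {a : R} {M : Type} {at_ : set (chart M A2)} {Q : A2 -> M}.
Hypothesis FC : fibre_cover a at_ Q.
Local Notation lin := (@lin R M Q).
Local Notation lift_chart := (@lift_chart R M Q).

(** Equivariance under the deck group makes the value independent of the chosen
    preimage of a point of the surface. *)
Lemma descend_vfield (X : A2 -> A2) :
  (forall n v, X (hol a n v) = X v *m hol_lin a n) ->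
  exists xi : @vfield R M, is_vfield at_ xi /\
    forall c v, at_ c -> dom c (Q v) -> xi c (Q v) = X v *m lin c v.
Proof.
move=> Xhol; pose r p := sval (cid (fc_surj FC p)).
have rK p : Q (r p) = p by rewrite /r; case: cid.
pose xi : @vfield R M := fun c p => X (r p) *m lin c (r p).
have xiE c v : at_ c -> dom c (Q v) -> xi c (Q v) = X v *m lin c v.
  move=> ac cv; rewrite /xi; move: (r (Q v)) (rK (Q v)) => w Qw.
  have /(fc_eq FC)[n ->] := Qw; have cw : dom c (Q w) by rewrite Qw.
  by rewrite (lin_hol FC n ac cw) Xhol mulmxA.
exists xi; split=> // c d p ac ad; have [v <-] := fc_surj FC p => cv dv.
rewrite (derive_transition FC _ ac ad cv dv) (xiE _ _ ac cv) (xiE _ _ ad dv).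
have [u _] := linP FC ac cv.
by rewrite mulmxA mulmxK.
Qed.

Lemma descend_aform (s : R) : exists om : @aform R M,
  [/\ is_aform at_ om, parallel at_ om &
      forall c v, at_ c -> dom c (Q v) -> om c (Q v) * \det (lin c v) = s].
Proof.
pose r p := sval (cid (fc_surj FC p)).
have rK p : Q (r p) = p by rewrite /r; case: cid.
pose om : @aform R M := fun c p => s / \det (lin c (r p)).
have omE c v : at_ c -> dom c (Q v) -> om c (Q v) = s / \det (lin c v).
  move=> ac cv; rewrite /om; move: (r (Q v)) (rK (Q v)) => w Qw.
  have /(fc_eq FC)[n ->] := Qw; have cw : dom c (Q w) by rewrite Qw.
  by rewrite (lin_hol FC n ac cw) det_mulmx det_hol_lin mul1r.
have ud c v : at_ c -> dom c (Q v) -> \det (lin c v) != 0.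
  by move=> ac cv; have [] := linP FC ac cv; rewrite unitmxE unitfE.
exists om; split.
- move=> c d p ac ad; have [v <-] := fc_surj FC p => cv dv.
  rewrite (jacobian_transition FC ac ad cv dv) (omE _ _ ac cv) (omE _ _ ad dv).
  rewrite det_mulmx det_inv [_^-1 * \det _]mulrC mulrA mulfVK//.
  exact: ud.
- move=> c p ac; have [v <-] := fc_surj FC p => cv.
  apply: filterS (lift_chartP FC ac cv) => y [-> dl El _].
  by rewrite (omE _ _ ac dl) (omE _ _ ac cv) El.
- by move=> c v ac cv; rewrite (omE _ _ ac cv) divfK//; exact: ud.
Qed.

Lemma descend_parallel (Z : A2) :
  (forall n, Z *m hol_lin a n = Z) ->
  exists ze : @vfield R M, [/\ is_vfield at_ ze, parallel at_ ze &
    forall c v, at_ c -> dom c (Q v) -> ze c (Q v) = Z *m lin c v].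
Proof.
move=> ZH; have [|ze [vz zeE]] := @descend_vfield (fun=> Z).
  by move=> n _; rewrite ZH.
exists ze; split=> // c p ac; have [v <-] := fc_surj FC p => cv.
apply: filterS (lift_chartP FC ac cv) => y [-> dl El _].
by rewrite (zeE _ _ ac dl) (zeE _ _ ac cv) El.
Qed.

Lemma bipoly_affine (al be ga : R) : exists P : {poly {poly R}},
  forall u t, P.[t%:P].[u] = al + be * u + ga * t.
Proof.
exists ((be *: 'X + al%:P)%:P + (ga%:P)%:P * 'X) => u t.
by rewrite !hornerE /=; ring.
Qed.

(** The fields are zeta = (0, z) and xi = (x0, ka u), where s z x0 = - 1 and
    ka x0 = z.  Equivariance of xi under the deck group is the relation
    ka = a x0, which is the cubic equation. *)
Lemma normal_field_exists (om : @aform R M) (s z : R) : s != 0 -> z != 0 ->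
  s ^+ 2 * z ^+ 3 = a ->
  (forall c v, at_ c -> dom c (Q v) -> om c (Q v) * \det (lin c v) = s) ->
  exists ze : @vfield R M, [/\ is_vfield at_ ze, parallel at_ ze,
    forall c v, at_ c -> dom c (Q v) -> ze c (Q v) = row2 0 z *m lin c v &
    exists2 xi, polynomial_vfield at_ xi &
        forall c p, at_ c -> dom c p ->
          ze c p = nabla_self xi c p /\ om c p * det2 (ze c p) (xi c p) = 1].
Proof.
move=> s0 z0 sz omE.
have [|ze [vz pz zeE]] := @descend_parallel (row2 0 z).
  by move=> n; rewrite mul_hol_lin; apply: row2P;
    rewrite !(row2_0, row2_1) ?mulr0 ?addr0.
exists ze; split=> //.
pose x0 := - (s * z)^-1; pose ka := - (s * z ^+ 2).
pose C : 'M[R]_2 := ka *: delta_mx 0 1.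
pose X (v : A2) := v *m C + row2 x0 0.
have XE v : X v = row2 x0 (ka * v 0 0).
  apply: row2P; rewrite /X /C !(row2_0, row2_1) mxE mul_rV2 !mxE /=;
    ring.
have [|xi [vx xiE]] := @descend_vfield X.
  move=> n v; rewrite !XE mul_hol_lin; apply: row2P; rewrite !(row2_0, row2_1) //.
  rewrite /transl /Phi_inv mxE row2_0 zvecE /ka /x0 -sz.
  by field; rewrite s0 z0.
have sX : smooth_on setT X by exact: affine_smooth.
exists xi; first split=> //.
  move=> c p ac; have [v <-] := fc_surj FC p => cv.
  pose L := lin c v; pose B := invmx L.
  pose l00 := (v 0 0 - cmap c (Q v) 0 0 * B 0 0 - cmap c (Q v) 0 1 * B 1 0).
  have coord j : exists P : {poly {poly R}}, forall y : A2,
      P.[(y 0 1)%:P].[y 0 0] = (X (lift_chart c v y) *m L) 0 j.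
    have [P PE] := bipoly_affine (x0 * L 0 j + ka * l00 * L 1 j)
      (ka * B 0 0 * L 1 j) (ka * B 1 0 * L 1 j).
    exists P => y; rewrite PE XE mul_rV2 row2_0 row2_1 /lift_chart.
    rewrite [(v + _) 0 0]mxE mul_rV2 -/B !mxE /l00; ring.
  have [P PE] := coord 0; have [P' PE'] := coord 1.
  exists P, P'; apply: filterS (lift_chartP FC ac cv) => y [-> dl El _].
  by rewrite (xiE _ _ ac dl) El PE PE' row2_eta.
move=> c p ac; have [v <-] := fc_surj FC p => cv.
have [u H] := linP FC ac cv.
have HX : \forall w \near v, xi c (Q w) = X w *m lin c w.
  by apply: filterS H => w [dw _ _]; exact: xiE.
rewrite (nabla_pull FC ac cv (smooth_on_near v sX) HX) (zeE _ _ ac cv).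
rewrite (xiE _ _ ac cv) det2_mul; split.
  have [_ ->] := derive_affine C (row2 x0 0) (X v) v.
  congr (_ *m _); rewrite XE; apply: row2P; rewrite mul_rV2 !(row2_0, row2_1) !mxE /=.
    by ring.
  by rewrite /x0 /ka; field; rewrite s0 z0.
rewrite mulrCA (omE _ _ ac cv) /det2 XE !(row2_0, row2_1) /x0.
by field; rewrite s0 z0.
Qed.

End NormalFields.

(** * The period of a covered torus *)

Section Period.
Context {R : realType}.
Local Notation A2 := 'rV[R]_2.
Context {a : R} {m : marked R} {Q : A2 -> msurf m}.
Hypothesis FC : fibre_cover a (@matlas R m) Q.
Local Notation at_ := (@matlas R m).
Local Notation lin := (@lin R (msurf m) Q).

(** Normalization of the area forces the coefficient of the area form to be
    [\det A], and the cubic equation then forces zeta = (0, cbrt a): the fields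
    exist, and the resulting vector does not depend on them.  In the Euclidean
    case both sides vanish. *)
Lemma period_fibre_cover (k : A2 -> A2) (A : 'M[R]_2) :
  smooth_on setT k -> (forall i x, k (x + delta_mx 0 i) = k x + row i A) ->
  (forall x, mmap m (pi2 x) = Q (Phi a (k x))) -> \det A ^+ 2 = 1 ->
  period m = - (\det A * cbrt a) *: row2 (A 0 0) (A 1 0).
Proof.
move=> sk kA fE detA; set s := \det A in detA *.
have s0 : s != 0 by rewrite -sqrf_eq0 detA oner_eq0.
have ss : s * s = 1 by rewrite -expr2.
rewrite /period; case: asboolP => [/(euclidean_holonomy FC) -> |neu].
  by rewrite (_ : cbrt 0 = 0) ?mulr0 ?oppr0 ?scale0r//; apply/eqP; rewrite cbrt_eq0.
have a0 : a != 0 by apply/eqP => /(flat_euclidean FC).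
pose z := cbrt a; have z0 : z != 0 by rewrite cbrt_eq0.
have sz : s ^+ 2 * z ^+ 3 = a by rewrite detA mul1r cbrtK.
have loops om s' (ze : @vfield R (msurf m)) (Z : A2) : s' = s -> Z = row2 0 z ->
    (forall c v, at_ c -> dom c (Q v) -> om c (Q v) * \det (lin c v) = s') ->
    (forall c v, at_ c -> dom c (Q v) -> ze c (Q v) = Z *m lin c v) ->
    \row_(i < 2) loop_int i (Defs.contract ze om) =
    - (s * z) *: row2 (A 0 0) (A 1 0).
  move=> -> -> omE zeE.
  have lE i := loop_intE FC sk kA fE omE i (row2_0 0 z) zeE.
  by apply: row2P; rewrite !mxE !lE row2_1 !mulNr.
apply: xget_eq.
  have [om [ao po omE]] := descend_aform FC s.
  have [ze [vz pz zeE ex]] := normal_field_exists FC s0 z0 sz omE.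
  exists om, ze; split; [split=> //|split=> //|].
    by rewrite (area_intE FC sk kA fE omE).
  by rewrite (loops om s ze (row2 0 z) erefl erefl omE zeE).
move=> v [om [ze [[ao po aom] [vz pz [xi px zexi]] ->]]].
have [s' omE] := aform_constant FC ao po.
(* The area is s' * \det A, and \det A is its own inverse. *)
have Es : s' = s.
  have := area_intE FC sk kA fE omE; rewrite aom => E.
  by apply: (mulIf s0); rewrite -/s ss -E.
have [Z ZE] := vfield_constant FC vz pz.
have [X [XE Xhol]] := vfield_pull FC px.
have [Z00 Zz] := field_cube FC a0 omE px zexi XE Xhol ZE.
apply: (loops om s' ze Z Es _ omE ZE).
apply: row2P; rewrite ?row2_0 ?row2_1 //.
by apply: cbrt_unique; rewrite -Zz Es detA mul1r.
Qed.

End Period.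

(** * The developing map is affinely the universal covering *)

Section Continuation.
Context {R : realType}.
Local Notation A2 := 'rV[R]_2.

Lemma affine_continuous (B : 'M[R]_2) (b : A2) : continuous (fun w : A2 => w *m B + b).
Proof. by apply: continuous_smooth; exact: affine_smooth. Qed.

Lemma continuous_translate (f : A2 -> A2) w : continuous f ->
  continuous (fun x : A2 => f (x + w)).
Proof.
move=> cf x; apply: (@continuous_comp A2 A2 A2 (fun x : A2 => x + w) f); last exact: cf.
have ct : continuous (fun x : A2 => x + w).
  apply: continuous_smooth => k.
  by apply: Ck_onD; [exact: openT|exact: Ck_on_id|exact: Ck_on_cst].
exact: ct.
Qed.

Lemma affine_germ_eq (B B' : 'M[R]_2) (b b' v : A2) :
  (\forall w \near v, w *m B + b = w *m B' + b') -> B = B' /\ b = b'.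
Proof.
move=> H; have E := affine_germ_unique H; split=> //.
by have := nbhs_singleton H; rewrite E => /addrI.
Qed.

Context {a : R} {m : marked R} {Q : A2 -> msurf m}.
Hypothesis FC : fibre_cover a (@matlas R m) Q.
Local Notation at_ := (@matlas R m).

(** [Phi_inv a] straightens the deck group to the integer lattice, which is discrete. *)
Lemma deck_discrete (al be : A2 -> A2) w :
  {for w, continuous al} -> {for w, continuous be} ->
  (\forall x \near w, Q (al x) = Q (be x)) -> al w = be w ->
  \forall x \near w, al x = be x.
Proof.
move=> ca cb QE E; pose e x := Phi_inv a (be x) - Phi_inv a (al x).
have cP : continuous (Phi_inv a) by exact: continuous_smooth (@smooth_Phi_inv _ a).
have ce : {for w, continuous e}.
  apply: (@continuousB _ A2 A2).
    by apply: (@continuous_comp _ _ _ be (Phi_inv a)); [exact: cb|exact: cP].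
  by apply: (@continuous_comp _ _ _ al (Phi_inv a)); [exact: ca|exact: cP].
have ez : \forall x \near w, exists n, e x = zvec n.
  apply: filterS QE => x /(fc_eq FC)[n En]; exists n.
  by rewrite /e En Phi_inv_hol addrC addKr.
apply: filterS (lattice_valued_locally_constant ez ce) => x.
rewrite /e E subrr => /eqP; rewrite subr_eq0 => /eqP.
by move/(can_inj (Phi_invK a)).
Qed.

Variables (dev : A2 -> A2) (h : 'rV[int]_2 -> A2 -> A2) (g : A2 -> A2).
Hypothesis devK : cancel dev g.
Hypothesis gK : cancel g dev.
Hypothesis sg : smooth_on setT g.
Hypothesis devm : develops m dev.

Let q w := mmap m (pi2 (g w)).

(** Near a point, both the developing map and [Q] are affine in the charts of the
    surface. *)
Lemma developing_local (w0 : A2) : exists (B : 'M[R]_2) b,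
  B \in unitmx /\ \forall w \near w0, q w = Q (w *m B + b).
Proof.
have [v Qv] := fc_surj FC (q w0); have [d ad dv] := fc_chart FC (Q v).
have [uL H] := linP FC ad dv.
have [|H1 [psi [A1 [b1 [A1pos psiE]]] H2]] := devm (x := g w0) ad.
  by rewrite Qv in dv.
have cg : {for w0, continuous g}.
  exact: smooth_near_continuous (smooth_on_near w0 sg).
have K1 := near_comp cg H1; have K2 := near_comp cg H2.
have E0 : w0 *m A1 + b1 = cmap d (Q v).
  by rewrite Qv /q (nbhs_singleton K2) psiE gK.
have ca : {for w0, continuous (fun w : A2 => w *m A1 + b1)}.
  exact: affine_continuous.
have HL := lift_chartP FC ad dv; rewrite -E0 in HL.
have K3 := near_comp ca HL.
pose Li := invmx (@lin R _ Q d v).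
exists (A1 *m Li), ((b1 - cmap d (Q v)) *m Li + v); split.
  by rewrite unitmx_mul unitmx_inv uL andbT unitmxE unitfE gt_eqF.
apply: filterS3 K1 K2 K3 => w dq Eq [E3 _ _ _].
have [_ dK] := fc_ok FC ad; rewrite -[LHS](dK _ dq) Eq psiE gK E3.
congr Q; rewrite /lift_chart -/Li mulmxA addrA -mulmxDl addrA.
by rewrite addrC.
Qed.

(** Two affine lifts that agree up to the deck group at one point differ by a deck
    transformation near it, which is affine as well; so the local lifts can be
    continued over the plane, and an affine germ determines them. *)
Lemma developing_affine : exists (B : 'M[R]_2) b,
  B \in unitmx /\ forall w, q w = Q (w *m B + b).
Proof.
have [B0 [b0 [u0 H0]]] := developing_local 0; exists B0, b0; split=> //.
pose P (w : A2) := \forall w' \near w, q w' = Q (w' *m B0 + b0).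
suff H : forall w, P w by move=> w; exact: nbhs_singleton (H w).
move=> w; apply: (@locally_iff_global R A2 P _ 0 w) => // {}w.
have [Pw|nPw] := pselect (P w).
  by apply: filterS (nbhs_interior Pw) => x Px; split=> _.
have [B [b [uB HB]]] := developing_local w.
apply: filterS (nbhs_interior HB) => x Hx; split=> // Px; exfalso; apply: nPw.
have /(fc_eq FC)[n En] : Q (x *m B + b) = Q (x *m B0 + b0).
  by rewrite -(nbhs_singleton Hx) -(nbhs_singleton Px).
pose t := row2 (n 0 0)%:~R ((n 0 1)%:~R + 2^-1 * a * (n 0 0)%:~R ^+ 2) : A2.
have holE' y : hol a n (y *m B + b) =
    y *m (B *m hol_lin a n) + (b *m hol_lin a n + t).
  by rewrite hol_affine -/t mulmxDl mulmxA addrA.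
have Heq : \forall y \near x, y *m B0 + b0 =
    y *m (B *m hol_lin a n) + (b *m hol_lin a n + t).
  apply: deck_discrete.
  - exact: affine_continuous.
  - exact: affine_continuous.
  - by apply: filterS2 Hx Px => y Ey <-; rewrite -holE' (Q_hol FC).
  - by rewrite En holE'.
have [E1 E2] := affine_germ_eq Heq.
by apply: filterS HB => y Ey; rewrite E1 E2 -holE' (Q_hol FC).
Qed.

End Continuation.

(** * The action of a marking on the lattice *)

Section Lift.
Context {R : realType}.
Local Notation A2 := 'rV[R]_2.
Context {a : R} {m : marked R} {Q : A2 -> msurf m}.
Hypothesis FC : fibre_cover a (@matlas R m) Q.

Lemma lattice_additive (J : 'rV[int]_2 -> 'rV[int]_2) :
  (forall n n', J (n + n') = J n + J n') ->
  forall n, J n = n *m (\matrix_i J (delta_mx 0 i)).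
Proof.
move=> JD; have J0 : J 0 = 0 by apply: (addrI (J 0)); rewrite -JD !addr0.
have JN n : J (- n) = - J n by apply: (addrI (J n)); rewrite -JD !subrr.
have Jn k n : J (n *+ k) = J n *+ k.
  by elim: k => [|k IH]; rewrite ?mulr0n// !mulrS JD IH.
have natZ (k : nat) (v : 'rV[int]_2) : k%:Z *: v = v *+ k.
  by rewrite -scaler_nat natz.
have JZ (z : int) n : J (z *: n) = z *: J n.
  by case: z => k; rewrite ?NegzE ?scaleNr ?JN !natZ Jn.
move=> n; rewrite {1}[n]row_sum_delta big_ord_recl big_ord1 JD !JZ.
by rewrite [RHS]mulmx_sum_row big_ord_recl big_ord1 !rowK.
Qed.

(** In affine coordinates adapted to [Q], the developing diffeomorphism lifts the
    marking.  Its increments over a lattice vector are lattice valued and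
    continuous, hence constant, and this gives [A].  The marking is injective,
    so every lattice vector is such an increment and [A] is invertible. *)
Lemma lift_marking : complete_marked m ->
  exists (k : A2 -> A2) (A : 'M[int]_2),
  [/\ smooth_on setT k,
      forall x n, k (x + zvec n) = k x + zvec (n *m A),
      forall x, mmap m (pi2 x) = Q (Phi a (k x)) & \det A ^+ 2 = 1].
Proof.
move=> [_ [fi [fK _ _ _]] _ [dev [h [_ devm [g [devK gK sdev sg]]]]]].
have [B [b [uB QE]]] := developing_affine FC gK sg devm.
pose k x := Phi_inv a (dev x *m B + b).
have sk : smooth_on setT k.
  move=> n; apply: (@Ck_on_Phi_inv _ _ n setT (cst a : A2 -> R^o)).
  - exact: openT.
  - exact: Ck_on_cst.
  - apply: Ck_onD; [exact: openT| |exact: Ck_on_cst].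
    by apply: Ck_on_mulmx; [exact: openT|exact: sdev].
have fE x : mmap m (pi2 x) = Q (Phi a (k x)).
  by rewrite Phi_invK -QE devK.
have kper x n : exists j, k (x + zvec n) = k x + zvec j.
  have /(fc_eq FC)[j Ej] : Q (Phi a (k x)) = Q (Phi a (k (x + zvec n))).
    by rewrite -!fE pi2_transl.
  by exists j; rewrite -[LHS](PhiK a) Ej Phi_inv_hol PhiK.
pose J n := sval (cid (kper 0 n)).
have JE n : k (zvec n) = k 0 + zvec (J n).
  by rewrite -[zvec n]add0r /J; case: cid.
have ck : continuous k by exact: continuous_smooth.
have kJ x n : k (x + zvec n) = k x + zvec (J n).
  pose e (y : A2) : A2 := k (y + zvec n) - k y.
  have ce : continuous e.
    move=> y; apply: (@continuousB _ A2 A2 (fun x => k (x + zvec n)) k); last exact: ck.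
    exact: continuous_translate.
  have E : e x = e 0.
    apply: locally_constant => y; apply: lattice_valued_locally_constant (ce y).
    apply: near_everywhere => z; have [j Ej] := kper z n; exists j.
    by rewrite /e Ej addrC addKr.
  have E0 : e 0 = zvec (J n) by rewrite /e add0r JE addrC addKr.
  by rewrite -[LHS](subrK (k x)) -/(e x) E E0 addrC.
have JD n n' : J (n + n') = J n + J n'.
  apply: (@zvec_inj R); apply: (addrI (k 0)).
  by rewrite zvecD -JE zvecD kJ JE addrA.
pose A := \matrix_i J (delta_mx 0 i) : 'M[int]_2.
have JA n : J n = n *m A by exact: lattice_additive.
exists k, A; split=> // [x n|]; first by rewrite kJ JA.
have Jsurj j : exists n, J n = j.
  pose y := g ((Phi a (k 0 + zvec j) - b) *m invmx B).
  have ky : k y = k 0 + zvec j by rewrite /k /y gK mulmxKV// subrK PhiK.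
  have : pi2 0 = pi2 y.
    by apply: (can_inj fK); rewrite !fE ky -hol_Phi (Q_hol FC).
  move=> /pi2_eq[n En]; exists n; apply: (@zvec_inj R); apply: (addrI (k 0)).
  by rewrite -JE -ky En add0r.
have /choice[N NE] : forall i : 'I_2, exists n, J n = delta_mx 0 i.
  by move=> i; exact: Jsurj.
have NA : (\matrix_i N i) *m A = 1%:M.
  by apply/row_matrixP => i; rewrite row_mul rowK -JA NE rowE mulmx1.
have := congr1 determinant NA; rewrite det_mulmx det1 => /(congr1 absz).
rewrite abszM => /eqP; rewrite muln_eq1 => /andP[_ /eqP dA].
by move: (\det A) dA => -[[|[|?]]|[|?]].
Qed.

End Lift.

(** * Periods of the tori affinely diffeomorphic to a fibre *)

Section Fibre.
Context {R : realType}.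
Local Notation A2 := 'rV[R]_2.
Local Notation fib_charts a := (@fib_atlas _ _ _ (E_family R) a).

Lemma fibre_cover_diffeo (a : R) (M : Type) (at_ : set (chart M A2))
    (phi : fibre (E_family R) a -> M) :
  affine_surface at_ -> affine_diffeo (fib_charts a) at_ phi ->
  fibre_cover a at_ (fun v => phi (E_fib_cls a v)).
Proof.
move=> [[ok ch _ _ _] _] [[psi phiK psiK] aff]; split=> //.
- by move=> p; have [v E] := E_fib_surj (psi p); exists v; rewrite E psiK.
- move=> v w; split=> [/(can_inj phiK)/E_fib_eq //|].
  by move=> /E_fib_eq ->.
- move=> d v ad dv; have [c [ac dc cv]] := st_chart_at (straightened_fibre a) v.
  have [B [b [uB H]]] := aff _ _ _ ac ad dc dv; exists B, b; split=> //.
  by rewrite cv in H; have -> : E_fib_cls a = cinv c by case: ac.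
Qed.

Lemma affine_diffeo_id (M : Type) (at_ : set (chart M A2)) :
  affine_surface at_ -> affine_diffeo at_ at_ id.
Proof.
move=> [[ok _ sm _ _] aff]; split; first by exists id.
move=> c d p ac ad cp dp; have [g [B [b [Bpos ->]]] H] := aff _ _ _ ac ad cp dp.
exists B, b; split; first by rewrite unitmxE unitfE gt_eqF.
have [H1 _] := sm p c d ac ad cp dp.
by apply: filterS2 H H1 => y E1 E2; split.
Qed.

Lemma period_marking (a : R) (m : marked R) (phi : fibre (E_family R) a -> msurf m)
    (k : A2 -> A2) (A : 'M[int]_2) :
  affine_surface (@matlas R m) -> affine_diffeo (fib_charts a) (@matlas R m) phi ->
  smooth_on setT k -> (forall x n, k (x + zvec n) = k x + zvec (n *m A)) ->
  (forall x, mmap m (pi2 x) = phi (E_fib_cls a (Phi a (k x)))) ->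
  \det A ^+ 2 = 1 ->
  period m = - ((\det A)%:~R * cbrt a) *: row2 (A 0 0)%:~R (A 1 0)%:~R.
Proof.
move=> sm aphi sk kA fE dA.
have := period_fibre_cover (fibre_cover_diffeo sm aphi) (A := map_mx intr A) sk.
rewrite det_map_mx !mxE; apply=> //; last by rewrite -rmorphXn dA.
move=> i x; rewrite -zvec_delta kA -rowE; congr (_ + _).
by apply/rowP => j; rewrite !mxE.
Qed.

(** The first column of an invertible integer matrix has an entry of absolute value
    at least 1, so the bound does not depend on the marking. *)
Lemma period_bound (a : R) (m : marked R) (phi : fibre (E_family R) a -> msurf m) :
  complete_marked m -> affine_diffeo (fib_charts a) (@matlas R m) phi ->
  `|cbrt a| <= `|period m| /\ (a = 0 -> period m = 0).
Proof.
move=> cm aphi; have sm : affine_surface (@matlas R m) by case: cm.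
have [k [A [sk kA fE dA]]] := lift_marking (fibre_cover_diffeo sm aphi) cm.
rewrite (period_marking sm aphi sk kA fE dA); split; last first.
  by move=> ->; rewrite /cbrt sgr0 mul0r mulr0 oppr0 scale0r.
move: (cbrt a) => s; rewrite normrZ normrN normrM.
have nint (z : int) : z != 0 -> 1 <= `|z%:~R : R|.
  by move=> z0; rewrite -intr_norm -[1]/(1%:~R) ler_int -gtz0_ge1 normr_gt0.
have d1 : \det A != 0 by apply: contra_eqN dA => /eqP ->; rewrite expr0n.
rewrite -mulrA mulrCA -[leLHS]mulr1; apply: ler_wpM2l => //.
apply: mulr_ege1; first exact: nint.
have [A0|A0] := eqVneq (A 0 0) 0; last first.
  apply: le_trans (nint _ A0) _.
  by have := @A2_norm_coord R (row2 (A 0 0)%:~R (A 1 0)%:~R) 0; rewrite row2_0.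
have A1 : A 1 0 != 0.
  by apply: contra d1 => /eqP A1; rewrite det_mx22 A0 A1 mul0r mulr0 subrr.
apply: le_trans (nint _ A1) _.
by have := @A2_norm_coord R (row2 (A 0 0)%:~R (A 1 0)%:~R) 1; rewrite row2_1.
Qed.

Lemma period_E_marked (a : R) : period (E_marked a) = row2 (- cbrt a) 0.
Proof.
have sm := fibre_affine_surface a.
rewrite (@period_marking a (E_marked a) id id 1%:M) //.
- by rewrite det1 !mxE mul1r /=; apply: row2P; rewrite !mxE /= ?mulr1 ?mulr0.
- exact: affine_diffeo_id.
- by move=> k; exact: Ck_on_id.
- by move=> x n; rewrite mulmx1.
- by move=> x; rewrite /= E_marking_pi2.
- by rewrite det1 expr1n.
Qed.

End Fibre.

(** * Lifting isotopies to the plane *)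

Section IsotopyLift.
Context {R : realType}.
Local Notation A2 := 'rV[R]_2.
Local Notation L1 := 'rV[R]_1.
Local Notation T2 := (@T2 R).

(** Such a lift exhibits [g] as acting trivially on the fundamental group of the
    torus. *)
Definition equivariant_lift (g : T2 -> T2) (K : A2 -> A2) :=
  [/\ continuous K, forall x, pi2 (K x) = g (pi2 x)
    & forall x n, K (x + zvec n) = K x + zvec n].

Definition local_lift (g : T2 -> T2) := forall x0 y0 : A2,
  pi2 y0 = g (pi2 x0) -> exists F : A2 -> A2,
    [/\ F x0 = y0, {for x0, continuous F}
      & \forall x \near x0, pi2 (F x) = g (pi2 x)].

Definition close_maps (g1 g2 : T2 -> T2) := forall t, exists y1 y2 : A2,
  [/\ pi2 y1 = g1 t, pi2 y2 = g2 t & `|y2 - y1| < 2^-1].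

Lemma small_displacement_unique (y w w' : A2) : `|w| < 2^-1 -> `|w'| < 2^-1 ->
  pi2 (y + w) = pi2 (y + w') -> w' = w.
Proof.
move=> hw hw' /pi2_eq[n]; rewrite -addrA => /addrI E.
suff n0 : n = 0 by rewrite E n0 zvec0 addr0.
apply: (@zvec_small R); have -> : zvec n = w' - w by rewrite E addrAC subrr add0r.
apply: le_lt_trans (ler_normB _ _) _.
by rewrite [ltRHS](splitr 1) !mul1r ltrD.
Qed.

Lemma close_displacement g1 g2 (x y : A2) : close_maps g1 g2 ->
  pi2 y = g1 (pi2 x) ->
  exists w, `|w| < 2^-1 /\ pi2 (y + w) = g2 (pi2 x).
Proof.
move=> /(_ (pi2 x))[y1 [y2 [E1 E2 h]]] E; exists (y2 - y1); split=> //.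
have /pi2_eq[n ->] : pi2 y1 = pi2 y by rewrite E.
by rewrite addrAC addrCA subrr addr0 pi2_transl.
Qed.

(** The lift of [g1] is corrected by the small displacement that brings it over
    [g2].  There is only one displacement of norm less than 1/2, so the
    correction is periodic, and it agrees with the one given by any local lift,
    so it is continuous. *)
Lemma close_equivariant_lift g1 g2 : close_maps g1 g2 -> local_lift g2 ->
  (exists K, equivariant_lift g1 K) -> exists K, equivariant_lift g2 K.
Proof.
move=> cl ll [K [cK piK eqK]].
have /choice[w wE] : forall x, exists w,
    `|w| < 2^-1 /\ pi2 (K x + w) = g2 (pi2 x).
  by move=> x; exact: close_displacement cl (piK x).
have wu x v : `|v| < 2^-1 -> pi2 (K x + v) = g2 (pi2 x) -> v = w x.
  move=> hv Ev; have [hw Ew] := wE x.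
  by apply: (small_displacement_unique hw hv (y := K x)); rewrite Ev.
exists (fun x => K x + w x); split=> [x0|x|x n]; last first.
- rewrite eqK addrAC; congr (_ + _ + _); apply: wu; first by have [] := wE (x + zvec n).
  have [_] := wE (x + zvec n); rewrite pi2_transl => <-.
  by rewrite eqK addrAC pi2_transl.
- by have [] := wE x.
have [hw Ew] := wE x0; have [F [F0 cF EF]] := ll _ _ Ew.
pose e (x : A2) : A2 := F x - K x.
have ce : {for x0, continuous e}.
  apply: (@continuousB _ A2 A2 F K); [exact: cF|exact: cK].
have e0 : e x0 = w x0 by rewrite /e F0 addrC addKr.
have se : \forall x \near x0, `|e x| < 2^-1.
  have cn : {for x0, continuous (fun x => `|e x| : R)}.
    by apply: (@continuous_comp _ _ _ e Num.norm); [exact: ce|exact: norm_continuous].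
  by have := cvgr_lt _ cn; apply; rewrite e0.
apply: (@near_eq_continuous _ _ _ F) cF.
apply: filterS2 EF se => x E1 E2; rewrite -(wu x (e x)) //.
  by rewrite /e addrC subrK.
by rewrite /e addrC subrK.
Qed.

Definition line_chart : chart R L1 :=
  Chart setT (fun t => const_mx t) (fun y : L1 => y 0 0).

Lemma line_chart_atlas : line_atlas line_chart.
Proof.
split=> //; split=> [|p _ /=]; last by rewrite mxE.
rewrite (_ : _ @` _ = setT); first exact: openT.
apply/seteqP; split=> // y _; exists (y 0 0) => //.
by apply: L1_inj; rewrite mxE.
Qed.

Lemma isotopy_local_lift (G : R -> T2 -> T2) (x0 y0 : A2) t0 :
  smooth_map (prod_atlas line_atlas T2_atlas) T2_atlas (fun z => G z.1 z.2) ->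
  pi2 y0 = G t0 (pi2 x0) ->
  exists F : A2 * R -> A2, [/\ F (x0, t0) = y0, {for (x0, t0), continuous F}
    & \forall z \near (x0, t0), pi2 (F z) = G z.2 (pi2 z.1)].
Proof.
move=> sG E.
have [c [ac dc cx]] := st_chart_at (@straightened_T2 R) x0.
have [d [ad dd dy]] := st_chart_at (@straightened_T2 R) y0.
have [|||H1 H2] := sG (t0, pi2 x0) (prod_chart line_chart c) d _ ad.
- by exists line_chart, c; split=> //; exact: line_chart_atlas.
- by split.
- by rewrite /= -E.
have cq : cinv c = pi2 by case: ac.
rewrite /= cx cq in H1 H2.
pose io (z : A2 * R) : L1 * A2 := (const_mx z.2, z.1).
have cio : {for (x0, t0), continuous io}.
  have -> : io = (fun z => (z.2 *: const_mx 1, z.1)).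
    by apply/funext => z; congr (_, _); apply: L1_inj; rewrite !mxE mulr1.
  have c1 : (fun z : A2 * R => z.2 *: (const_mx 1 : L1)) @ (x0, t0) -->
      t0 *: (const_mx 1 : L1) by apply: cvgZr_tmp; exact: cvg_snd.
  have c2 : (fun z : A2 * R => z.1) @ (x0, t0) --> x0 by exact: cvg_fst.
  exact: (cvg_pair c1 c2).
pose F z := cmap d (G z.2 (pi2 z.1)).
pose D (y : L1 * A2) : A2 := cmap d (G (y.1 0 0) (pi2 y.2)).
have FE z : F z = D (io z) by rewrite /F /D /io /= mxE.
exists F; split.
- by rewrite /F /= -E dy.
- rewrite (_ : F = D \o io); last by apply/funext => z; exact: FE.
  apply: (@continuous_comp _ _ _ io D); first exact: cio.
  exact: smooth_near_continuous H2.
have : \forall z \near (x0, t0), dom d (G ((io z).1 0 0) (pi2 (io z).2)).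
  exact: cio H1.
apply: filterS => z; rewrite /io /= mxE => dz.
exact: cover_inv ad dz.
Qed.

Lemma T2_box (t : T2) : exists2 x : A2, pi2 x = t & forall i, x ord0 i \in `[0, 1].
Proof.
rewrite -[t]pi2_repr; move: (orbit_repr t) => x.
exists (x - zvec (\row_i Num.floor (x 0 i))).
  by rewrite -zvecN pi2_transl.
move=> i; rewrite !mxE in_itv /=.
have := floor_le (x 0 i); have := floorD1_gt (x 0 i); rewrite intrD.
by move: (_%:~R) => m *; apply/andP; split; lra.
Qed.

(** Compactness of the torus makes the isotopy uniformly continuous in time. *)
Lemma isotopy_close (G : R -> T2 -> T2) (t0 : R) :
  smooth_map (prod_atlas line_atlas T2_atlas) T2_atlas (fun z => G z.1 z.2) ->
  \forall t \near t0, close_maps (G t0) (G t).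
Proof.
move=> sG.
pose box : set A2 := [set v : A2 | forall i, `[0, 1]%classic (v ord0 i)].
have cbox : compact box.
  by apply: (@rV_compact R^o 2 (fun=> `[0, 1]%classic)) => i; exact: segment_compact.
pose P (t : R) (x : A2) := exists y1 y2 : A2,
  [/\ pi2 y1 = G t0 (pi2 x), pi2 y2 = G t (pi2 x) & `|y2 - y1| < 2^-1].
have H : \near t0, box `<=` P t0.
  apply: (proj1 (compact_near_coveringP box) cbox R (nbhs t0) P _) => x _.
  have [F [_ cF HF]] := isotopy_local_lift sG (pi2_repr (G t0 (pi2 x))).
  have h4 : 0 < 4^-1 :> R by rewrite invr_gt0.
  have /cvgrPdist_lt/(_ _ h4) dF : F z @[z --> (x, t0)] --> F (x, t0) by exact: cF.
  have [[A B] /= [nA nB] AB] := filterI HF dF.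
  exists (A, B) => // -[x' t] /= [Ax Bt].
  have [E1 h1] := AB (x', t0) (conj Ax (nbhs_singleton nB)).
  have [E2 h2] := AB (x', t) (conj Ax Bt).
  exists (F (x', t0)), (F (x', t)); split=> //.
  move: h1 h2 => /= h1 h2.
  have -> : F (x', t) - F (x', t0) = (F (x, t0) - F (x', t0)) - (F (x, t0) - F (x', t)).
    by rewrite opprB [RHS]addrC addrA subrK.
  by apply: le_lt_trans (ler_normB _ _) _; lra.
apply: filterS H => t H p; have [x <- xb] := T2_box p.
by apply: H => i; have := xb i.
Qed.

(** Closeness is symmetric, so existence of an equivariant lift is an open and
    closed condition on the time; it holds for the identity. *)
Lemma diff0_lift (g : T2 -> T2) : diff0 g -> exists K, equivariant_lift g K.
Proof.
move=> [G [sG _ G0 <-]].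
have ll t : local_lift (G t).
  move=> x0 y0 /(isotopy_local_lift sG)[F [F0 cF HF]].
  have cs : {for x0, continuous (fun x : A2 => (x, t))}.
    have c1 : (fun x : A2 => x) @ x0 --> x0 by exact: cvg_id.
    have c2 : {for x0, continuous (fun _ : A2 => t)} by exact: cst_continuous.
    exact: (cvg_pair c1 c2).
  exists (fun x => F (x, t)); split=> //.
    apply: (@continuous_comp _ _ _ (fun x : A2 => (x, t)) F); last exact: cF.
    exact: cs.
  exact: (cs _ HF).
apply: (@R_clopen R (fun t => exists K, equivariant_lift (G t) K) _ 0 1).
  move=> t; apply: filterS (isotopy_close t sG) => s cl.
  split; apply: close_equivariant_lift => //.
  move=> p; have [y1 [y2 [E1 E2 h]]] := cl p; exists y2, y1; split=> //.
  by rewrite distrC.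
by rewrite G0; exists id; split=> // x; exact: cvg_id.
Qed.

End IsotopyLift.

(** * Failure of smoothness *)

Section Conclusion.
Context {R : realType}.
Local Notation A2 := 'rV[R]_2.
Local Notation L1 := 'rV[R]_1.
Local Notation fib_charts a := (@fib_atlas _ _ _ (E_family R) a).

Lemma diff0_id : @diff0 R id.
Proof.
have T2id : smooth_map (@T2_atlas R) T2_atlas id by exact: st_smooth_id straightened_T2.
exists (fun _ t => t); split=> // [p|t]; last by exists id.
apply: smooth_at_sub (@prod_cover _ _ _ _ _ _ _) (@subset_refl _ _) _.
apply: smooth_at_cover => x0 x1 <- /= /esym /pi2_eq[n ->].
exists (fun z : L1 * A2 => z.2 + zvec n); split=> //.
  apply: smooth_on_near => k.
  by apply: Ck_onD; [exact: openT|exact: smooth_snd|exact: Ck_on_cst].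
by apply: near_everywhere => z; rewrite pi2_transl.
Qed.

Lemma isotopic_refl (m : marked R) : complete_marked m -> isotopic m m.
Proof.
move=> [am _ _ _]; exists id, id; split=> //; last exact: diff0_id.
exact: affine_diffeo_id.
Qed.

(** If [K] lifts the diffeomorphism isotopic to the identity and [k] the marking, then
    [K \o k] lifts the identity of the torus: it is a translation, so the action
    of the marking on the lattice is trivial. *)
Lemma period_isotopic (a : R) (m : marked R) :
  complete_marked m -> isotopic (E_marked a) m -> period m = row2 (- cbrt a) 0.
Proof.
move=> cm [phi [g [aphi /diff0_lift[K [cK piK eqK]] E]]].
have sm : affine_surface (@matlas R m) by case: cm.
have [k [A [sk kA fE dA]]] := lift_marking (fibre_cover_diffeo sm aphi) cm.
have kK x : pi2 (K (k x)) = pi2 x.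
  have [_ [f [fK _ _ _]] _ _] := cm; apply: (can_inj fK).
  by rewrite [RHS]fE piK -E /= E_marking_pi2.
have ck : continuous k by exact: continuous_smooth.
pose e (x : A2) : A2 := K (k x) - x.
have ce : continuous e.
  move=> x; apply: (@continuousB _ A2 A2 (fun x => K (k x)) id); last exact: cvg_id.
  by apply: (@continuous_comp _ _ _ k K); [exact: ck|exact: cK].
have ez x : exists n, e x = zvec n.
  by have /pi2_eq[n En] := esym (kK x); exists n; rewrite /e En addrC addKr.
have ec x y : e x = e y.
  apply: locally_constant => z; apply: lattice_valued_locally_constant (ce z).
  exact: near_everywhere.
have nA (n : 'rV[int]_2) : n *m A = n.
  apply: (@zvec_inj R); have := ec (0 + zvec n) 0; rewrite /e kA eqK add0r subr0.
  by rewrite -addrA -[RHS]addr0 => /addrI/eqP; rewrite subr_eq0 => /eqP.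
have A1 : A = 1%:M by apply/row_matrixP => i; rewrite -[LHS]mulmx1 !rowE mulmx1 nA mulmx1.
rewrite (period_marking sm aphi sk kA fE dA) A1 det1 !mxE mul1r /=.
by apply: row2P; rewrite !mxE /= ?mulr1 ?mulr0.
Qed.

Lemma Dc_period_E (a : R) : Dc_period (iso_class (E_marked a)) = row2 (- cbrt a) 0.
Proof.
have cE := fibre_complete_marked a.
apply: xget_eq => [|v [m [cm im] ->]]; last exact: period_isotopic.
by exists (E_marked a); [split=> //; exact: isotopic_refl|rewrite period_E_marked].
Qed.

(** For [h = e ^+ 3] the difference quotient has norm at least [e ^- 2], which is
    unbounded. *)
Lemma cbrt_growth_not_derivable (V : normedModType R) (f : V -> A2) (x v : V) :
  derivable f x v -> (forall h, `|cbrt h| <= `|f (h *: v + x) - f x|) -> False.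
Proof.
move=> df fh; pose l := 'D_v f x.
have /cvgrPdist_lt/(_ 1 ltr01) : h^-1 *: (f (h *: v + x) - f x) @[h --> 0^'] --> l.
  exact: df.
move=> /nbhs_ballP[d /= d0 H].
pose M := `|l| + 1; have M0 : 0 < M by rewrite ltr_wpDl.
pose u := Num.min (Num.min 1 d) M^-1; pose e := u / 2.
have u0 : 0 < u by rewrite !lt_min ltr01 d0 invr_gt0.
have e0 : 0 < e by rewrite divr_gt0.
have eu : e < u by rewrite ltr_pdivrMr// ltr_pMr// ltr1n.
have [e1 ed eM] : [/\ e < 1, e < d & e < M^-1].
  by move: eu; rewrite !lt_min => /andP[/andP[]].
have h0 : 0 < e ^+ 3 by rewrite exprn_gt0.
have he : e ^+ 3 <= e by rewrite exprS ler_piMr ?exprn_ile1 ?(ltW e0) ?(ltW e1).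
have := H (e ^+ 3); rewrite /ball/= sub0r normrN gtr0_norm//.
move=> /(_ (le_lt_trans he ed) (lt0r_neq0 h0)) /= hl.
have := fh (e ^+ 3); rewrite -(cbrt_unique erefl) gtr0_norm//.
set w := f _ - _ in hl *; apply/negP; rewrite -ltNge.
have : `|(e ^+ 3)^-1 *: w| < M.
  rewrite -[_ *: w](subKr l); apply: le_lt_trans (ler_normB _ _) _.
  by rewrite /M ltrD2l.
rewrite normrZ gtr0_norm ?invr_gt0// ltr_pdivrMl// => /lt_le_trans; apply.
rewrite exprS -mulrA -[leRHS]mulr1 ler_pM2l// expr2 -mulrA.
have eM1 : e * M <= 1 by rewrite -ler_pdivlMr// div1r ltW.
apply: le_trans eM1; rewrite ler_piMl ?(ltW e1)//.
by rewrite mulr_ge0 ?(ltW e0) ?(ltW M0).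
Qed.

Lemma Dc_period_not_smooth :
  ~ smooth_near (fun a : R^o => Dc_period (iso_class (E_marked a))) 0.
Proof.
move=> /(@smooth_near_derivable _ _ _ _ _ (1 : R^o)) /cbrt_growth_not_derivable; apply=> h.
rewrite !Dc_period_E addr0 [h *: _]mulr1.
have := @A2_norm_coord R (row2 (- cbrt h) 0 - row2 (- cbrt 0) 0) 0.
rewrite mxE row2_0 mxE row2_0 (_ : cbrt 0 = 0); last by apply/eqP; rewrite cbrt_eq0.
by rewrite oppr0 subr0 normrN.
Qed.

(** The lower bound on the period holds for every marking, in particular for any
    smooth choice of markings of the fibres. *)
Lemma E_not_induced : ~ induced_by_smooth_map line_atlas (E_family R).
Proof.
move=> [F [_ sF [mu [_ _ cmu] Fmu]]].
have bound a : `|cbrt a| <= `|Dc_period (F a)| /\ (a = 0 -> Dc_period (F a) = 0).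
  have cm : complete_marked (marked_fibre (mu a)) by exact: cmu.
  rewrite /Dc_period; case: xgetP => [v _ []|none].
    rewrite Fmu => m [cm' [phi [g [aphi _ _]]]] ->.
    exact: period_bound aphi.
  exfalso; apply: (none (period (marked_fibre (mu a)))).
  exists (marked_fibre (mu a)) => //; rewrite Fmu; split=> //.
  exact: isotopic_refl.
pose c : chart A2 A2 := Chart setT id id.
have ac : vec_atlas A2 c by split=> //; split=> //=; rewrite image_id; exact: openT.
have [//|//|_ /=] := sF 0 line_chart c line_chart_atlas ac.
move=> /(@smooth_near_derivable _ _ _ _ _ (const_mx 1)) /cbrt_growth_not_derivable.
apply=> h; rewrite !mxE mulr1 addr0.
by have [_ ->//] := bound 0; rewrite subr0; have [] := bound h.
Qed.

End Conclusion.

Theorem mainTheorem4 (R : realType) :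
  ~ (forall (B : Type) (n : nat) (aB : set (chart B 'rV[R]_n))
       (X : torus_family B n),
       differentiable_family aB X -> induced_by_smooth_map aB X)
  /\
  [/\ smooth_map (prod_atlas line_atlas (vec_atlas 'rV[R]_2))
        (vec_atlas 'rV[R]_2) (fun z => Phi z.1 z.2),
      forall a : R, developing_map (Phi a) (hol a) /\ diffeo (Phi a),
      differentiable_family line_atlas (E_family R),
      trivialization line_atlas (E_family R) setT E_marking
    & forall a : R, complete_dev (E_marked a) (Phi a) (hol a) /\
        forall x, mmap (E_marked a) (pi2 x) = E_fib_cls a (Phi a x)]
  /\
  [/\ forall a : R, Dc (iso_class (E_marked a)),
      forall a : R, period (E_marked a) = row2 (- cbrt a) 0,
      forall a : R, Dc_period (iso_class (E_marked a)) = row2 (- cbrt a) 0,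
      ~ smooth_near (fun a : R^o => Dc_period (iso_class (E_marked a))) 0
    & ~ induced_by_smooth_map line_atlas (E_family R)].
Proof.
split; last split.
- by move=> /(_ _ _ _ _ (@E_differentiable R)); exact: E_not_induced.
- split.
  + exact: smooth_map_Phi.
  + by move=> a; split; [exact: developing_Phi|exact: diffeo_Phi].
  + exact: E_differentiable.
  + exact: E_trivialization.
  + by move=> a; split; [exact: fibre_complete_dev|exact: E_marking_pi2].
- split.
  + by move=> a; exists (E_marked a); first exact: fibre_complete_marked.
  + exact: period_E_marked.
  + exact: Dc_period_E.
  + exact: Dc_period_not_smooth.
  + exact: E_not_induced.
Qed.
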